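(* Let $R$ be a commutative Noetherian ring, $p_1,\ldots,p_n\in R$, $\mathcal F$ a fan in $\mathbb R^2$, and $f_1,\ldots,f_n$ fan linear functions on $\mathcal F$; write $\mathbf f=(f_1,\dots,f_n)$, $\mathbf p=(p_1,\dots,p_n)$. Let $\mathcal B_{\mathbf f,\mathcal F,\mathbf p}$ be the associated fan algebra. If $|\mathcal F|$ is a proper rational cone contained in $\mathbb R^2$, then there exists $M\in\mathbb N$ (namely the number of elements of $\mathcal H$, the union of the Hilbert bases of the maximal cones of $\mathcal F$) such that the following is a $\mathbb Z^2$-graded resolution of $\mathcal B_{\mathbf f,\mathcal F,\mathbf p}$ over $R[\mathbf Y]$: $$0\to R[\mathbf Y]^{M-2}\xrightarrow{\varphi_{M-2}}\cdots\to R[\mathbf Y]^{3\binom{M-1}{4}}\xrightarrow{\varphi_3}R[\mathbf Y]^{2\binom{M-1}{3}}\xrightarrow{\varphi_2}R[\mathbf Y]^{\binom{M-1}{2}}\xrightarrow{\varphi_1}R[\mathbf Y]\xrightarrow{\varphi_0}\mathcal B_{\mathbf f,\mathcal F,\mathbf p}\to 0,$$ where $\varphi_j:R[\mathbf Y]^{j\binom{M-1}{j+1}}\to R[\mathbf Y]^{(j-1)\binom{M-1}{j}}$ for $j\ge 2$, $\varphi_1:R[\mathbf Y]^{\binom{M-1}{2}}\to R[\mathbf Y]$ and $\varphi_0$ are the maps described in the context. The resolution is minimal graded over $R[\mathbf Y]$ if $R$ is $*$-local with maximal ideal $\mathfrak m$, $\mathbf f$ is strict with respect to $\mathcal F$,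 none of the $p_i$ is a zero divisor in $R$, and all of them belong to $\mathfrak m$. Here $R[\mathbf Y]$ is regarded as graded with the induced $\mathbb Z$-grading.
   Context: Conventions: $\mathbb N=\{0,1,2,\dots\}$. A fan $\mathcal F$ in $\mathbb R^2$ is a finite collection of strongly convex rational polyhedral cones, closed under taking faces, any two of which intersect in a common face; $|\mathcal F|$ is the union of its cones and is always assumed convex. A proper rational cone is a convex rational polyhedral cone that is neither the whole space nor contained in a line. A function $f:|\mathcal F|\cap\mathbb Z^2\to\mathbb N$ is fan linear if it is $\mathbb N$-linear on the lattice points of each cone of $\mathcal F$ and $f(u+v)\le f(u)+f(v)$ for all $u,v\in|\mathcal F|\cap\mathbb Z^2$. Let $C_1,\dots,C_\ell$ be the maximal cones of $\mathcal F$ sorted clockwise, $\mathcal H_i$ the (unique) Hilbert basis of the monoid $C_i\cap\mathbb Z^2$, $\mathcal H=\bigcup_i\mathcal H_i=\{\mathbf v_1,\dots,\mathbf v_M\}$ sorted clockwise, and $Y_i=Y_{\mathbf v_i}$ variables, one for each element of $\mathcal H$, $\mathbf Y=(Y_1,\dots,Y_M)$. $\mathbf f$ is strict with respect to $\mathcal F$ if for each $1\le i<\ell$ there is $k_i\in\{1,\dots,n\}$ such that $f_{k_i}$ is not linear on $C_i\cup C_{i+1}$. Write $\mathbf p^{(c_1,\dots,c_n)}=p_1^{c_1}\cdots p_n^{c_n}$. The fan algebra is $$\mathcal B_{\mathbf f,\mathcal F,\mathbf p}=\sum_{\mathbf v\in|\mathcal F|\cap\mathbb Z^2}\langle\mathbf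 p^{\mathbf f(\mathbf v)}\rangle\,\mathbf x^{\mathbf v}\subset R[x_1^{\pm1},x_2^{\pm1}],$$ and $\varphi_0:R[\mathbf Y]\to\mathcal B_{\mathbf f,\mathcal F,\mathbf p}$ is the surjective $R$-algebra map $Y_{\mathbf v}\mapsto\mathbf p^{\mathbf f(\mathbf v)}\mathbf x^{\mathbf v}$. It is $\mathbb Z^2$-graded with $\deg Y_{\mathbf v}=\mathbf v$, $\deg r=(0,0)$ for $r\in R$. Two elements of $\mathcal H$ are adjacent if they are consecutive in the clockwise order. For non-adjacent $\mathbf v_i,\mathbf v_j$ ($i+1<j$) write $\mathbf v_i+\mathbf v_j=\alpha\mathbf w+\alpha'\mathbf w'$ with $\mathbf w,\mathbf w'\in\mathcal H$ adjacent, $\alpha,\alpha'\in\mathbb N$, and set $\mathbf S_{i,j}=Y_iY_j-\mathbf p^{\gamma}Y_{\mathbf w}^{\alpha}Y_{\mathbf w'}^{\alpha'}$ where $\gamma=(f_t(\mathbf v_i)+f_t(\mathbf v_j)-f_t(\mathbf v_i+\mathbf v_j))_{t=1,\dots,n}$. Monomials of $R[\mathbf Y]$ are ordered lexicographically with $Y_1\prec\dots\prec Y_M$. Given a monomial order on a free module and an ordered family $g_1,\dots,g_t$ in it with leading coefficients $1$, the induced order on $R[\mathbf Y]^t$ (basis $\tilde e_1,\dots,\tilde e_t$) is: $\mathbf Y^\alpha\tilde e_a\prec\mathbf Y^\beta\tilde e_b$ iff $\mathrm{lm}(\mathbf Y^\alpha g_a)\prec\mathrm{lm}(\mathbf Y^\beta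 g_b)$, or these are equal and $b<a$. For $a<b$ with $\mathrm{lm}(g_a),\mathrm{lm}(g_b)$ on the same basis vector and $X=\mathrm{lcm}(\mathrm{lm}(g_a),\mathrm{lm}(g_b))$, the syzygy attached to $(g_a,g_b)$ is $\frac{X}{\mathrm{lm}(g_a)}\tilde e_a-\frac{X}{\mathrm{lm}(g_b)}\tilde e_b-\sum_\nu F_\nu\tilde e_\nu$, where $\sum_\nu F_\nu g_\nu$ is the result (with remainder $0$) of dividing the S-polynomial $\frac{X}{\mathrm{lm}(g_a)}g_a-\frac{X}{\mathrm{lm}(g_b)}g_b$ by $g_1,\dots,g_t$ with the division algorithm, always dividing by the $g_\nu$ of maximal index $\nu$ among those whose leading monomial divides the current leading monomial. For $u\ge0$ let $S_u$ be the set of tuples $(i,j,k_1,\dots,k_u)$ with $1\le i<j-1\le M-1$, $i<k_1<\dots<k_u\le M$, all $k_m\notin\{j-1,j\}$; it has $(u+1)\binom{M-1}{u+2}$ elements. For each $u\ge0$ let $R[\mathbf Y]^{(u+1)\binom{M-1}{u+2}}$ have basis $e_{(i,j,k_1,\dots,k_u)}$ indexed by $S_u$ sorted lexicographically. Define $\varphi_1(e_{(i,j)})=\mathbf S_{i,j}$. For $(i,j,k)\in S_1$ let $s_{i,j,k}$ be the syzygy attached to $(\mathbf S_{i,j},\mathbf S_{i,k})$ if $j<k$ and to $(\mathbf S_{i,j},\mathbf S_{k,j})$ if $k<j$; for $u\ge2$ let $s_{i,j,k_1,\dots,k_u}$ be the syzygy attached to the pair $(s_{i,j,k_1,\dots,k_{u-2},k_{u-1}},\,s_{i,j,k_1,\dots,k_{u-2},k_u})$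 inside the lexicographically sorted family of all $s_{i',j',k'_1,\dots,k'_{u-1}}$; at each level the free module carries the order induced by the family at the previous level. Define $\varphi_{u+1}(e_{(i,j,k_1,\dots,k_u)})=s_{i,j,k_1,\dots,k_u}$ for $u\ge1$. The $\mathbb Z^2$-degree of $e_{(i,j,k_1,\dots,k_u)}$ is $\mathbf v_i+\mathbf v_j+\mathbf v_{k_1}+\dots+\mathbf v_{k_u}$. A graded ring is $*$-local if it has a unique maximal graded (i.e. $*$-maximal) ideal. The induced $\mathbb Z$-grading on $R[\mathbf Y]$ gives a monomial the sum of its exponents as degree and elements of $R$ degree $0$; the corresponding maximal ideal of $R[\mathbf Y]$ is $(\mathfrak m,\mathbf Y)$. ''Minimal graded'' means that $\ker\varphi_0\subseteq(\mathfrak m,\mathbf Y)$ and $\ker\varphi_j\subseteq(\mathfrak m,\mathbf Y)R[\mathbf Y]^{j\binom{M-1}{j+1}}$ for all $j\ge1$.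
   Formalization: The inclusion of ker φ_0 in im φ_1 (exactness at R[Y]) is stated only when no p_i is a zero divisor in R; without this it fails, e.g. R a field, p_1 = 0, first-quadrant fan, f_1(a,b) = a+b. The rest holds for arbitrary p_i, with R nonzero. *)

(* Defs.v *)
From HB Require Import structures.
From mathcomp Require Import all_boot all_order all_algebra.
From mathcomp Require Import finmap.
From mathcomp Require Import boolp classical_sets cardinality reals.
From mathcomp.multinomials Require monalg.
From mathcomp.multinomials Require Import mpoly.

Set Implicit Arguments.
Unset Strict Implicit.
Unset Printing Implicit Defensive.

Import Order.TTheory GRing.Theory Num.Theory.

Local Open Scope ring_scope.
Local Open Scope classical_set_scope.

(* The Laurent polynomial ring R[x_1^{+-1}, x_2^{+-1}], as the group algebra
   of Z^2 on the free module {malg R[int * int]}.  The ring structure which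
   monalg puts on {malg R[K]} is not available, because a monomType has no
   invertible element besides 1. *)

Definition lattice : Type := (int * int)%type.
HB.instance Definition _ := GRing.Zmodule.on lattice.

Definition laurent (R : comNzRingType) : Type := @monalg.malg lattice R.

Section LaurentRing.
Import monalg.
Local Open Scope fset_scope.
Local Open Scope ring_scope.
Variable R : comNzRingType.

HB.instance Definition _ := Choice.on (laurent R).
HB.instance Definition _ := GRing.Lmodule.copy (laurent R) {malg R[lattice]}.

Implicit Types (g : laurent R) (u w : lattice).

Definition lcoef u g : R := mcoeff u g.

(* The monomial c x^u. *)
Definition lmon (c : R) u : laurent R := mkmalgU u c.

Definition lmul g1 g2 : laurent R :=
  \sum_(u <- msupp g1) \sum_(w <- msupp g2)
     lmon (lcoef u g1 * lcoef w g2) (u + w).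

Lemma lmonD u : {morph lmon^~ u : c d / c + d}.
Proof. by move=> c d; apply: monalgUD. Qed.

Lemma lmon0 u : lmon 0 u = 0.
Proof. exact: monalgU0. Qed.

Lemma laurentE g : g = \sum_(u <- msupp g) lmon (lcoef u g) u.
Proof. exact: monalgE. Qed.

Lemma lmulw (d1 d2 : {fset lattice}) g1 g2 :
  msupp g1 `<=` d1 -> msupp g2 `<=` d2 ->
  lmul g1 g2 = \sum_(u <- d1) \sum_(w <- d2)
     lmon (lcoef u g1 * lcoef w g2) (u + w).
Proof.
move=> le1 le2; rewrite /lmul (big_fset_incl _ le1) /=.
  apply/eq_bigr=> u _; apply/big_fset_incl => // w _ /mcoeff_outdom h.
  by rewrite /lcoef h mulr0 lmon0.
move=> u _ /mcoeff_outdom h.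
by rewrite big1 // => w _; rewrite /lcoef h mul0r lmon0.
Qed.

Lemma lmulC : commutative lmul.
Proof.
move=> g1 g2; rewrite /lmul exchange_big /=.
by apply/eq_bigr => u _; apply/eq_bigr => w _; rewrite mulrC addrC.
Qed.

Lemma lmulDl : left_distributive lmul +%R.
Proof.
move=> g1 g2 g.
rewrite (@lmulw (msupp g1 `|` msupp g2) (msupp g) (g1 + g2) g) //;
  last exact: msuppD_le.
rewrite (@lmulw (msupp g1 `|` msupp g2) (msupp g) g1 g) ?fsubsetUl //.
rewrite (@lmulw (msupp g1 `|` msupp g2) (msupp g) g2 g) ?fsubsetUr //.
rewrite -big_split /=; apply/eq_bigr => u _.
rewrite -big_split /=; apply/eq_bigr => w _.
by rewrite -lmonD -mulrDl /lcoef mcoeffD.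
Qed.

Lemma lmul0l : left_zero 0 lmul.
Proof. by move=> g; rewrite /lmul msupp0 big_seq_fset0. Qed.

Lemma lmulDr : right_distributive lmul +%R.
Proof. by move=> g g1 g2; rewrite !(lmulC g) lmulDl. Qed.

Lemma lmul0r : right_zero 0 lmul.
Proof. by move=> g; rewrite lmulC lmul0l. Qed.

Lemma lmulUU c d u w : lmul (lmon c u) (lmon d w) = lmon (c * d) (u + w).
Proof.
rewrite (@lmulw [fset u] [fset w]) ?msuppU_le // !big_seq_fset1.
by rewrite /lcoef !mcoeffUU.
Qed.

Lemma lmul_suml (I : Type) (s : seq I) (E : I -> laurent R) g :
  lmul (\sum_(i <- s) E i) g = \sum_(i <- s) lmul (E i) g.
Proof. exact: (big_morph (lmul^~ g) (fun _ _ => lmulDl _ _ _) (lmul0l _)). Qed.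

Lemma lmul_sumr (I : Type) (s : seq I) (E : I -> laurent R) g :
  lmul g (\sum_(i <- s) E i) = \sum_(i <- s) lmul g (E i).
Proof. exact: (big_morph (lmul g) (fun _ _ => lmulDr _ _ _) (lmul0r _)). Qed.

Lemma lmulA : associative lmul.
Proof.
move=> g1 g2 g3; rewrite (laurentE g1) !lmul_suml; apply/eq_bigr => u _.
rewrite (laurentE g2) !(lmul_suml, lmul_sumr); apply/eq_bigr => w _.
rewrite (laurentE g3) !lmul_sumr; apply/eq_bigr => z _.
by rewrite !lmulUU mulrA addrA.
Qed.

Lemma lmul1l : left_id (lmon 1 0) lmul.
Proof.
move=> g; rewrite [g in LHS]laurentE [RHS]laurentE lmul_sumr.
by apply/eq_bigr => u _; rewrite lmulUU mul1r add0r.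
Qed.

Lemma lone_neq0 : lmon 1 0 != 0.
Proof. by rewrite /lmon monalgU_eq0 oner_eq0. Qed.

HB.instance Definition _ := GRing.Zmodule_isComNzRing.Build (laurent R)
  lmulA lmulC lmul1l lmulDl lone_neq0.

Lemma lmonZ (a c : R) u : a *: lmon c u = lmon (a * c) u.
Proof. by apply/malgP => w; rewrite mcoeffZ !mcoeffU mulrnAr. Qed.

Lemma lscaleAl (a : R) (g1 g2 : laurent R) : a *: (g1 * g2) = (a *: g1) * g2.
Proof.
change (a *: lmul g1 g2 = lmul (a *: g1) g2).
rewrite (laurentE g1) lmul_suml !scaler_sumr lmul_suml.
apply/eq_bigr => u _; rewrite (laurentE g2) !lmul_sumr scaler_sumr.
by apply/eq_bigr => w _; rewrite lmonZ !lmulUU lmonZ mulrA.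
Qed.

HB.instance Definition _ :=
  GRing.Lmodule_isLalgebra.Build R (laurent R) lscaleAl.
HB.instance Definition _ := GRing.Lalgebra_isComAlgebra.Build R (laurent R).

End LaurentRing.

Section Ideals.
Variable A : comNzRingType.

Definition is_ideal (I : set A) : Prop :=
  [/\ I 0, forall x y, I x -> I y -> I (x + y) & forall a x, I x -> I (a * x)].

Definition ideal_gen (X : set A) : set A :=
  [set x | exists (k : nat) (a b : 'I_k -> A),
     (forall i, X (b i)) /\ x = \sum_(i < k) a i * b i].

Definition noetherian : Prop :=
  forall I : set A, is_ideal I ->
    exists (k : nat) (b : 'I_k -> A), I = ideal_gen (range b).

Definition homogeneous_components (G : int -> set A) (x : A) (c : int -> A) :=
  (forall d, G d (c d)) /\
  exists s : seq int, [/\ uniq s, forall d, d \notin s -> c d = 0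
                        & x = \sum_(d <- s) c d].

Definition is_Zgrading (G : int -> set A) : Prop :=
  [/\ forall d, G d 0 /\ (forall x y, G d x -> G d y -> G d (x - y)),
      forall d e x y, G d x -> G e y -> G (d + e) (x * y),
      forall x, exists c, homogeneous_components G x c
    & forall x c c', homogeneous_components G x c ->
        homogeneous_components G x c' -> c =1 c'].

Definition is_graded_ideal (G : int -> set A) (I : set A) : Prop :=
  is_ideal I /\
  forall x c, I x -> homogeneous_components G x c -> forall d, I (c d).

Definition is_star_maximal (G : int -> set A) (m : set A) : Prop :=
  [/\ is_graded_ideal G m, ~ m 1
    & forall I, is_graded_ideal G I -> ~ I 1 -> m `<=` I -> I = m].

(* A, graded by G, is *-local and m is its *-maximal ideal. *)
Definition is_star_local (G : int -> set A) (m : set A) : Prop :=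
  is_star_maximal G m /\ forall I, is_star_maximal G I -> I = m.

End Ideals.

Section Fans.
Variable K : realType.

Definition plane : Type := (K^o * K^o)%type.
HB.instance Definition _ := GRing.Lmodule.copy plane (K^o * K^o)%type.

Definition emb (u : lattice) : plane := (u.1%:~R, u.2%:~R).

Definition dot (a x : plane) : K := a.1 * x.1 + a.2 * x.2.

Definition is_rational_cone (C : set plane) : Prop :=
  exists s : seq lattice, C =
    [set x | exists c : 'I_(size s) -> K,
       (forall i, 0 <= c i) /\ x = \sum_(i < size s) c i *: emb s`_i].

Definition strongly_convex (C : set plane) : Prop :=
  forall x, C x -> C (- x) -> x = 0.

Definition is_face (T C : set plane) : Prop :=
  exists a, (forall x, C x -> 0 <= dot a x) /\ T = [set x | C x /\ dot a x = 0].

Definition fan_support (F : set (set plane)) : set plane :=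
  [set x | exists2 C, F C & C x].

Definition convex_set (D : set plane) : Prop :=
  forall x y (t : K), D x -> D y -> 0 <= t -> t <= 1 ->
    D (t *: x + (1 - t) *: y).

Definition is_fan (F : set (set plane)) : Prop :=
  [/\ finite_set F,
      forall C, F C -> is_rational_cone C /\ strongly_convex C,
      forall C T, F C -> is_face T C -> F T,
      forall C D, F C -> F D -> is_face (C `&` D) C /\ is_face (C `&` D) D
    & convex_set (fan_support F)].

Definition proper_rational_cone (C : set plane) : Prop :=
  [/\ is_rational_cone C, C <> setT
    & ~ exists (a : plane) (b : K), a <> 0 /\ forall x, C x -> dot a x = b].

Definition linear_on (D : set plane) (f : lattice -> nat) : Prop :=
  forall (u w : lattice) (a b : nat), D (emb u) -> D (emb w) ->
    f (u *+ a + w *+ b)%R = (a * f u + b * f w)%N.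

(* Values of f outside of the support of the fan are irrelevant. *)
Definition fan_linear (F : set (set plane)) (f : lattice -> nat) : Prop :=
  (forall C, F C -> linear_on C f) /\
  (forall u w, fan_support F (emb u) -> fan_support F (emb w) ->
     (f (u + w)%R <= f u + f w)%N).

Definition maximal_cone (F : set (set plane)) (C : set plane) : Prop :=
  F C /\ forall D, F D -> C `<=` D -> D = C.

Definition monoid_generated (X : set lattice) : set lattice :=
  [set u | exists s : seq lattice,
     (forall w, w \in s -> X w) /\ u = \sum_(w <- s) w].

(* X is a minimal generating set of the submonoid S of Z^2. *)
Definition is_hilbert_basis (S X : set lattice) : Prop :=
  monoid_generated X = S /\
  forall Y : set lattice, Y `<=` X -> monoid_generated Y = S -> Y = X.

Definition fan_hilbert (F : set (set plane)) : set lattice :=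
  [set u | exists C X, [/\ maximal_cone F C,
     is_hilbert_basis [set w | C (emb w)] X & X u]].

(* Negative iff w is obtained from u by a clockwise turn of an angle which
   lies strictly between 0 and pi. *)
Definition det2 (V : comNzRingType) (u w : V * V) : V :=
  u.1 * w.2 - u.2 * w.1.

(* As the cone spanned by X is contained in a half-plane, the angle between
   any two of its vectors is at most pi; hence comparing consecutive vectors
   gives the clockwise order, also when the cone is a half-plane, in which
   case the first and the last vector are opposite. *)
Definition is_clockwise_enum (X : set lattice) (v : seq lattice) : Prop :=
  [/\ uniq v, forall u, u \in v <-> X u
    & sorted (fun u w : int * int => det2 u w < 0) v].

(* For two-dimensional cones with disjoint interiors in a half-plane. *)
Definition cone_before (C D : set plane) : Prop :=
  forall x y : K * K, C x -> D y -> det2 x y <= 0.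

Definition is_clockwise_cones (F : set (set plane)) (Cs : seq (set plane)) :=
  (forall D, maximal_cone F D <->
     exists2 i : nat, (i < size Cs)%N & D = nth set0 Cs i) /\
  (forall i j : nat, (i < j)%N -> (j < size Cs)%N ->
     cone_before (nth set0 Cs i) (nth set0 Cs j)).

Definition strict (F : set (set plane)) (n : nat)
    (f : 'I_n -> lattice -> nat) : Prop :=
  exists Cs : seq (set plane), is_clockwise_cones F Cs /\
    forall i : nat, (i.+1 < size Cs)%N ->
      exists k : 'I_n,
        ~ linear_on (nth set0 Cs i `|` nth set0 Cs i.+1) (f k).

Definition ppow (R : comNzRingType) n (p : 'I_n -> R) (c : 'I_n -> nat) : R :=
  \prod_(t < n) p t ^+ c t.

Definition fan_algebra (R : comNzRingType) n (p : 'I_n -> R)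
    (f : 'I_n -> lattice -> nat) (F : set (set plane)) : set (laurent R) :=
  [set g | forall u,
     (fan_support F (emb u) ->
        ideal_gen [set ppow p (f^~ u)] (lcoef u g)) /\
     (~ fan_support F (emb u) -> lcoef u g = 0)].

End Fans.

(* The basis of the free module in homological degree j: for j = u + 1 it is
   the set S_u of tuples (i, j, k_1, ..., k_u), for j = 0 it is the singleton
   of the empty tuple.  Indices start from 0. *)

Definition basis_len (j : nat) : nat := if j is u.+1 then u.+2 else 0.

Definition is_basis_seq (s : seq nat) : bool :=
  match s with
  | [::] => true
  | [:: _] => false
  | i :: j :: ks =>
      [&& i.+1 < j, path ltn i ks & all (fun k => (k != j.-1) && (k != j)) ks]%N
  end.

Definition idx (M j : nat) : finType :=
  {t : (basis_len j).-tuple 'I_M | is_basis_seq (map val t)}.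

Definition idx_seq (M j : nat) (t : idx M j) : seq 'I_M := tval (val t).

Fixpoint lex_lt (s t : seq nat) : bool :=
  match s, t with
  | x :: s', y :: t' => ((x < y) || ((x == y) && lex_lt s' t'))%N
  | _, _ => false
  end.

Definition idx_lt (M j : nat) (s t : idx M j) : bool :=
  lex_lt (map val (idx_seq s)) (map val (idx_seq t)).

(* Lexicographic order with Y_0 < ... < Y_(M-1). *)
Definition mnm_lt (M : nat) (a b : 'X_{1..M}) : bool :=
  [exists i : 'I_M, (a i < b i)%N
     && [forall k : 'I_M, (i < k)%N ==> (a k == b k)]].

Section FreeModules.
Variables (R : comNzRingType) (M : nat).

Notation poly := {mpoly R[M]}.

Definition free_mod (J : finType) : Type := {ffun J -> poly^o}.
HB.instance Definition _ J := GRing.Lmodule.copy (free_mod J) {ffun J -> poly^o}.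

Definition basis_vec (J : finType) (t : J) : free_mod J :=
  [ffun s => (s == t)%:R].

Definition term (J : finType) : Type := ('X_{1..M} * J)%type.

Definition term_order (J : finType) := term J -> term J -> Prop.

Definition tcoef (J : finType) (h : free_mod J) (x : term J) : R :=
  (h x.2 : poly)@_x.1.

Definition is_lm (J : finType) (ord : term_order J) (h : free_mod J)
    (x : term J) : Prop :=
  tcoef h x <> 0 /\ forall y, tcoef h y <> 0 -> y <> x -> ord y x.

Section Family.
Variables (I J : finType) (ltI : rel I) (ord : term_order J).
Variable g : I -> free_mod J.

Definition induced_order : term_order I := fun x y =>
  exists x' y', [/\ is_lm ord (('X_[x.1] : poly) *: g x.2) x',
                    is_lm ord (('X_[y.1] : poly) *: g y.2) y'
                  & ord x' y' \/ (x' = y' /\ ltI y.2 x.2)].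

Definition monic_family : Prop :=
  forall i, exists2 x, is_lm ord (g i) x & tcoef (g i) x = 1.

(* [divides_to h q]: the division algorithm applied to h by the family g,
   whose leading coefficients are 1, stops with remainder 0 and with the
   quotients q; at each step the divisor is the g_i of maximal index i among
   those whose leading monomial divides the current leading monomial. *)
Inductive divides_to : free_mod J -> free_mod I -> Prop :=
| divides_to_zero : divides_to 0 0
| divides_to_step h q x i m :
    is_lm ord h x -> is_lm ord (g i) (m, x.2) -> (m <= x.1)%MM ->
    (forall i' m', is_lm ord (g i') (m', x.2) -> (m' <= x.1)%MM ->
       i' = i \/ ltI i' i) ->
    let c : poly := tcoef h x *: 'X_[x.1 - m] in
    divides_to (h - c *: g i) q ->
    divides_to h (c *: basis_vec i + q).

(* s is the syzygy attached to (g_a, g_b). *)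
Definition is_syzygy (a b : I) (s : free_mod I) : Prop :=
  exists (ma mb : 'X_{1..M}) (j : J) (q : free_mod I),
    [/\ is_lm ord (g a) (ma, j), is_lm ord (g b) (mb, j)
      & let ca : poly := 'X_[mlcm ma mb - ma] in
        let cb : poly := 'X_[mlcm ma mb - mb] in
        divides_to (ca *: g a - cb *: g b) q /\
        s = ca *: basis_vec a - cb *: basis_vec b - q].

End Family.

(* [F j t] is the image under phi_(j + 1) of the basis vector e_t. *)
Definition families : Type :=
  forall j : nat, idx M j.+1 -> free_mod (idx M j).

Fixpoint order_at (F : families) (j : nat) : term_order (idx M j) :=
  match j with
  | 0 => fun x y => mnm_lt x.1 y.1
  | j'.+1 => induced_order (@idx_lt M j'.+1) (@order_at F j') (F j')
  end.

(* The pair of tuples attached to (i, j, k_1, ..., k_u), u > 0. *)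
Definition syz_pair (s : seq 'I_M) : seq 'I_M * seq 'I_M :=
  match s with
  | [:: i; j; k] =>
      ([:: i; j], if (j < k)%N then [:: i; k] else [:: k; j])
  | _ => let u := size s in (take u.-1 s, take u.-2 s ++ drop u.-1 s)
  end.

Variables (n : nat) (p : 'I_n -> R) (f : 'I_n -> lattice -> nat).
Variable v : M.-tuple lattice.

(* P is S_(i,j); the adjacent w, w' are v_k and v_(k + 1). *)
Definition is_Sij (i j : 'I_M) (P : poly) : Prop :=
  exists (k k' : 'I_M) (a b : nat), [/\ k' = k.+1 :> nat,
    tnth v i + tnth v j = tnth v k *+ a + tnth v k' *+ b
  & P = 'X_i * 'X_j
        - ppow p (fun t => f t (tnth v i) + f t (tnth v j)
                           - f t (tnth v i + tnth v j)%R)%N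
          *: ('X_k ^+ a * 'X_k' ^+ b)].

(* The free module R[Y]^{idx M 0} of rank one is R[Y]. *)
Definition are_resolution_families (F : families) : Prop :=
  [/\ forall (t : idx M 1) (i j : 'I_M), idx_seq t = [:: i; j] ->
        exists2 P, is_Sij i j P & F 0%N t = [ffun => P],
      forall j, monic_family (@order_at F j) (F j)
    & forall j (t : idx M j.+2), exists a b : idx M j.+1,
        (idx_seq a, idx_seq b) = syz_pair (idx_seq t) /\
        is_syzygy (@idx_lt M j.+1) (@order_at F j) (F j) a b (F j.+1 t)].

Definition phi0 : poly -> laurent R :=
  mmap (in_alg (laurent R))
    (fun i => lmon (ppow p (f^~ (tnth v i))) (tnth v i)).

(* [phi F j] is the R[Y]-linear map phi_(j + 1). *)
Definition phi (F : families) (j : nat) (h : free_mod (idx M j.+1)) :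
    free_mod (idx M j) :=
  \sum_t (h t : poly) *: F j t.

Definition mnm_deg2 (m : 'X_{1..M}) : lattice := \sum_(i < M) tnth v i *+ m i.

Definition idx_deg2 (j : nat) (t : idx M j) : lattice :=
  \sum_(k <- idx_seq t) tnth v k.

Definition homog2 (j : nat) (u : lattice) (h : free_mod (idx M j)) : Prop :=
  forall t m, tcoef h (m, t) <> 0 -> mnm_deg2 m + idx_deg2 t = u.

Definition is_Z2_graded (F : families) : Prop :=
  (forall u (P : poly), (forall m, P@_m <> 0 -> mnm_deg2 m = u) ->
     forall w, w <> u -> lcoef w (phi0 P) = 0) /\
  (forall j u h, homog2 u h -> homog2 u (@phi F j h)).

(* The ideal (m, Y) of R[Y]; a vector lies in (m, Y) R[Y]^J iff its
   coordinates lie in (m, Y). *)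
Definition mY (m : set R) : set poly :=
  ideal_gen [set P | (exists2 c, m c & P = c%:MP) \/ exists i, P = 'X_i].

Definition is_minimal (F : families) (m : set R) : Prop :=
  (forall P, phi0 P = 0 -> mY m P) /\
  (forall j h, @phi F j h = 0 -> forall t, mY m (h t)).

End FreeModules.

Arguments phi {R M} F j h.
Arguments order_at {R M} F j _ _.

(* Main.v *)
(* The fan algebra is a quotient (by zero, if no p_t is a zero divisor) of the
   free R-module with basis e_u, u in the lattice points of the support, and
   product e_u e_w = p^(f u + f w - f (u + w)) e_(u + w).  The monomials in two adjacent
   variables are exactly the lexicographically smallest monomials of their
   Z^2-degree, and have pairwise distinct degrees; therefore a polynomial which
   vanishes in this free module has a leading monomial divisible by some Y_i Y_j with
   i + 1 < j, so the S_(i,j) form a Groebner basis.  Schreyer's theorem then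
   produces the higher syzygies: the leading term of s_(i,j,k_1,...,k_u) is
   Y_(k_u) e_(i,j,k_1,...,k_(u-1)), and a coincidence of two leading terms of the
   previous level forces divisibility by one of these.  The ranks come from
   sum_i (M-i-2) C(M-i-3, j) = (j+1) C(M-1, j+2).

   Minimality propagates through the levels since the leading coefficients are 1
   and the leading terms are linear: the constant coefficients of a syzygy are
   forced into the ideal m one after the other, from large to small leading
   terms.  It starts with the S_(i,j), where strictness makes p^gamma a multiple
   of some p_t as soon as v_i + v_j is 0 or an element of the Hilbert bases. *)

Require Import Defs.
From mathcomp Require Import all_boot all_order all_algebra.
From mathcomp Require Import finmap.
From mathcomp Require Import boolp classical_sets cardinality reals.
From mathcomp.multinomials Require monalg.
From mathcomp.multinomials Require Import mpoly.
From mathcomp Require Import zify ring lra.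

Set Implicit Arguments.
Unset Strict Implicit.
Unset Printing Implicit Defensive.

Import Order.TTheory GRing.Theory Num.Theory.

Local Open Scope ring_scope.
Local Open Scope classical_set_scope.

(** * Lexicographic and induced orders *)

(** The free module with basis e_u, called the comparison module below, is never built as a ring:
    its coordinates are the functionals [wsum (kappa u)], and it suffices that their common kernel
    is an ideal. Under [phi0] the coordinate at u gets multiplied by p^(f u); only there can zero
    divisors among the p_t enlarge the kernel. The algebra sees the fan only through [good_chain].
    Its geometric source is a gluing: the Hilbert basis of a plane cone is a unimodular chain of
    minimal length, and a basis vector of one maximal cone that lies in another also belongs to the
    basis of the latter. So the bases merge into one list with determinant -1 between neighbours.
    The obstacle in the geometry is a support that is a half-plane. Its first and last basis vectors
    are opposite, so their determinant vanishes and no longer orders them, and their sum is 0. This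
    accounts for the auxiliary direction [e] of the sorting, the exception in [cb_lt] and the second
    case of [flat_between]. *)

Section MonomialOrder.
Variable M : nat.
Implicit Types a b c m : 'X_{1..M}.

Lemma mnm_ltP a b : reflect
  (exists i : 'I_M, (a i < b i)%N /\ forall k : 'I_M, (i < k)%N -> a k = b k)
  (mnm_lt a b).
Proof.
apply: (iffP existsP) => [[i /andP[lt /forallP eq]]|[i [lt eq]]]; exists i.
  by split=> // k ik; apply/eqP; have := eq k; rewrite ik.
by rewrite lt; apply/forallP => k; apply/implyP => /eq ->.
Qed.

Lemma mnm_lt_irr a : ~ mnm_lt a a.
Proof. by case/mnm_ltP => i []; rewrite ltnn. Qed.

Lemma mnm_lt_trans b a c : mnm_lt a b -> mnm_lt b c -> mnm_lt a c.
Proof.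
move=> /mnm_ltP[i [lti eqi]] /mnm_ltP[j [ltj eqj]]; apply/mnm_ltP.
case: (ltngtP i j) => [ij|ji|/val_inj ij].
- by exists j; rewrite eqi //; split=> // k jk; rewrite eqi ?eqj ?(ltn_trans ij).
- by exists i; rewrite -eqj //; split=> // k ik; rewrite eqi ?eqj ?(ltn_trans ji).
- exists i; move: ltj; rewrite -ij => ltj; split; first exact: ltn_trans lti ltj.
  by move=> k ik; rewrite eqi ?eqj -?ij.
Qed.

Lemma mnm_lt_total a b : a <> b -> mnm_lt a b \/ mnm_lt b a.
Proof.
move=> ab; pose P := [pred i : 'I_M | a i != b i].
have [i0 Pi0] : exists i, P i.
  apply/existsP; apply: contra_notT ab => /existsPn eq.
  by apply/mnmP => i; apply/eqP; have := eq i; rewrite negbK.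
case: (arg_maxnP (fun i : 'I_M => val i) Pi0) => i Pi maxi.
have eq (k : 'I_M) : (i < k)%N -> a k = b k.
  by move=> ik; apply/eqP; apply: contraTT ik => /maxi; rewrite -leqNgt.
move: Pi; rewrite inE neq_ltn => /orP[] lt; [left|right]; apply/mnm_ltP; exists i;
  by split=> // k /eq ->.
Qed.

Lemma mnm_lt_add m a b : mnm_lt (m + a) (m + b) = mnm_lt a b.
Proof.
apply/mnm_ltP/mnm_ltP => -[i [lt eq]]; exists i; move: lt; rewrite !mnmDE ltn_add2l.
  by move=> lt; split=> // k /eq; rewrite !mnmDE => /addnI.
by move=> lt; split=> // k /eq; rewrite !mnmDE => ->.
Qed.

(** [ltk k] keeps only the comparisons decided at an index below [k]. A descent for [ltk k.+1]
    either lowers the exponent at [k], which can happen only finitely often, or leaves it fixed and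
    is a descent for [ltk k]. *)
Lemma mnm_lt_wf : well_founded (fun a b => mnm_lt a b).
Proof.
pose ltk k a b := exists i : 'I_M, [/\ (i < k)%N, (a i < b i)%N
                                 & forall l : 'I_M, (i < l)%N -> a l = b l].
suff wf k : well_founded (ltk k).
  move=> a; elim/(well_founded_ind (wf M)): a => a IHa; split=> b.
  by case/mnm_ltP=> i [lt eq]; apply: IHa; exists i; rewrite ltn_ord.
elim: k => [|k IHk] a; first by split=> b [i [/[!ltn0]]].
have [kM|Mk] := ltnP k M; last first.
  elim/(well_founded_ind IHk): a => a IHa; split=> b [i [_ lt eq]].
  by apply: IHa; exists i; rewrite (leq_trans (ltn_ord i)).
pose k' := Ordinal kM.
have [N le] := ubnP (a k'); elim: N a le => [a|N IHN a]; first by rewrite ltn0.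
rewrite ltnS => le.
elim/(well_founded_ind IHk): a le => a IHa le; split=> b [i [ik lt eq]].
move: ik; rewrite ltnS leq_eqVlt => /orP[/eqP ik|ik].
  have ii : i = k' by apply: val_inj.
  by apply: IHN; rewrite -ii; apply: leq_trans lt _; rewrite ii.
by apply: IHa; [exists i | rewrite eq].
Qed.

End MonomialOrder.

Section TermOrders.
Variables (M : nat).

Record good_order (J : finType) (ord : term_order M J) : Prop := GoodOrder {
  good_irr : forall x, ~ ord x x;
  good_trans : forall y x z, ord x y -> ord y z -> ord x z;
  good_total : forall x y, x <> y -> ord x y \/ ord y x;
  good_wf : well_founded ord;
  good_shift : forall m (x y : term M J), ord x y ->
    ord ((m + x.1)%MM, x.2) ((m + y.1)%MM, y.2) }.

End TermOrders.

Section Coefficients.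
Variables (R : comNzRingType) (M : nat) (J : finType).
Notation poly := {mpoly R[M]}.
Implicit Types (h g : free_mod R M J) (x y : term M J).

Lemma free_scaleE (c : poly) h t : (c *: h) t = c * (h t : poly).
Proof. by rewrite ffunE. Qed.

Lemma free_sumE (I : Type) (s : seq I) (E : I -> free_mod R M J) t :
  (\sum_(i <- s) E i) t = \sum_(i <- s) (E i t : poly).
Proof. by elim/big_rec2: _ => [|i a b _ <-]; rewrite ffunE. Qed.

Lemma tcoef0 x : tcoef (0 : free_mod R M J) x = 0.
Proof. by rewrite /tcoef ffunE mcoeff0. Qed.

Lemma tcoefB h g x : tcoef (h - g) x = tcoef h x - tcoef g x.
Proof. by rewrite /tcoef !ffunE mcoeffB. Qed.

Lemma tcoefD h g x : tcoef (h + g) x = tcoef h x + tcoef g x.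
Proof. by rewrite /tcoef !ffunE mcoeffD. Qed.

Lemma tcoef_scale (c : poly) h x : tcoef (c *: h) x = (c * (h x.2 : poly))@_x.1.
Proof. by rewrite /tcoef free_scaleE. Qed.

Lemma tcoefZX (a : R) m h x :
  tcoef ((a *: 'X_[m] : poly) *: h) x = a * tcoef (('X_[m] : poly) *: h) x.
Proof.
rewrite [LHS]tcoef_scale -[X in X@_ _]mpoly_scaleAl mcoeffZ.
by congr (_ * _); rewrite tcoef_scale.
Qed.

Lemma tcoefX m h k t :
  tcoef (('X_[m] : poly) *: h) ((m + k)%MM, t) = tcoef h (k, t).
Proof. by rewrite /tcoef !free_scaleE mulrC mcoeffMX. Qed.

Lemma tcoefX_out m h x : ~~ (m <= x.1)%MM ->
  tcoef (('X_[m] : poly) *: h) x = 0.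
Proof.
move=> le; apply/eqP; rewrite /tcoef free_scaleE mulrC mcoeff_eq0.
rewrite (perm_mem (msuppMX _ _)); apply: contra le => /mapP[k _ ->]; exact: lem_addr.
Qed.

Lemma tcoefX_neq0 m h x : tcoef (('X_[m] : poly) *: h) x <> 0 ->
  exists k, [/\ x = ((m + k)%MM, x.2)
    & tcoef h (k, x.2) = tcoef (('X_[m] : poly) *: h) x].
Proof.
have [le _|le] := boolP (m <= x.1)%MM; last by rewrite tcoefX_out.
exists (x.1 - m)%MM; case: x le => x1 x2 /= le.
have E : (m + (x1 - m) = x1)%MM by rewrite addmC submK.
by split; rewrite ?E // -[in RHS]E tcoefX.
Qed.

Lemma tcoef_basis (t : J) x :
  tcoef (basis_vec R M t) x = ((x.2 == t) && (x.1 == 0%MM))%:R.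
Proof.
by rewrite /tcoef ffunE; case: (x.2 == t); rewrite ?mcoeff1 // mcoeff0.
Qed.

Lemma tcoef_Xbasis m (t : J) x :
  tcoef (('X_[m] : poly) *: basis_vec R M t) x = (x == (m, t) :> 'X_{1..M} * J)%:R.
Proof.
case: x => k s; rewrite /tcoef free_scaleE ffunE /= xpair_eqE.
by case: (s == t); rewrite ?mulr1 ?mulr0 ?mcoeffX ?mcoeff0 ?andbT ?andbF // eq_sym.
Qed.

Lemma free_eq0 h : (forall x, tcoef h x = 0) -> h = 0.
Proof. by move=> h0; apply/ffunP => t; apply/mpolyP => m; rewrite ffunE mcoeff0 -(h0 (m, t)). Qed.

Definition tsupp h : seq ('X_{1..M} * J) :=
  [seq (m, t) | t <- enum J, m <- msupp (h t : poly)].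

Lemma tsuppP h x : reflect (tcoef h x <> 0) (x \in tsupp h).
Proof.
apply: (iffP allpairsPdep) => [[t [m [_ mh ->]]]|]; rewrite /tcoef /=.
  by apply/eqP; rewrite -mcoeff_msupp.
case: x => m t /eqP; rewrite -mcoeff_msupp => mh.
by exists t, m; rewrite mem_enum.
Qed.

Variable ord : term_order M J.
Hypothesis ordG : good_order ord.

Lemma is_lm_exists h : h <> 0 -> exists x, is_lm ord h x.
Proof.
move=> h0.
suff [x [xs lex]] : exists x, x \in tsupp h /\
    forall y, y \in tsupp h -> y <> x -> ord y x.
  by exists x; split; [exact/tsuppP | move=> y /tsuppP; exact: lex].
have : tsupp h <> [::].
  by move=> E; apply: h0; apply: free_eq0 => x; apply: contrapT => /tsuppP; rewrite E.
elim: (tsupp h) => // x [|y s] IH _.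
  by exists x; split=> [|y]; rewrite !inE // => /eqP.
have [//|z [zs lez]] := IH.
have [xz|xz] := pselect (x = z).
  exists z; split; first by rewrite inE zs orbT.
  by move=> w; rewrite inE => /orP[/eqP ->|/lez].
have [ozx|oxz] := good_total ordG (nesym xz).
  exists x; split; first exact: mem_head.
  move=> w; rewrite inE => /orP[/eqP -> //|ws] _.
  have [->//|wz] := pselect (w = z).
  exact: good_trans ordG _ _ _ (lez _ ws wz) ozx.
exists z; split; first by rewrite inE zs orbT.
by move=> w; rewrite inE => /orP[/eqP ->|/lez].
Qed.

Lemma is_lm_uniq h x y : is_lm ord h x -> is_lm ord h y -> x = y.
Proof.
move=> [hx lex] [hy ley]; apply: contrapT => xy.
apply: (good_irr ordG (x := x)); apply: good_trans ordG _ _ _ (ley _ hx xy) _.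
exact: lex (nesym xy).
Qed.

Lemma is_lm_shift m h x : is_lm ord h x ->
  is_lm ord (('X_[m] : poly) *: h) ((m + x.1)%MM, x.2).
Proof.
case: x => x1 x2 [hx lex]; split=> [|y]; first by rewrite tcoefX.
move=> /[dup] hy /tcoefX_neq0[k [E Ek]] ne; rewrite E.
apply: (good_shift ordG m (x := (k, y.2)) (y := (x1, x2))).
by apply: lex => [|[k1 y2]]; [rewrite Ek | apply: ne; rewrite E k1 y2].
Qed.

Lemma is_lm_le h x y : is_lm ord h x -> tcoef h y <> 0 -> y = x \/ ord y x.
Proof.
by move=> [_ lex] hy; have [|yx] := pselect (y = x); [left | right; exact: lex].
Qed.

End Coefficients.

(** * Division and Schreyer's criterion *)

Section GroebnerFamily.
Variables (R : comNzRingType) (M : nat) (I J : finType) (ltI : rel I).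
Variable ord : term_order M J.
Hypothesis ordG : good_order ord.
Hypothesis ltI_irr : irreflexive ltI.
Hypothesis ltI_trans : transitive ltI.
Hypothesis ltI_total : forall i i', i != i' -> ltI i i' \/ ltI i' i.
Variables (g : I -> free_mod R M J) (lead : I -> term M J).
Hypothesis leadP : forall i, is_lm ord (g i) (lead i).
Hypothesis lead1 : forall i, tcoef (g i) (lead i) = 1.
Notation poly := {mpoly R[M]}.

Definition lead_at (x : term M I) : term M J :=
  ((x.1 + (lead x.2).1)%MM, (lead x.2).2).

Definition lifted_order : term_order M I := fun x y =>
  ord (lead_at x) (lead_at y) \/ (lead_at x = lead_at y /\ ltI y.2 x.2).

Lemma lead_atP x : is_lm ord (('X_[x.1] : poly) *: g x.2) (lead_at x).
Proof. exact: is_lm_shift. Qed.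

(** Leading terms are unique and shift with a monomial factor, so the existential in [induced_order]
    has only one pair of witnesses, [lead_at x] and [lead_at y]. *)
Lemma induced_orderE : induced_order ltI ord g = lifted_order.
Proof.
apply/funext => x; apply/funext => y; apply/propext; split.
  case=> x' [y' [lx ly H]]; rewrite /lifted_order.
  by rewrite (is_lm_uniq ordG (lead_atP x) lx) (is_lm_uniq ordG (lead_atP y) ly).
by move=> H; exists (lead_at x), (lead_at y); split=> //; apply: lead_atP.
Qed.

Lemma lead_at_shift m (x : term M I) :
  lead_at ((m + x.1)%MM, x.2) = ((m + (lead_at x).1)%MM, (lead_at x).2).
Proof. by rewrite /lead_at /= addmA. Qed.

Lemma lifted_order_good : good_order lifted_order.
Proof.
split.
- by move=> x [/(good_irr ordG)|[_]]; rewrite ?ltI_irr.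
- move=> y x z [xy|[xy xy2]] [yz|[yz yz2]].
  + by left; apply: good_trans ordG _ _ _ xy yz.
  + by left; rewrite -yz.
  + by left; rewrite xy.
  + by right; split; [rewrite xy | apply: ltI_trans yz2 xy2].
- move=> x y xy.
  have [E|ne] := pselect (lead_at x = lead_at y); last first.
    by case: (good_total ordG ne); [left; left | right; left].
  have : x.2 != y.2.
    apply/eqP => E2; apply: xy; have /eqP := congr1 fst E; rewrite /= E2.
    by rewrite eqm_add2r => /eqP; case: x y E2 {E} => [x1 x2] [y1 y2] /= -> ->.
  by case/ltI_total; [right | left]; right.
- move=> x; have [z] : exists z, z = lead_at x by exists (lead_at x).
  elim/(well_founded_ind (good_wf ordG)): z x => z IHz x zx.
  (* Among terms with the same [lead_at] a descent raises the index, so the number of indices above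
     [x.2] decreases. *)
  have [k] := ubnP #|[pred i | ltI x.2 i]|; elim: k x zx => [|k IHk] x zx.
    by rewrite ltn0.
  rewrite ltnS => le; split=> y [lt|[E lt]]; first by apply: IHz erefl; rewrite zx.
  apply: IHk; first by rewrite E.
  apply: leq_trans le; apply/proper_card/properP; split.
    by apply/fintype.subsetP => i; rewrite !inE; apply: ltI_trans.
  by exists y.2; rewrite !inE ?ltI_irr.
- move=> m x y [lt|[E lt]].
    by left; rewrite !lead_at_shift; apply: (good_shift ordG).
  by right; rewrite !lead_at_shift E.
Qed.

Definition combine (h : free_mod R M I) : free_mod R M J :=
  \sum_i (h i : poly) *: g i.

Lemma combine0 : combine 0 = 0.
Proof. by rewrite /combine big1 // => i _; rewrite ffunE scale0r. Qed.

Lemma combineD h h' : combine (h + h') = combine h + combine h'.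
Proof. by rewrite /combine -big_split; apply: eq_bigr => i _; rewrite ffunE scalerDl. Qed.

Lemma combineB h h' : combine (h - h') = combine h - combine h'.
Proof.
by rewrite /combine -sumrB; apply: eq_bigr => i _; rewrite !ffunE scalerBl.
Qed.

Lemma combineZ (c : poly) h : combine (c *: h) = c *: combine h.
Proof.
by rewrite /combine scaler_sumr; apply: eq_bigr => i _; rewrite free_scaleE scalerA.
Qed.

Lemma combine_basis i : combine (basis_vec R M i) = g i.
Proof.
rewrite /combine (bigD1 i) //= big1 ?addr0 => [|k ki]; rewrite ffunE.
  by rewrite eqxx scale1r.
by rewrite (negbTE ki) scale0r.
Qed.

Lemma tcoef_combine h x : tcoef (combine h) x =
  \sum_i \sum_(m <- msupp (h i : poly))
     tcoef h (m, i) * tcoef (('X_[m] : poly) *: g i) x.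
Proof.
rewrite /tcoef free_sumE (raddf_sum (mcoeff x.1)); apply: eq_bigr => i _.
rewrite [in LHS]free_scaleE [in LHS](mpolyE (h i : poly)) mulr_suml.
rewrite (raddf_sum (mcoeff x.1)) /=.
apply: eq_bigr => m _; rewrite -[X in X@_ _]mpoly_scaleAl mcoeffZ.
by congr (_ * _); rewrite free_scaleE.
Qed.

(* The largest term of [h] for the lifted order contributes to [combine h] at
   a position where no other term contributes, unless a second term of [h]
   has the same leading term. *)
Lemma syzygy_lead h x : combine h = 0 -> is_lm lifted_order h x ->
  exists y, [/\ tcoef h y <> 0, lead_at y = lead_at x & ltI x.2 y.2].
Proof.
move=> h0 [hx lex]; apply: contrapT => none.
have : tcoef (combine h) (lead_at x) = tcoef h x.
  rewrite tcoef_combine (bigD1 x.2) //= [X in _ + X]big1 ?addr0 => [|i ix].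
    rewrite (bigD1_seq x.1) ?msupp_uniq //=; last first.
      by rewrite mcoeff_msupp; apply/eqP; case: (x) hx.
    rewrite [X in _ + X]big1_seq ?addr0 => [|m /andP[mx mh]].
      rewrite /lead_at -surjective_pairing tcoefX -surjective_pairing lead1.
      by rewrite mulr1; case: (x).
    have [->|ne] := pselect (tcoef (('X_[m] : poly) *: g x.2) (lead_at x) = 0).
      by rewrite mulr0.
    have hm : tcoef h (m, x.2) <> 0 by apply/eqP; rewrite -mcoeff_msupp.
    have mx' : (m, x.2) <> x by move=> E; move: mx; rewrite -E eqxx.
    exfalso; have := is_lm_le (lead_atP (m, x.2)) ne.
    case: (lex _ hm mx') => [lt [E|gt]|[_ /=]]; last by rewrite ltI_irr.
      by apply: (good_irr ordG (x := lead_at x)); rewrite [X in ord X]E.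
    by apply: (good_irr ordG (x := lead_at x)); apply: good_trans ordG _ _ _ gt lt.
  rewrite big1_seq // => m /= mh.
  have [->|ne] := pselect (tcoef (('X_[m] : poly) *: g i) (lead_at x) = 0).
    by rewrite mulr0.
  have hm : tcoef h (m, i) <> 0 by apply/eqP; rewrite -mcoeff_msupp.
  have mx' : (m, i) <> x by move=> E; move: ix; rewrite -E eqxx.
  exfalso; have := is_lm_le (lead_atP (m, i)) ne.
  case: (lex _ hm mx') => [lt [E|gt]|[E lt _]].
  - by apply: (good_irr ordG (x := lead_at x)); rewrite [X in ord X]E.
  - by apply: (good_irr ordG (x := lead_at x)); apply: good_trans ordG _ _ _ gt lt.
  - by apply: none; exists (m, i); rewrite E.
by rewrite h0 tcoef0 => E; apply: hx.
Qed.

Section Division.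
Variable N : free_mod R M J -> Prop.
Hypothesis N_closed : forall h (c : poly) i, N h -> N (h - c *: g i).
Hypothesis N_lead : forall h x, N h -> is_lm ord h x ->
  exists i m, lead i = (m, x.2) /\ (m <= x.1)%MM.

(** [N] is an invariant of the dividend: stable under reduction, and forcing a divisible leading
    term. It will be instantiated with the combinations of [g], with the syzygies of a level and
    with the kernel of the comparison module. Each reduction cancels the leading term, so the
    well-founded order ends the division. *)
Lemma divides_toP h : N h -> exists q, divides_to ltI ord g h q.
Proof.
have [->|h0] := pselect (h = 0); first by exists 0; constructor.
have [x] := is_lm_exists ordG h0.
elim/(well_founded_ind (good_wf ordG)): x h {h0} => x IHx h lmh Nh.
have [i0 [m0 [l0 le0]]] := N_lead Nh lmh.
pose P := [pred i | ((lead i).2 == x.2) && ((lead i).1 <= x.1)%MM].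
have Pi0 : P i0 by rewrite inE l0 eqxx.
(* [ltI] is only a relation; the divisor of maximal index is found by maximizing the number of
   indices below it. *)
case: (arg_maxnP (fun i => #|[pred k | ltI k i]|) Pi0) => i /andP[/eqP l2 l1] maxi.
have lmi : is_lm ord (g i) ((lead i).1, x.2) by rewrite -l2 -surjective_pairing.
pose c : poly := tcoef h x *: 'X_[x.1 - (lead i).1].
have xE : ((x.1 - (lead i).1 + (lead i).1)%MM, x.2) = x.
  by rewrite submK // -surjective_pairing.
have cx : tcoef (c *: g i) x = tcoef h x.
  have := tcoefX (x.1 - (lead i).1)%MM (g i) (lead i).1 x.2.
  rewrite xE => E.
  by rewrite /c tcoefZX E -l2 -surjective_pairing lead1 mulr1.
have [q dq] : exists q, divides_to ltI ord g (h - c *: g i) q.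
  have [->|h0] := pselect (h - c *: g i = 0); first by exists 0; constructor.
  have [y lmy] := is_lm_exists ordG h0.
  have Nc := N_closed c i Nh.
  apply: (IHx y _ _ lmy Nc).
  have [hy _] := lmy.
  have yx : y <> x by move=> E; apply: hy; rewrite E tcoefB cx subrr.
  have [h0y|hy0] := pselect (tcoef h y = 0); last exact: (proj2 lmh).
  have gy : tcoef (('X_[x.1 - (lead i).1] : poly) *: g i) y <> 0.
    by move=> E; apply: hy; rewrite tcoefB h0y tcoefZX E mulr0 subr0.
  have lmg := lead_atP ((x.1 - (lead i).1)%MM, i).
  have := is_lm_le lmg gy.
  by rewrite /lead_at /= l2 xE => -[].
exists (c *: basis_vec R M i + q).
apply: (divides_to_step lmh lmi l1) => //.
move=> i' m' lmi' le'.
have [->|ii'] := pselect (i' = i); [by left | right].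
have [//|lt] := ltI_total (introN eqP ii').
have E := is_lm_uniq ordG (leadP i') lmi'.
have /maxi : P i' by rewrite inE E /= eqxx.
rewrite /= leqNgt; case/negP; apply/proper_card/properP; split.
  by apply/fintype.subsetP => k; rewrite !inE => /ltI_trans; apply.
by exists i; rewrite !inE ?ltI_irr.
Qed.

End Division.

Lemma divides_to_combine h q : divides_to ltI ord g h q -> combine q = h.
Proof.
elim=> [|{}h {}q x i m lmh lmi le _ c _ IH]; first exact: combine0.
by rewrite combineD combineZ combine_basis IH addrC subrK.
Qed.

(** The terms of [h - c *: g i] come from [h] or lie at or below the leading term just treated, so
    the quotients never outgrow the dividend. This keeps them away from the leading position of a
    syzygy. *)
Lemma divides_to_bound h q : divides_to ltI ord g h q ->
  forall y, tcoef q y <> 0 -> exists x, [/\ tcoef h x <> 0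
    & lead_at y = x \/ ord (lead_at y) x].
Proof.
elim=> [y|{}h {}q x i m lmh lmi le _ c _ IH y]; first by rewrite tcoef0.
have ml : lead i = (m, x.2) := is_lm_uniq ordG (leadP i) lmi.
have xE : lead_at ((x.1 - m)%MM, i) = x.
  by rewrite /lead_at /= ml submK // -surjective_pairing.
rewrite tcoefD tcoefZX tcoef_Xbasis.
case: eqP => [->|_]; first by exists x; split; [case: lmh | left].
rewrite mulr0 add0r => /IH[z [hz H]].
suff {H} zx : z = x \/ ord z x.
  exists x; split; first by case: lmh.
  case: H zx => [->//|lt] [<-|lt']; right=> //; exact: good_trans ordG _ _ _ lt lt'.
have [h0|hz0] := pselect (tcoef h z = 0); last exact: is_lm_le lmh hz0.
have := lead_atP ((x.1 - m)%MM, i); rewrite xE => lm; apply: is_lm_le lm _.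
by move=> E; apply: hz; rewrite tcoefB h0 tcoefZX E mulr0 subr0.
Qed.

End GroebnerFamily.

Lemma submlcmK M (a b : 'X_{1..M}) : (mlcm a b - a + a = mlcm a b)%MM.
Proof. by rewrite submK // lem_mlcml. Qed.

Section Syzygies.
Variables (R : comNzRingType) (M : nat) (I J : finType) (ltI : rel I).
Variable ord : term_order M J.
Hypothesis ordG : good_order ord.
Hypothesis ltI_irr : irreflexive ltI.
Hypothesis ltI_trans : transitive ltI.
Hypothesis ltI_total : forall i i', i != i' -> ltI i i' \/ ltI i' i.
Variables (g : I -> free_mod R M J) (lead : I -> term M J).
Hypothesis leadP : forall i, is_lm ord (g i) (lead i).
Hypothesis lead1 : forall i, tcoef (g i) (lead i) = 1.
Notation poly := {mpoly R[M]}.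

Let lead_atP := lead_atP ordG leadP.

Lemma tcoef_lead_at m i :
  tcoef (('X_[m] : poly) *: g i) (lead_at lead (m, i)) = 1.
Proof. by rewrite tcoefX -surjective_pairing lead1. Qed.

Lemma combine_pair (c c' : poly) a b :
  combine g (c *: basis_vec R M a - c' *: basis_vec R M b) = c *: g a - c' *: g b.
Proof. by rewrite combineB; congr (_ - _); rewrite combineZ combine_basis. Qed.

Lemma syzygy_exists a b ma mb j :
  (forall h x, is_lm ord (combine g h) x ->
     exists i m, lead i = (m, x.2) /\ (m <= x.1)%MM) ->
  lead a = (ma, j) -> lead b = (mb, j) -> exists s, is_syzygy ltI ord g a b s.
Proof.
move=> gb la lb.
pose ca : poly := 'X_[mlcm ma mb - ma]; pose cb : poly := 'X_[mlcm ma mb - mb].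
have [|||q qP] := @divides_toP _ _ _ _ ltI ord ordG ltI_irr ltI_trans ltI_total
  g lead leadP lead1 (fun h => exists q, combine g q = h) _ _ (ca *: g a - cb *: g b).
- move=> _ c i [q <-]; exists (q - c *: basis_vec R M i).
  by rewrite combineB combineZ combine_basis.
- by move=> _ x [q <-]; apply: gb.
- exists (ca *: basis_vec R M a - cb *: basis_vec R M b).
  exact: combine_pair.
exists (ca *: basis_vec R M a - cb *: basis_vec R M b - q), ma, mb, j, q.
by rewrite -la -lb; split.
Qed.

Section OneSyzygy.
Variables (a b : I) (ma mb : 'X_{1..M}) (j : J) (s : free_mod R M I).
Hypothesis la : lead a = (ma, j).
Hypothesis lb : lead b = (mb, j).
Hypothesis ltab : ltI a b.
Hypothesis sP : is_syzygy ltI ord g a b s.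

Let ca : poly := 'X_[mlcm ma mb - ma].
Let cb : poly := 'X_[mlcm ma mb - mb].

(* The vectors are named because comparing two distinct multiples [c *: g a]
   and [c' *: g b] by conversion is prohibitively slow. *)
Lemma is_syzygyE : exists va vb ea eb q,
  [/\ va = ca *: g a /\ vb = cb *: g b,
      ea = ca *: basis_vec R M a /\ eb = cb *: basis_vec R M b,
      divides_to ltI ord g (va - vb) q & s = ea - eb - q].
Proof.
case: sP => ma' [mb' [j' [q [la' lb' [dq sE]]]]].
have := is_lm_uniq ordG la' (leadP a); rewrite la => -[Ea _].
have := is_lm_uniq ordG lb' (leadP b); rewrite lb => -[Eb _].
rewrite /ca /cb -Ea -Eb.
do 4!eexists; exists q.
exact: And4 (conj erefl erefl) (conj erefl erefl) dq sE.
Qed.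

Lemma syzygy_combine : combine g s = 0.
Proof.
have [va [vb [ea [eb [q [[va_ vb_] [ea_ eb_] dq ->]]]]]] := is_syzygyE.
have -> : combine g (ea - eb - q) = va - vb - combine g q.
  by rewrite combineB va_ vb_ ea_ eb_ combine_pair.
by rewrite (divides_to_combine dq) subrr.
Qed.

(** The two multiples of [g a] and [g b] have the same leading term with coefficient 1. It cancels
    in the S-polynomial, so by [divides_to_bound] all quotient terms lie strictly below. The two
    basis terms tie, and the induced order puts the larger index [b] lower. *)
Lemma syzygy_lm :
  is_lm (lifted_order ltI ord lead) s ((mlcm ma mb - ma)%MM, a) /\
  tcoef s ((mlcm ma mb - ma)%MM, a) = 1.
Proof.
have [va [vb [ea [eb [q [[va_ vb_] [ea_ eb_] dq sE]]]]]] := is_syzygyE.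
pose lift := lifted_order ltI ord lead.
have liftG : good_order lift := lifted_order_good ordG ltI_irr ltI_trans ltI_total lead.
pose xa : term M I := ((mlcm ma mb - ma)%MM, a).
pose xb : term M I := ((mlcm ma mb - mb)%MM, b).
have Ea : lead_at lead xa = (mlcm ma mb, j).
  by rewrite /lead_at /= la submlcmK.
have Eb : lead_at lead xb = (mlcm ma mb, j).
  by rewrite /lead_at /= lb mlcmC submlcmK.
have lt_b : lift xb xa by right; rewrite Ea Eb.
have lt_q y : tcoef q y <> 0 -> lift y xa.
  move=> /(divides_to_bound ordG leadP dq)[x [hx yx]]; left; rewrite Ea.
  suff lt : ord x (mlcm ma mb, j).
    by case: yx => [->//|lt']; apply: good_trans ordG _ _ _ lt' lt.
  have Ta : tcoef va (mlcm ma mb, j) = 1 by rewrite va_ -Ea; apply: tcoef_lead_at.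
  have Tb : tcoef vb (mlcm ma mb, j) = 1 by rewrite vb_ -Eb; apply: tcoef_lead_at.
  have xE : x <> (mlcm ma mb, j).
    by move=> E; apply: hx; rewrite E tcoefB Ta Tb subrr.
  have [h0|h1] := pselect (tcoef va x = 0).
    have : tcoef vb x <> 0.
      by move=> E; apply: hx; rewrite tcoefB h0 E subrr.
    by rewrite vb_ => /(is_lm_le (lead_atP xb)); rewrite Eb => -[].
  move: h1; rewrite va_ => /(is_lm_le (lead_atP xa)).
  by rewrite Ea => -[].
have sx y : tcoef s y = (y == xa :> 'X_{1..M} * I)%:R
    - (y == xb :> 'X_{1..M} * I)%:R - tcoef q y.
  rewrite sE !tcoefB; congr (_ - _ - _); first by rewrite ea_ tcoef_Xbasis.
  by rewrite eb_ tcoef_Xbasis.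
have s1 : tcoef s xa = 1.
  have -> : tcoef s xa = 1 - 0 - 0; last by rewrite !subr0.
  rewrite sx eqxx; congr (_ - _ - _).
    by case: eqP => // E; case: (good_irr liftG (x := xa)); rewrite {1}E.
  by apply: contrapT => /lt_q /(good_irr liftG).
split=> //; split; first by rewrite s1; apply/eqP/oner_neq0.
move=> y hy yxa.
have [q0|/lt_q //] := pselect (tcoef q y = 0).
have [-> //|yb] := pselect (y = xb).
by case: hy; rewrite sx q0 (introF eqP yxa) (introF eqP yb) !subr0.
Qed.

End OneSyzygy.

(* Schreyer's criterion: only pairs of terms with a common leading term have to
   be covered. *)
Lemma schreyer (K : finType) (leadK : K -> term M I) :
  (forall x y : term M I, lead_at lead x = lead_at lead y -> ltI x.2 y.2 ->
     exists k m, leadK k = (m, x.2) /\ (m <= x.1)%MM) ->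
  forall h x, combine g h = 0 -> is_lm (lifted_order ltI ord lead) h x ->
  exists k m, leadK k = (m, x.2) /\ (m <= x.1)%MM.
Proof.
move=> cover h x h0 lmx.
have [y [hy E lt]] := syzygy_lead ordG ltI_irr leadP lead1 h0 lmx.
exact: cover (esym E) lt.
Qed.

Section Homogeneous.
Variables (V : zmodType) (degm : 'X_{1..M} -> V) (degI : I -> V) (degJ : J -> V).
Hypothesis degmD : forall a b : 'X_{1..M}, degm (a + b)%MM = degm a + degm b.

Definition whomog (L : finType) (degL : L -> V) (u : V) (h : free_mod R M L) :=
  forall x, tcoef h x <> 0 -> degm x.1 + degL x.2 = u.

Lemma homogB (L : finType) (degL : L -> V) u (h h' : free_mod R M L) :
  whomog degL u h -> whomog degL u h' -> whomog degL u (h - h').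
Proof.
move=> hu hu' x; rewrite tcoefB.
have [-> /eqP|/hu //] := pselect (tcoef h x = 0).
by rewrite sub0r oppr_eq0 => /eqP; apply: hu'.
Qed.

Lemma homogD (L : finType) (degL : L -> V) u (h h' : free_mod R M L) :
  whomog degL u h -> whomog degL u h' -> whomog degL u (h + h').
Proof.
move=> hu hu' x; rewrite tcoefD.
have [-> |/hu //] := pselect (tcoef h x = 0).
by rewrite add0r; apply: hu'.
Qed.

Lemma homogX (L : finType) (degL : L -> V) u m (h : free_mod R M L) :
  whomog degL u h -> whomog degL (degm m + u) (('X_[m] : poly) *: h).
Proof.
move=> hu x /[dup] hx /tcoefX_neq0 [k [E0 E]]; rewrite E0 /=.
by rewrite degmD -addrA (hu (k, x.2)) // E.
Qed.

Lemma homogZX (L : finType) (degL : L -> V) u c m (h : free_mod R M L) :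
  whomog degL u h -> whomog degL (degm m + u) ((c *: 'X_[m] : poly) *: h).
Proof.
move=> hu x; rewrite tcoefZX => cx; apply: (homogX hu) => E.
by apply: cx; rewrite E mulr0.
Qed.

Hypothesis degm0 : degm 0%MM = 0.

Lemma homog_basis (L : finType) (degL : L -> V) (t : L) :
  whomog degL (degL t) (basis_vec R M t).
Proof.
move=> x; rewrite tcoef_basis; case: eqP => [->|//].
by case: eqP => [->|//]; rewrite degm0 add0r.
Qed.

Hypothesis g_homog : forall i, whomog degJ (degI i) (g i).

Lemma divides_to_homog u h q : divides_to ltI ord g h q ->
  whomog degJ u h -> whomog degI u q.
Proof.
elim=> [_ x|{}h {}q x i m lmh lmi le _ c _ IH hu]; first by rewrite tcoef0.
have ml : lead i = (m, x.2) := is_lm_uniq ordG (leadP i) lmi.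
have uE : u = degm (x.1 - m)%MM + degI i.
  have [gi _] := leadP i; rewrite -(g_homog gi) ml /= addrA -degmD submK //.
  by apply/esym/hu; case: lmh.
apply: homogD.
  by rewrite uE; apply/homogZX/homog_basis.
by apply: IH; apply: homogB => //; rewrite uE; apply: homogZX.
Qed.

Lemma syzygy_homog a b ma mb j s : lead a = (ma, j) -> lead b = (mb, j) ->
  is_syzygy ltI ord g a b s -> whomog degI (degm (mlcm ma mb) + degJ j) s.
Proof.
move=> la lb sP.
have [va [vb [ea [eb [q [[va_ vb_] [ea_ eb_] dq ->]]]]]] := is_syzygyE la lb sP.
have Ea : degm (mlcm ma mb) + degJ j = degm (mlcm ma mb - ma)%MM + degI a.
  have [ga _] := leadP a; rewrite -(g_homog ga) la /= addrA -degmD submK //.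
  exact: lem_mlcml.
have Eb : degm (mlcm ma mb) + degJ j = degm (mlcm ma mb - mb)%MM + degI b.
  have [gb _] := leadP b; rewrite -(g_homog gb) lb /= addrA -degmD submK //.
  exact: lem_mlcmr.
apply: homogB.
  by apply: homogB; [rewrite Ea ea_ | rewrite Eb eb_]; apply/homogX/homog_basis.
apply: divides_to_homog dq _.
by apply: homogB; [rewrite Ea va_ | rewrite Eb vb_]; apply: homogX.
Qed.

Lemma combine_homog u h : whomog degI u h -> whomog degJ u (combine g h).
Proof.
move=> hu x; rewrite tcoef_combine => hx.
apply: contrapT => ne; apply: hx.
apply: big1 => i _; apply: big1_seq => m /= mh.
have hm : tcoef h (m, i) <> 0 by apply/eqP; rewrite -mcoeff_msupp.
have [->|gx] := pselect (tcoef (('X_[m] : poly) *: g i) x = 0).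
  by rewrite mulr0.
by case: ne; rewrite (homogX (@g_homog i) gx) (hu _ hm).
Qed.

End Homogeneous.

(** * Constant coefficients of syzygies *)

Section Minimality.
Variables (mm : set R) (d : nat).
Hypothesis mmI : is_ideal mm.
Hypothesis lead_mdeg : forall i, mdeg (lead i).1 = d.
Hypothesis lead_inj : injective lead.
Hypothesis low : forall i x, (mdeg x.1 < d)%N -> mm (tcoef (g i) x).

Lemma ideal_sum (L : Type) (r : seq L) (P : pred L) (E : L -> R) :
  (forall l, P l -> mm (E l)) -> mm (\sum_(l <- r | P l) E l).
Proof. by case: mmI => mm0 mmD _ PE; elim/big_ind: _. Qed.

(* The position [lead i] of [combine g h = 0] receives the constant coefficient
   of [h] at [i]; all other contributions lie in [mm], by the induction from
   large to small leading terms. *)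
Lemma syzygy_const h i : combine g h = 0 -> mm (tcoef h (0%MM, i)).
Proof.
move=> h0; have [mm0 mmD mmM] := mmI.
have [k] := ubnP #|[pred l | `[< ord (lead i) (lead l) >]]|.
elim: k i => [|k IH] i; first by rewrite ltn0.
rewrite ltnS => le.
have {}IH l : ord (lead i) (lead l) -> mm (tcoef h (0%MM, l)).
  move=> lt; apply: IH; apply: leq_trans le; apply/proper_card/properP; split.
    apply/fintype.subsetP => l'; rewrite !inE => lt'.
    exact: good_trans ordG _ _ _ lt lt'.
  by exists l; rewrite ?inE //; apply/negP; rewrite inE => /(good_irr ordG).
have other l m : (l, m) <> (i, 0%MM) ->
    mm (tcoef h (m, l) * tcoef (('X_[m] : poly) *: g l) (lead i)).
  move=> ne; have [m0|m0] := eqVneq m 0%MM.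
    rewrite m0 mpolyX0 scale1r.
    have [->|gl] := pselect (tcoef (g l) (lead i) = 0); first by rewrite mulr0.
    rewrite mulrC; apply: mmM; apply: IH.
    have [/lead_inj E|//] := is_lm_le (leadP l) gl.
    by case: ne; rewrite m0 E.
  (* A cofactor of positive degree reaches [lead i] only from a term of [g l] of degree below [d],
     whose coefficient is in [mm] by [low]. *)
  apply: (mmM); have [->|gl] := pselect (tcoef (('X_[m] : poly) *: g l) (lead i) = 0).
    exact: mm0.
  have [k' [E <-]] := tcoefX_neq0 gl; apply: low => /=.
  have := lead_mdeg i; rewrite E /= mdegD => <-.
  by rewrite -[X in (X < _)%N]add0n ltn_add2r lt0n mdeg_eq0.
have : tcoef (combine g h) (lead i) = 0 by rewrite h0 tcoef0.
have [h00|hi] := pselect (tcoef h (0%MM, i) = 0); first by rewrite h00.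
have mmN x : mm x -> mm (- x) by move/(mmM (-1)); rewrite mulN1r.
rewrite tcoef_combine (bigD1 i) //= (bigD1_seq 0%MM) ?msupp_uniq //=; last first.
  by rewrite mcoeff_msupp; apply/eqP.
rewrite mpolyX0 scale1r lead1 mulr1 -addrA => /eqP; rewrite addr_eq0 => /eqP ->.
apply: mmN; apply: mmD.
  by apply: ideal_sum => m m0; apply: other => -[] /eqP; rewrite (negbTE m0).
apply: ideal_sum => l li; apply: ideal_sum => m _; apply: other => -[] /eqP.
by rewrite (negbTE li).
Qed.

End Minimality.
End Syzygies.

(** * The index tuples *)

Section LexOrder.

Lemma lex_lt_irr s : lex_lt s s = false.
Proof. by elim: s => //= x s ->; rewrite ltnn eqxx. Qed.

Lemma lex_lt_trans : transitive lex_lt.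
Proof.
elim=> [|y t IH] [|x s] [|z u] //= /orP[xy|/andP[/eqP -> st]] /orP[yz|/andP[/eqP <- tu]].
- by rewrite (ltn_trans xy yz).
- by rewrite xy.
- by rewrite yz.
- by rewrite eqxx (IH _ _ st tu) orbT.
Qed.

Lemma lex_lt_total s t : size s = size t -> s != t -> lex_lt s t \/ lex_lt t s.
Proof.
elim: s t => [|x s IH] [|y t] //= [st]; rewrite eqseq_cons.
by case: (ltngtP x y) => //= [_|_|_ /(IH _ st)] //; [left | right].
Qed.

Lemma lex_lt_rcons s x y : lex_lt (rcons s x) (rcons s y) = (x < y)%N.
Proof. by elim: s => [|z s IH] /=; rewrite ?ltnn ?eqxx //= andbF orbF. Qed.

End LexOrder.

Section Indices.
Variable M : nat.

Definition vseq (s : seq 'I_M) : seq nat := map val s.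

Lemma idx_exists j (s : seq 'I_M) : size s = basis_len j ->
  is_basis_seq (vseq s) -> exists t : idx M j, idx_seq t = s.
Proof.
move=> /eqP sz bs; have bt : is_basis_seq (map val (Tuple sz)) by [].
by exists (Sub (Tuple sz) bt); rewrite /idx_seq SubK.
Qed.

Lemma idx_seq_inj j : injective (@idx_seq M j).
Proof. by move=> s t /val_inj /val_inj. Qed.

Lemma size_idx j (t : idx M j) : size (idx_seq t) = basis_len j.
Proof. exact: size_tuple. Qed.

Lemma idx_basis j (t : idx M j) : is_basis_seq (vseq (idx_seq t)).
Proof. exact: (valP t). Qed.

Lemma idx0E (s t : idx M 0) : s = t.
Proof.
apply: idx_seq_inj; have := size_idx s; have := size_idx t.
by move=> /size0nil -> /size0nil ->.
Qed.

Lemma idx_lt_irr j : irreflexive (@idx_lt M j).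
Proof. by move=> t; rewrite /idx_lt lex_lt_irr. Qed.

Lemma idx_lt_trans j : transitive (@idx_lt M j).
Proof. by move=> t s u; apply: lex_lt_trans. Qed.

Lemma idx_lt_total j (s t : idx M j) : s != t -> idx_lt s t \/ idx_lt t s.
Proof.
move=> st; apply: lex_lt_total; first by rewrite !size_map !size_idx.
apply: contra st => /eqP /(inj_map val_inj) E; apply/eqP; exact: idx_seq_inj.
Qed.

Lemma idx1P (t : idx M 1) : exists i j : 'I_M,
  idx_seq t = [:: i; j] /\ (i.+1 < j)%N.
Proof.
have := size_idx t; have := idx_basis t.
by case: (idx_seq t) => [|i [|j []]] //= /andP[ij _] _; exists i, j.
Qed.

(* [k_u] for the tuple (i, j, k_1, ..., k_u), and [i] if u = 0. *)
Definition blast (s : seq nat) := last (head 0%N s) (drop 2 s).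

Lemma blast_rcons s k : (1 < size s)%N -> blast (rcons s k) = k.
Proof. by case: s => [|i [|j s]] //= _; rewrite /blast /= drop0 last_rcons. Qed.

Lemma is_basis_rcons s k : (1 < size s)%N -> is_basis_seq (rcons s k) =
  [&& is_basis_seq s, (blast s < k)%N, k != (nth 0 s 1).-1 & k != nth 0%N s 1].
Proof.
case: s => [|i [|j s]] //= _; rewrite /blast /= drop0 rcons_path all_rcons.
case: (i.+1 < j)%N => //=; case: (path _ _ _) => //=.
by case: (last i s < k)%N; rewrite ?andbF //= andbC.
Qed.

Lemma nth1_rcons (s : seq nat) k : (1 < size s)%N -> nth 0%N (rcons s k) 1 = nth 0%N s 1.
Proof. by move=> s1; rewrite nth_rcons s1. Qed.

Lemma size_vidx j (t : idx M j.+1) : (1 < size (vseq (idx_seq t)))%N.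
Proof. by rewrite size_map size_idx. Qed.

Lemma idxSP j (t : idx M j.+2) : exists (s : idx M j.+1) (k : 'I_M),
  idx_seq t = rcons (idx_seq s) k.
Proof.
have := size_idx t; have := idx_basis t; case/lastP: (idx_seq t) => // s k.
rewrite /vseq map_rcons size_rcons => + [sz].
rewrite is_basis_rcons ?size_map ?sz // => /and4P[bs _ _ _].
by have [s' Es] := @idx_exists j.+1 s sz bs; exists s', k; rewrite Es.
Qed.

Definition lead_spec j (t : idx M j.+1) (x : term M (idx M j)) : Prop :=
  if j is 0 then forall i k : 'I_M, idx_seq t = [:: i; k] -> x.1 = (U_(i) + U_(k))%MM
  else exists2 k, idx_seq t = rcons (idx_seq x.2) k & x.1 = U_(k)%MM.

Lemma lead_spec_exists j (t : idx M j.+1) : exists x, lead_spec t x.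
Proof.
case: j t => [|j] t.
  have [i [k [E _]]] := idx1P t.
  have [//|//|s _] := @idx_exists 0 [::].
  by exists ((U_(i) + U_(k))%MM, s) => i' k'; rewrite E => -[-> ->].
by have [s [k E]] := idxSP t; exists (U_(k)%MM, s), k.
Qed.

(** [lead_spec] determines its term, since at level 0 the second component lives in a one-element
    type. Choosing it avoids a truncation function between the dependent types [idx]. *)
Definition ilead j (t : idx M j.+1) : term M (idx M j) :=
  projT1 (cid (lead_spec_exists t)).

Lemma ileadP j (t : idx M j.+1) : lead_spec t (ilead t).
Proof. exact: projT2 (cid (lead_spec_exists t)). Qed.

Lemma ilead0 (t : idx M 1) i k : idx_seq t = [:: i; k] ->
  (ilead t).1 = (U_(i) + U_(k))%MM.
Proof. exact: (ileadP t). Qed.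

Lemma ileadS j (t : idx M j.+2) (s : idx M j.+1) k :
  idx_seq t = rcons (idx_seq s) k -> ilead t = (U_(k)%MM, s).
Proof.
move=> E; have [k' E' E1] := ileadP t.
move: E'; rewrite E => /rcons_inj[/idx_seq_inj Es Ek].
by rewrite [LHS]surjective_pairing E1 -Es -Ek.
Qed.

Lemma mdeg_ilead j (t : idx M j.+1) : mdeg (ilead t).1 = (if j is 0 then 2 else 1)%N.
Proof.
case: j t => [|j] t.
  by have [i [k [E _]]] := idx1P t; rewrite (ilead0 E) mdegD !mdeg1.
by have [s [k E]] := idxSP t; rewrite (ileadS E) mdeg1.
Qed.

Lemma mnm1_neq (i k : 'I_M) : i != k -> (U_(i)%MM : 'X_{1..M}) k = 0%N.
Proof. by rewrite mnm1E => /negbTE ->. Qed.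

Lemma ilead_inj j : injective (@ilead j).
Proof.
case: j => [|j] s t E.
  have [i [k [Es ik]]] := idx1P s; have [i' [k' [Et ik']]] := idx1P t.
  apply: idx_seq_inj; rewrite Es Et; move: (congr1 fst E).
  rewrite (ilead0 Es) (ilead0 Et) => /mnmP U.
  have {}U z : (i == z) || (k == z) = (i' == z) || (k' == z).
    by have := U z; rewrite !mnmDE !mnm1E; do 4!case: (_ == _).
  move: (esym (U i)) (esym (U k)) (U i') (U k'); rewrite !eqxx !orbT -!val_eqE /=.
  move=> /orP[]/eqP ? /orP[]/eqP ? /orP[]/eqP ? /orP[]/eqP ?;
    by congr [:: _; _]; apply: val_inj => /=; lia.
have [s' [k Es]] := idxSP s; have [t' [k' Et]] := idxSP t.
apply: idx_seq_inj; rewrite Es Et; move: E; rewrite (ileadS Es) (ileadS Et) => E.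
have := congr1 snd E => /= ->; congr rcons; have := congr1 fst E => /= /mnmP /(_ k').
by rewrite !mnm1E eqxx; case: eqP.
Qed.

Lemma lep1_add (m n : 'X_{1..M}) (a b : 'I_M) : a != b ->
  (m + U_(a) = n + U_(b))%MM -> (U_(b) <= m)%MM.
Proof.
move=> ab /mnmP /(_ b); rewrite !mnmDE (mnm1_neq ab) mnm1E eqxx addn0 => E.
by rewrite lep1mP E addn1.
Qed.

(** At level 0 let (c, d) follow (a, b). Then c is an admissible third index for (a, b), unless c =
    a or c is b - 1 or b, and in these cases d is beyond b and admissible. The chosen variable
    occurs in the leading monomial of (c, d) but not in that of (a, b), so it divides the cofactor
    [m]. At later levels both tuples extend the same tuple by some k < l, and Y_l divides [m]. *)
Lemma ilead_cover j (x y : term M (idx M j.+1)) :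
  lead_at (@ilead j) x = lead_at (@ilead j) y -> idx_lt x.2 y.2 ->
  exists k m, @ilead j.+1 k = (m, x.2) /\ (m <= x.1)%MM.
Proof.
case: x y => [m s] [n t]; rewrite /lead_at /=; case: j s t => [|j] s t E.
  have [a [b [Es ab]]] := idx1P s; have [c [d [Et cd]]] := idx1P t.
  rewrite /idx_lt Es Et /= andbF orbF => lt.
  have /mnmP {}E := congr1 fst E; move: E => /=; rewrite (ilead0 Es) (ilead0 Et) => E.
  have sol k : k = c \/ k = d -> (a < k)%N -> (k != b.-1 :> nat) -> (k != b :> nat) ->
      exists k' m', @ilead 1 k' = (m', s) /\ (m' <= m)%MM.
    move=> kE ak kb1 kb.
    have [//||u Eu] := @idx_exists 2 [:: a; b; k].
      by rewrite /= ab ak kb1 kb.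
    exists u, U_(k)%MM; rewrite (@ileadS _ u s k) ?Es //; split=> //.
    have [a0 b0] : (U_(a)%MM : 'X_{1..M}) k = 0%N /\ (U_(b)%MM : 'X_{1..M}) k = 0%N.
      by split; apply: mnm1_neq; rewrite -val_eqE /=; lia.
    have k1 : (0 < (U_(c)%MM : 'X_{1..M}) k + (U_(d)%MM : 'X_{1..M}) k)%N.
      by rewrite !mnm1E; case: kE => ->; rewrite eqxx ?addn1.
    rewrite lep1mP; have := E k; rewrite !mnmDE a0 b0; lia.
  have [cb|cb] := boolP [&& (a < c)%N, c != b.-1 :> nat & c != b :> nat].
    by case/and3P: cb; apply: sol; left.
  by apply: (sol d); [right | lia | lia | lia].
have [s' [k Es]] := idxSP s; have [t' [l Et]] := idxSP t.
move: E; rewrite (ileadS Es) (ileadS Et) /= => E.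
have st : s' = t' := congr1 snd E.
have {}E := congr1 fst E; rewrite /= in E.
rewrite /idx_lt Es Et st !map_rcons lex_lt_rcons => lt.
have [||u Eu] := @idx_exists j.+3 (rcons (rcons (idx_seq s') k) l).
- by rewrite !size_rcons size_idx.
- have sz := size_vidx t'; have := idx_basis s; have := idx_basis t.
  rewrite Es Et st /vseq !map_rcons !is_basis_rcons ?size_rcons //; last exact: ltnW.
  rewrite blast_rcons // nth1_rcons // => /and4P[_ _ -> ->] /and4P[-> -> -> ->].
  by rewrite lt.
exists u, U_(l)%MM; rewrite (@ileadS _ u s l) ?Es //; split=> //.
by apply: lep1_add E; rewrite -val_eqE /= ltn_eqF.
Qed.

Lemma syz_pair_rcons (s : seq 'I_M) l k : (1 < size s)%N ->
  syz_pair (rcons (rcons s l) k) = (rcons s l, rcons s k).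
Proof.
move=> sz; have -> : forall w : seq 'I_M, (3 < size w)%N -> syz_pair w =
    (take (size w).-1 w, take (size w).-2 w ++ drop (size w).-1 w).
- by case=> [|? [|? [|? [|? ?]]]].
- rewrite !size_rcons /= -cats1 take_size_cat ?size_rcons //.
  rewrite drop_size_cat ?size_rcons // -[in take _ _]cats1 -catA.
  by rewrite take_size_cat // cats1.
- by rewrite !size_rcons !ltnS.
Qed.

(** At the first step the second pair, (i, k) or (k, j), follows (i, j) and shares one index with
    it, so the lcm exceeds Y_i Y_j exactly by Y_k. At later steps the two leading terms are distinct
    variables on one basis vector. *)
Lemma syz_pair_lead j (t : idx M j.+2) : exists (a b : idx M j.+1) ma mb c,
  [/\ (idx_seq a, idx_seq b) = syz_pair (idx_seq t),
      idx_lt a b, ilead a = (ma, c), ilead b = (mb, c)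
    & ilead t = ((mlcm ma mb - ma)%MM, a)].
Proof.
have [a [k Et]] := idxSP t; case: j a t Et => [|j] a t Et.
  have [i [l [Ea il]]] := idx1P a.
  have := idx_basis t; rewrite Et Ea /vseq /= => /and3P[_ /andP[ik _] /andP[/andP[kl1 kl] _]].
  have [b [b1 [b2 [Eb ltab]]]] : exists (b : idx M 1) (b1 b2 : 'I_M),
      idx_seq b = (if (l < k)%N then [:: i; k] else [:: k; l]) /\
      [/\ idx_seq b = [:: b1; b2], idx_lt a b
      & (mlcm (U_(i) + U_(l)) (U_(b1) + U_(b2)) - (U_(i) + U_(l)) = U_(k))%MM].
    have H b1 b2 (b : idx M 1) : idx_seq b = [:: b1; b2] -> idx_lt a b = ((i < b1)%N || (i == b1 :> nat) && (l < b2)%N).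
      by move=> E; rewrite /idx_lt Ea E /= andbF orbF.
    have [lk|kl'] := ltnP l k.
      have [//||b Eb] := @idx_exists 1 [:: i; k]; first by rewrite /= !andbT; lia.
      exists b, i, k; split=> //; split=> //; first by rewrite (H _ _ _ Eb); lia.
      apply/mnmP => z; rewrite !(mnmE, mnm1E) -!val_eqE /=; lia.
    have [//||b Eb] := @idx_exists 1 [:: k; l]; first by rewrite /= !andbT; lia.
    exists b, k, l; split=> //; split=> //; first by rewrite (H _ _ _ Eb); lia.
    apply/mnmP => z; rewrite !(mnmE, mnm1E) -!val_eqE /=; lia.
  case: ltab => Eb' lt E.
  exists a, b, (U_(i) + U_(l))%MM, (U_(b1) + U_(b2))%MM, (ilead a).2; split=> //.
  - by rewrite Ea Eb.
  - by rewrite -(ilead0 Ea) -surjective_pairing.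
  - by rewrite -(ilead0 Eb') (idx0E (ilead a).2 (ilead b).2) -surjective_pairing.
  - by rewrite E (ileadS Et).
have [s [l Ea]] := idxSP a.
have sz := size_vidx s.
have [bs ltl lk bk] : [/\ is_basis_seq (vseq (idx_seq s)), (blast (vseq (idx_seq s)) < l)%N,
    (l < k)%N & [&& k != (nth 0 (vseq (idx_seq s)) 1).-1 :> nat & k != nth 0%N (vseq (idx_seq s)) 1 :> nat]].
  have := idx_basis t; rewrite Et Ea /vseq !map_rcons !is_basis_rcons ?size_rcons //; last exact: ltnW.
  rewrite blast_rcons // nth1_rcons // => /and4P[/and4P[-> -> _ _] -> -> ->] //.
have Eb0 : exists b : idx M j.+2, idx_seq b = rcons (idx_seq s) k.
  apply: idx_exists; first by rewrite size_rcons size_idx.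
  by rewrite /vseq map_rcons is_basis_rcons // bs bk (ltn_trans ltl lk).
have [b Eb] := Eb0.
exists a, b, U_(l)%MM, U_(k)%MM, s; split.
- by rewrite Et Ea Eb syz_pair_rcons // size_idx.
- by rewrite /idx_lt Ea Eb !map_rcons lex_lt_rcons.
- exact: ileadS.
- exact: ileadS.
- rewrite (ileadS Et); congr pair; apply/mnmP => z.
  by rewrite !(mnmE, mnm1E) -!val_eqE /=; lia.
Qed.

End Indices.

Lemma combine_complex (R : comNzRingType) (M : nat) (I J K : finType)
    (g : I -> free_mod R M J) (s : K -> free_mod R M I) h :
  (forall k, combine g (s k) = 0) -> combine g (combine s h) = 0.
Proof.
move=> gs; rewrite [X in combine g X]/combine.
apply: (big_ind (fun u => combine g u = 0)) => [|u v u0 v0|k _].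
- exact: combine0.
- by rewrite combineD u0 v0 addr0.
- by rewrite combineZ gs scaler0.
Qed.

(** * The tower of syzygies *)

Section Tower.
Variables (R : comNzRingType) (M : nat).
Notation poly := {mpoly R[M]}.
Variable F0 : idx M 1 -> free_mod R M (idx M 0).

(** The default 0 of [xget] does not occur in the tower: [tower_syzygy] shows that the set is
    inhabited once the level below has the Groebner property. *)
Definition next_family j (ord : term_order M (idx M j))
    (g : idx M j.+1 -> free_mod R M (idx M j)) (t : idx M j.+2) :
    free_mod R M (idx M j.+1) :=
  xget 0 [set s | exists a b, (idx_seq a, idx_seq b) = syz_pair (idx_seq t) /\
                     is_syzygy (@idx_lt M j.+1) ord g a b s].

(** Order and family share one recursion, because each depends on both components of the previous
    level. *)
Fixpoint tower j : term_order M (idx M j) *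
    (idx M j.+1 -> free_mod R M (idx M j)) :=
  match j with
  | 0 => (fun x y => mnm_lt x.1 y.1 : Prop, F0)
  | j'.+1 => let og := tower j' in
      (induced_order (@idx_lt M j'.+1) og.1 og.2, next_family og.1 og.2)
  end.

Definition tower_families : families R M := fun j => (tower j).2.

Arguments tower_families : clear implicits.
Notation F := tower_families.

Lemma order_tower j : order_at F j = (tower j).1.
Proof. by elim: j => //= j ->. Qed.

Definition groebner_level j (ord : term_order M (idx M j))
    (g : idx M j.+1 -> free_mod R M (idx M j)) :=
  [/\ forall t, is_lm ord (g t) (ilead t), forall t, tcoef (g t) (ilead t) = 1
    & forall h x, is_lm ord (combine g h) x ->
        exists i m, ilead i = (m, x.2) /\ (m <= x.1)%MM].

Lemma order0_good : good_order (@order_at R M F 0).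
Proof.
split.
- by move=> x /mnm_lt_irr.
- move=> y x z; exact: mnm_lt_trans.
- move=> [x s] [y t] /= ne; apply: mnm_lt_total => E; apply: ne.
  by rewrite E (idx0E s t).
- move=> x; have [m mE] : exists m, m = x.1 by exists x.1.
  elim/(well_founded_ind (@mnm_lt_wf M)): m x mE => m IH x xm.
  by split=> y yx; apply: (IH y.1) => //; rewrite xm.
- by move=> m x y; rewrite /= mnm_lt_add.
Qed.

Lemma tower_syzygy j (t : idx M j.+2) :
  good_order (order_at F j) -> groebner_level (order_at F j) (F j) ->
  exists a b ma mb c,
    [/\ (idx_seq a, idx_seq b) = syz_pair (idx_seq t),
        ilead a = (ma, c), ilead b = (mb, c), idx_lt a b
      & is_syzygy (@idx_lt M j.+1) (order_at F j) (F j) a b (F j.+1 t) /\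
        ilead t = ((mlcm ma mb - ma)%MM, a)].
Proof.
move=> ordG [lmP lm1 gb].
have irr := @idx_lt_irr M j.+1; have tr := @idx_lt_trans M j.+1.
have tot := @idx_lt_total M j.+1.
have [a [b [ma [mb [c [ab ltab la lb lt]]]]]] := syz_pair_lead t.
exists a, b, ma, mb, c; split=> //; split=> //.
have : exists s, [set s | exists a b, (idx_seq a, idx_seq b) = syz_pair (idx_seq t) /\
    is_syzygy (@idx_lt M j.+1) (order_at F j) (F j) a b s] s.
  have [s sP] := syzygy_exists ordG irr tr tot lmP lm1 gb la lb.
  by exists s, a, b.
case/(xgetPex 0) => a' [b' [ab']].
rewrite -[X in is_syzygy _ _ _ _ _ X]/(next_family _ _ t) order_tower.
by move: ab'; rewrite -ab => -[/idx_seq_inj -> /idx_seq_inj ->].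
Qed.

Hypothesis F0_groebner : groebner_level (order_at F 0) F0.

(** [schreyer] gives divisibility for the leading terms of the whole kernel of [combine g]. By
    [combine_complex] the combinations of syzygies lie in this kernel, so the Groebner property
    passes to the next level. *)
Lemma tower_spec j : good_order (order_at F j) /\ groebner_level (order_at F j) (F j).
Proof.
elim: j => [|j [ordG [lmP lm1 gb]]]; first by split; [apply: order0_good|].
have irr := @idx_lt_irr M j.+1; have tr := @idx_lt_trans M j.+1.
have tot := @idx_lt_total M j.+1.
have ordE : order_at F j.+1 = lifted_order (@idx_lt M j.+1) (order_at F j) (@ilead M j).
  exact: induced_orderE.
have ordG' : good_order (order_at F j.+1).
  by rewrite ordE; apply: lifted_order_good.
have syz := fun t => tower_syzygy t ordG (And3 lmP lm1 gb).
split=> //; split.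
- move=> t; have [a [b [ma [mb [c [_ la lb ltab [sP lt]]]]]]] := syz t.
  by have [] := syzygy_lm ordG irr tr tot lmP lm1 la lb ltab sP; rewrite lt ordE.
- move=> t; have [a [b [ma [mb [c [_ la lb ltab [sP lt]]]]]]] := syz t.
  by have [] := syzygy_lm ordG irr tr tot lmP lm1 la lb ltab sP; rewrite lt.
- move=> h x; rewrite ordE.
  apply: (schreyer ordG irr lmP lm1 (@ilead_cover M j)).
  apply: combine_complex => t.
  have [a [b [ma [mb [c [_ la lb ltab [sP lt]]]]]]] := syz t.
  exact: (syzygy_combine ordG lmP la lb sP).
Qed.


Lemma tower_complex j (t : idx M j.+2) : combine (F j) (F j.+1 t) = 0.
Proof.
have [ordG [lmP lm1 gb]] := tower_spec j.
have [a [b [ma [mb [c [_ la lb ltab [sP _]]]]]]] := tower_syzygy t ordG (And3 lmP lm1 gb).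
exact: (syzygy_combine ordG lmP la lb sP).
Qed.

(** The kernel is stable under reduction by syzygies and [schreyer] supplies a divisor each time, so
    the division leaves no remainder and its quotients are the preimage. *)
Lemma tower_exact j h : phi F j h = 0 <-> exists h', h = phi F j.+1 h'.
Proof.
split=> [h0|[h' ->]]; last exact/combine_complex/tower_complex.
have [ordG [lmP lm1 _]] := tower_spec j.
have [ordG' [lmP' lm1' _]] := tower_spec j.+1.
have [|||q dq] := @divides_toP _ _ _ _ (@idx_lt M j.+2) (order_at F j.+1)
  ordG' (@idx_lt_irr _ _) (@idx_lt_trans _ _) (@idx_lt_total _ _) (F j.+1)
  (@ilead M j.+1) lmP' lm1' (fun h => combine (F j) h = 0) _ _ h.
- move=> h1 c i h10; rewrite combineB combineZ tower_complex h10 scaler0.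
  exact: subrr.
- move=> h1 x h10; rewrite /= (induced_orderE _ ordG lmP).
  exact: (schreyer ordG (@idx_lt_irr _ _) lmP lm1 (@ilead_cover M j)).
- exact: h0.
by exists q; rewrite /phi -/(combine _ _) (divides_to_combine dq).
Qed.

Lemma tower_families_resolution :
  (forall j, monic_family (order_at F j) (F j)) /\
  forall j (t : idx M j.+2), exists a b : idx M j.+1,
    (idx_seq a, idx_seq b) = syz_pair (idx_seq t) /\
    is_syzygy (@idx_lt M j.+1) (order_at F j) (F j) a b (F j.+1 t).
Proof.
split=> j.
  move=> t; have [_ [lmP lm1 _]] := tower_spec j.
  by exists (ilead t).
move=> t; have [ordG gb] := tower_spec j.
have [a [b [ma [mb [c [ab _ _ _ [sP _]]]]]]] := tower_syzygy t ordG gb.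
by exists a, b.
Qed.

Section Degrees.
Variable v : M.-tuple lattice.

Lemma mnm_deg2D a b : mnm_deg2 v (a + b)%MM = mnm_deg2 v a + mnm_deg2 v b.
Proof.
by rewrite /mnm_deg2 -big_split; apply: eq_bigr => i _; rewrite mnmDE mulrnDr.
Qed.

Lemma mnm_deg20 : mnm_deg2 v 0%MM = 0.
Proof. by rewrite /mnm_deg2 big1 // => i _; rewrite mnm0E. Qed.

Lemma mnm_deg2U i : mnm_deg2 v U_(i)%MM = tnth v i.
Proof.
rewrite /mnm_deg2 (bigD1 i) //= mnm1E eqxx big1 ?addr0 // => k ki.
by rewrite mnm1E eq_sym (negbTE ki).
Qed.

Lemma idx_deg2_lead j (t : idx M j.+1) :
  idx_deg2 v t = mnm_deg2 v (ilead t).1 + idx_deg2 v (ilead t).2.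
Proof.
case: j t => [|j] t.
  have [i [k [E _]]] := idx1P t.
  rewrite (ilead0 E) mnm_deg2D !mnm_deg2U /idx_deg2 E.
  have -> : idx_seq (ilead t).2 = [::] by apply/size0nil/size_idx.
  by rewrite !big_cons !big_nil !addr0.
have [s [k E]] := idxSP t.
by rewrite (ileadS E) mnm_deg2U /idx_deg2 E -cats1 big_cat big_seq1 addrC.
Qed.

Hypothesis F0_homog : forall t, homog2 v (idx_deg2 v t) (F0 t).

Lemma homog2E j u (h : free_mod R M (idx M j)) :
  homog2 v u h <-> whomog (mnm_deg2 v) (@idx_deg2 M v j) u h.
Proof. by split=> hu; [case=> m t; apply: hu | move=> t m; apply: hu]. Qed.

Lemma tower_homog j t : homog2 v (idx_deg2 v t) (F j t).
Proof.
elim: j t => [|j IH] t; first exact: F0_homog.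
have [ordG gb] := tower_spec j; have [lmP _ _] := gb.
have [a [b [ma [mb [c [_ la lb _ [sP lt]]]]]]] := tower_syzygy t ordG gb.
have IH' i : whomog (mnm_deg2 v) (@idx_deg2 M v j) (idx_deg2 v i) (F j i).
  exact/homog2E/IH.
apply/homog2E; have := syzygy_homog ordG lmP mnm_deg2D mnm_deg20 IH' la lb sP.
congr (whomog _ _ _ _).
rewrite (idx_deg2_lead t) lt /= (idx_deg2_lead a) la /= addrA -mnm_deg2D.
by rewrite submlcmK.
Qed.

Lemma tower_phi_homog j u h : homog2 v u h -> homog2 v u (phi F j h).
Proof.
move=> /homog2E hu; apply/homog2E.
by apply: combine_homog hu => [|i]; [exact: mnm_deg2D | exact/homog2E/tower_homog].
Qed.

End Degrees.

Section MinimalTower.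
Variable mm : set R.
Hypothesis mmI : is_ideal mm.
Hypothesis F0_low : forall t x, (mdeg x.1 < 2)%N -> mm (tcoef (F0 t) x).

(** Above level 0 the leading terms have degree 1, so the hypothesis of [syzygy_const] concerns only
    the constant coefficients of the syzygies. These syzygies are killed by the previous map, so the
    statement one level down applies to them. *)
Lemma tower_minimal j h t : phi F j h = 0 -> mm ((h t : poly)@_0%MM).
Proof.
elim: j h t => [|j IH] h t h0.
  have [ordG [lmP lm1 _]] := tower_spec 0.
  exact: (syzygy_const ordG lmP lm1 mmI (@mdeg_ilead M 0) (@ilead_inj M 0) F0_low t h0).
have [ordG [lmP lm1 _]] := tower_spec j.+1.
apply: (syzygy_const ordG lmP lm1 mmI (@mdeg_ilead M j.+1) (@ilead_inj M j.+1) _ t h0).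
move=> i [x s]; rewrite /= ltnS leqn0 mdeg_eq0 => /eqP ->.
exact/IH/tower_complex.
Qed.

End MinimalTower.

End Tower.

(** * The ranks *)

Section Cardinality.
Local Open Scope nat_scope.

Lemma sum_ltn_ord M c : \sum_(k < M) (c < k) = M - c.+1.
Proof. by elim: M => [|M IH]; rewrite ?big_ord0 // big_ord_recr /= IH; lia. Qed.

(** The summand i = 0 is (M-2) C(M-3, j) = (j+1) C(M-2, j+1), and Pascal's rule adds it to the value
    for M - 1. *)
Lemma sum_bin M j : \sum_(i < M) (M - i - 2) * 'C(M - i - 3, j) =
  j.+1 * 'C(M.-1, j.+2).
Proof.
elim: M => [|M IH]; first by rewrite big_ord0 bin0n muln0.
rewrite big_ord_recl /= subn0; under eq_bigr do rewrite /bump /= add1n subSS.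
rewrite {}IH; case: M => [|M]; first by rewrite !bin0n.
rewrite /= binS mulnDr addnC; congr (_ + _).
by rewrite !subSS subn0 -mul_bin_diag; case: M => [|M]; rewrite ?subSS ?subn0.
Qed.

Variables (M j : nat).

Let allowed (i l : 'I_M) : {set 'I_M} :=
  [set k : 'I_M | [&& i < k, k != l.-1 :> nat & k != l :> nat]].

(** As i + 1 < l, both l - 1 and l are among the M - i - 1 indices above i. *)
Lemma card_allowed (i l : 'I_M) : i.+1 < l -> #|allowed i l| = M - i - 3.
Proof.
move=> il; have l1M : l.-1 < M by have := ltn_ord l; lia.
pose l1 := Ordinal l1M.
have := sum_ltn_ord M i; rewrite -big_mkcond sum1dep_card /=.
rewrite (cardsD1 l) (cardsD1 l1) !inE /=.
have -> : i < l by lia.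
have -> : i < l.-1 by lia.
have -> : (l1 != l) by rewrite -val_eqE /=; lia.
have -> : [set x : 'I_M | i < x] :\ l :\ l1 = allowed i l.
  by apply/setP => k; rewrite !inE -!val_eqE /=; lia.
have -> : M - i - 3 = M - i.+1 - 2 by lia.
by move=> <-; rewrite addnA addKn.
Qed.

(** An increasing tail is the same as the set of its entries, which turns the count into one of
    subsets of given size. *)
Definition idx_triple (t : idx M j.+1) : 'I_M * ('I_M * {set 'I_M}) :=
  let w : j.+2.-tuple 'I_M := val t in
  (tnth w ord0, (tnth w (lift ord0 ord0), [set k in drop 2 w])).

Lemma idx_tripleE t i l ks : idx_seq t = i :: l :: ks ->
  idx_triple t = (i, (l, [set k in ks])).
Proof.
rewrite /idx_triple /idx_seq => E.
by rewrite !(tnth_nth i) E /= drop0.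
Qed.

Lemma idx_seqP (t : idx M j.+1) : exists i l ks,
  [/\ idx_seq t = i :: l :: ks, i.+1 < l, size ks = j,
      path (relpre val ltn) i ks & {subset ks <= allowed i l}].
Proof.
have := size_idx t; have := idx_basis t.
case: (idx_seq t) => [|i [|l ks]] //= /and3P[il pks /allP ok] [sz].
exists i, l, ks; split=> //; first by rewrite -path_map.
move=> k kks; have := ok _ (map_f val kks); rewrite inE => ->; rewrite andbT.
have /allP := order_path_min ltn_trans pks; apply; exact: map_f.
Qed.

Lemma idx_triple_inj : injective idx_triple.
Proof.
move=> s t; have [i [l [ks [Es _ _ ps _]]]] := idx_seqP s.
have [i' [l' [ks' [Et _ _ pt _]]]] := idx_seqP t.
rewrite (idx_tripleE Es) (idx_tripleE Et) => -[Ei El /setP Eks].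
apply: idx_seq_inj; rewrite Es Et -Ei -El; congr [:: _, _ & _].
apply: (@irr_sorted_eq _ (relpre val ltn)).
- by move=> x y z /=; apply: ltn_trans.
- by move=> x /=; apply: ltnn.
- exact: path_sorted ps.
- exact: path_sorted pt.
- by move=> x; have := Eks x; rewrite !inE.
Qed.

Lemma idx_triple_imset : idx_triple @: predT =
  [set x : 'I_M * ('I_M * {set 'I_M}) | x.1.+1 < x.2.1 &
     (x.2.2 \subset allowed x.1 x.2.1) && (#|x.2.2| == j)].
Proof.
apply/setP => -[i [l A]]; rewrite !inE /=; apply/imsetP/and3P.
  case=> t _; have [i' [l' [ks [Et il sz pk sub]]]] := idx_seqP t.
  rewrite (idx_tripleE Et) => -[-> -> ->]; split=> //.
    by apply/fintype.subsetP => k; rewrite !inE => /sub; rewrite inE.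
  rewrite cardsE (card_uniqP _) ?sz //.
  apply: (sorted_uniq _ _ (path_sorted pk)).
    by move=> x y z /=; apply: ltn_trans.
  by move=> x /=; apply: ltnn.
case=> il /fintype.subsetP sub /eqP sz.
have so : sorted ltn (map val (enum A)).
  rewrite {1}/enum_mem sorted_map; apply: sorted_filter.
    by move=> x y z /=; apply: ltn_trans.
  by rewrite -sorted_map -enumT val_enum_ord iota_ltn_sorted.
have al k : k \in map val (enum A) -> [&& i < k, k != l.-1 :> nat & k != l :> nat].
  by case/mapP => k'; rewrite mem_enum => /sub; rewrite inE => + ->.
have [||t Et] := @idx_exists M j.+1 [:: i, l & enum A].
- by rewrite /= -sz cardE.
- rewrite /= il /=; apply/andP; split; last first.
    by apply/allP => k /al /and3P[_ -> ->].
  rewrite path_min_sorted //; apply/allP => k /al /and3P[] //.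
exists t; first by [].
 rewrite (idx_tripleE Et); congr (_, (_, _)).
by apply/setP => k; rewrite inE mem_enum.
Qed.

Lemma card_idx : #|idx M j.+1| = j.+1 * 'C(M.-1, j.+2).
Proof.
rewrite -sum_bin -(card_imset predT idx_triple_inj) idx_triple_imset.
rewrite -sum1dep_card big_mkcond /= -(pair_bigA _ (fun (i : 'I_M) (y : 'I_M * {set 'I_M}) =>
  if (i.+1 < y.1) && ((y.2 \subset allowed i y.1) && (#|y.2| == j)) then 1 else 0)) /=.
apply: eq_bigr => i _.
rewrite -(pair_bigA _ (fun (l : 'I_M) (A : {set 'I_M}) =>
  if (i.+1 < l) && ((A \subset allowed i l) && (#|A| == j)) then 1 else 0)) /=.
have -> : M - i - 2 = \sum_(l < M) (i.+1 < l) by rewrite sum_ltn_ord; lia.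
rewrite big_distrl /=; apply: eq_bigr => l _.
case: ltnP => il /=; last by rewrite big1 ?mul0n.
by rewrite -big_mkcond sum1dep_card cards_draws card_allowed // mul1n.
Qed.

End Cardinality.

(** * The fan algebra *)

Section PowerProducts.
Variables (R : comNzRingType) (n : nat) (p : 'I_n -> R).

Lemma ppowD (c d : 'I_n -> nat) : ppow p (fun t => c t + d t)%N = ppow p c * ppow p d.
Proof. by rewrite /ppow -big_split; apply: eq_bigr => t _; rewrite exprD. Qed.

Lemma eq_ppow (c d : 'I_n -> nat) : c =1 d -> ppow p c = ppow p d.
Proof. by move=> cd; apply: eq_bigr => t _; rewrite cd. Qed.

Lemma ppow0 (c : 'I_n -> nat) : (forall t, c t = 0%N) -> ppow p c = 1.
Proof. by move=> c0; rewrite /ppow big1 // => t _; rewrite c0 expr0. Qed.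

Lemma ppow_lreg (c : 'I_n -> nat) : (forall t, GRing.lreg (p t)) -> GRing.lreg (ppow p c).
Proof.
move=> pR; rewrite /ppow; elim/big_ind: _ => [|x y xR yR|t _].
- exact: lreg1.
- exact: lregM.
- exact/lregX.
Qed.

Lemma ppow_mem (mm : set R) (c : 'I_n -> nat) : is_ideal mm -> (forall t, mm (p t)) ->
  (exists t, 0 < c t)%N -> mm (ppow p c).
Proof.
move=> [_ _ mmM] pm [t ct]; rewrite /ppow (bigD1 t) //= mulrC; apply: (mmM).
by rewrite -(prednK ct) exprSr; apply: (mmM).
Qed.

End PowerProducts.

(** * The comparison module through its coordinates *)

Section WeightedSums.
Variables (R : comNzRingType) (M : nat).
Notation poly := {mpoly R[M]}.
Variable kap : 'X_{1..M} -> R.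

Definition wsum (P : poly) : R := \sum_(m <- msupp P) P@_m * kap m.

Lemma wsumE (s : seq 'X_{1..M}) (P : poly) : uniq s -> {subset msupp P <= s} ->
  wsum P = \sum_(m <- s) P@_m * kap m.
Proof.
move=> us sub; rewrite /wsum [RHS](bigID (mem (msupp P))) /= [X in _ + X]big1 ?addr0.
  rewrite -[RHS]big_filter; apply: perm_big; apply: uniq_perm.
  - exact: msupp_uniq.
  - exact: filter_uniq.
  - move=> m; rewrite mem_filter /= andbC.
    by have [/sub -> |] := boolP (m \in msupp P); rewrite ?andbF.
by move=> m /memN_msupp_eq0 ->; rewrite mul0r.
Qed.

Lemma wsumD P Q : wsum (P + Q) = wsum P + wsum Q.
Proof.
have us := undup_uniq (msupp P ++ msupp Q).
rewrite (wsumE us) ?(wsumE (P := P) us) ?(wsumE (P := Q) us) -?big_split.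
- by apply: eq_bigr => m _; rewrite mcoeffD mulrDl.
- by move=> m mQ; rewrite mem_undup mem_cat mQ orbT.
- by move=> m mP; rewrite mem_undup mem_cat mP.
- by move=> m /msuppD_le; rewrite mem_undup.
Qed.

Lemma wsumZ c P : wsum (c *: P) = c * wsum P.
Proof.
rewrite (wsumE (msupp_uniq P)); last exact: msuppZ_le.
by rewrite /wsum mulr_sumr; apply: eq_bigr => m _; rewrite mcoeffZ mulrA.
Qed.

Lemma wsum0 : wsum 0 = 0.
Proof. by rewrite -(scale0r 0) wsumZ mul0r. Qed.

Lemma wsumX m : wsum 'X_[m] = kap m.
Proof. by rewrite /wsum msuppX big_seq1 mcoeffX eqxx mul1r. Qed.

Lemma wsum_MX m (P : poly) : wsum ('X_[m] * P) = \sum_(k <- msupp P) P@_k * kap (m + k)%MM.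
Proof.
rewrite [in LHS](mpolyE P) mulr_sumr (big_morph wsum wsumD wsum0).
by apply: eq_bigr => k _; rewrite -scalerAr wsumZ -mpolyXD wsumX.
Qed.

End WeightedSums.

Section Chain.
Variables (R : comNzRingType) (n : nat) (p : 'I_n -> R) (f : 'I_n -> lattice -> nat).
Variables (M : nat) (v : M.-tuple lattice) (D : set lattice).
Notation poly := {mpoly R[M]}.
Notation deg := (mnm_deg2 v).

Definition standard (m : 'X_{1..M}) :=
  forall i j : 'I_M, (i.+1 < j)%N -> (0 < m i)%N -> (0 < m j)%N -> False.

Definition wt t (m : 'X_{1..M}) : nat := (\sum_i m i * f t (tnth v i))%N.

(* All that the resolution needs to know about the clockwise sorted Hilbert
   bases. *)
Record good_chain : Prop := GoodChain {
  chain_0 : D 0;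
  chain_D : forall u w, D u -> D w -> D (u + w);
  chain_v : forall i, D (tnth v i);
  chain_sub : forall t u w, D u -> D w -> (f t (u + w)%R <= f t u + f t w)%N;
  chain_lin : forall t m, standard m -> f t (deg m) = wt t m;
  chain_inj : forall m m', standard m -> standard m' -> deg m = deg m' -> m = m';
  chain_surj : forall u, D u -> exists2 m, standard m & deg m = u;
  chain_red : forall i j : 'I_M, (i.+1 < j)%N -> exists k k' : 'I_M, exists a b,
    [/\ k' = k.+1 :> nat, tnth v i + tnth v j = tnth v k *+ a + tnth v k' *+ b
      & mnm_lt (U_(k) *+ a + U_(k') *+ b)%MM (U_(i) + U_(j))%MM] }.

Hypothesis chain : good_chain.

Lemma wtD t m m' : wt t (m + m')%MM = (wt t m + wt t m')%N.
Proof. by rewrite /wt -big_split; apply: eq_bigr => i _; rewrite mnmDE mulnDl. Qed.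

Lemma wtU t i : wt t U_(i)%MM = f t (tnth v i).
Proof.
rewrite /wt (bigD1 i) //= mnm1E eqxx big1 ?addn0 ?mul1n // => k ki.
by rewrite mnm1E eq_sym (negbTE ki) mul0n.
Qed.

Lemma wt0 t : wt t 0%MM = 0%N.
Proof. by rewrite /wt big1 // => i _; rewrite mnm0E. Qed.

Lemma wtMn t m a : wt t (m *+ a)%MM = (wt t m * a)%N.
Proof.
by elim: a => [|a IH]; rewrite ?mulm0n ?muln0 ?wt0 // mulmS wtD IH mulnS.
Qed.

Lemma degMn m a : deg (m *+ a)%MM = deg m *+ a.
Proof.
by elim: a => [|a IH]; rewrite ?mulm0n ?mulr0n ?mnm_deg20 // mulmS mnm_deg2D IH mulrS.
Qed.

Lemma standard0 : standard 0%MM.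
Proof. by move=> i j _; rewrite mnm0E. Qed.

Lemma chain_f0 t : f t 0 = 0%N.
Proof. by have := chain_lin chain t standard0; rewrite mnm_deg20 wt0. Qed.

Lemma chain_mul t u k : D u -> D (u *+ k) /\ (f t (u *+ k)%R <= f t u * k)%N.
Proof.
move=> Du; elim: k => [|k [Dk le]].
  by rewrite mulr0n chain_f0; split=> //; apply: chain_0.
rewrite mulrS; split; first exact: chain_D.
by rewrite mulnS (leq_trans (chain_sub chain t Du Dk)) ?leq_add2l.
Qed.

Lemma chain_deg t m : D (deg m) /\ (f t (deg m) <= wt t m)%N.
Proof.
rewrite /mnm_deg2 /wt.
elim/big_rec2: _ => [|i c u _ [Du le]].
  by rewrite chain_f0; split=> //; apply: chain_0.
have [Di lei] := chain_mul t (m i) (chain_v chain i).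
split; first exact: chain_D.
by rewrite (leq_trans (chain_sub chain t Di Du)) // mulnC leq_add.
Qed.

Lemma chain_degD m : D (deg m).
Proof.
by rewrite /mnm_deg2; elim/big_ind: _ => [|u w|i _];
  [exact: chain_0 | exact: chain_D |]; elim: (m i) => [|k IH];
  rewrite ?mulr0n ?mulrS; [exact: chain_0 | apply: chain_D => //; exact: chain_v].
Qed.

Lemma lep_pair (i j : 'I_M) (m : 'X_{1..M}) : i != j -> (0 < m i)%N -> (0 < m j)%N ->
  (U_(i) + U_(j) <= m)%MM.
Proof.
move=> ne mi mj; apply/mnm_lepP => l; rewrite mnmDE !mnm1E.
case: (eqVneq i l) => [<-|_]; first by rewrite eq_sym (negbTE ne) addn0.
by case: (eqVneq j l) => [<-|_].
Qed.

(* The standard monomial is the lexicographically smallest one of its degree. *)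
Lemma standard_min x m : standard x -> deg m = deg x -> m = x \/ mnm_lt x m.
Proof.
move=> sx; elim/(well_founded_ind (@mnm_lt_wf M)): m => m IH dm.
have [sm|] := pselect (standard m); first by left; exact: (chain_inj chain).
rewrite /standard => /existsNP[i /existsNP[j]].
move=> /not_implyP[ij /not_implyP[mi /not_implyP[mj _]]].
have [k [k' [a [b [_ E lt]]]]] := chain_red chain ij.
have ne : i != j by rewrite -val_eqE /=; lia.
pose m0 := (m - (U_(i) + U_(j)))%MM.
have mE : m = (m0 + (U_(i) + U_(j)))%MM.
  by rewrite /m0 submK // lep_pair.
(* One straightening of the factor Y_i Y_j keeps the degree and lowers [m]; the induction takes over
   from there. *)
pose m' := (m0 + (U_(k) *+ a + U_(k') *+ b))%MM.
have lt' : mnm_lt m' m by rewrite [X in mnm_lt _ X]mE mnm_lt_add.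
have dm' : deg m' = deg x.
  by rewrite -dm mE !mnm_deg2D !degMn !mnm_deg2U -E.
right; case: (IH _ lt' dm') => [<-//|xm']; exact: mnm_lt_trans xm' lt'.
Qed.

(** The coefficient of e_u in the image of Y^m in the comparison module. When u is the degree of m,
    [chain_deg] gives f u <= wt m, so the subtraction does not truncate. *)
Definition kappa (u : lattice) (m : 'X_{1..M}) : R :=
  if deg m == u then ppow p (fun t => wt t m - f t u)%N else 0.

(* The functionals [wsum (kappa u)] are the coordinates of the image of a
   polynomial in the free module with basis e_u, multiplied by
   e_u e_w = p^(f u + f w - f (u + w)) e_(u + w). *)
Definition in_kernel (P : poly) : Prop := forall u, wsum (kappa u) P = 0.

(** The second factor does not depend on [k]: multiplication by Y^m carries the coordinate at
    [u - deg m] to a multiple of it at [u], and so the kernel is an ideal. Subadditivity of [f t]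
    keeps the exponents from truncating. *)
Lemma kappaD u m k : kappa u (m + k)%MM =
  kappa (u - deg m) k * ppow p (fun t => wt t m + f t (u - deg m)%R - f t u)%N.
Proof.
rewrite /kappa mnm_deg2D; have -> : (deg m + deg k == u) = (deg k == u - deg m).
  by rewrite eq_sym [RHS]eq_sym subr_eq addrC.
case: eqP => [E|_]; last by rewrite mul0r.
rewrite -ppowD; apply: eq_ppow => t; rewrite wtD -E.
have [_ le1] := chain_deg t k; have [_ le2] := chain_deg t m.
have uE : u = deg m + deg k by rewrite E addrC subrK.
have := chain_sub chain t (chain_degD m) (chain_degD k); rewrite -uE; lia.
Qed.

Lemma in_kernelX m P : in_kernel P -> in_kernel ('X_[m] * P).
Proof.
move=> NP u; rewrite wsum_MX; under eq_bigr do rewrite kappaD mulrA.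
by rewrite -mulr_suml -/(wsum _ _) NP mul0r.
Qed.

Lemma in_kernelD P Q : in_kernel P -> in_kernel Q -> in_kernel (P + Q).
Proof. by move=> NP NQ u; rewrite wsumD NP NQ addr0. Qed.

Lemma in_kernelZ c P : in_kernel P -> in_kernel (c *: P).
Proof. by move=> NP u; rewrite wsumZ NP mulr0. Qed.

Lemma in_kernel0 : in_kernel 0.
Proof. by move=> u; rewrite wsum0. Qed.

Lemma in_kernelM Q P : in_kernel P -> in_kernel (Q * P).
Proof.
move=> NP; rewrite (mpolyE Q) mulr_suml; elim/big_ind: _ => [|A B|m _].
- exact: in_kernel0.
- exact: in_kernelD.
- by rewrite -scalerAl; apply/in_kernelZ/in_kernelX.
Qed.

(** If x were standard, any other monomial of the same degree would exceed x and be absent from P.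
    The coordinate at [deg x] would then be P@_x times p^0, hence nonzero. *)
Lemma in_kernel_lead P (x : 'X_{1..M}) : in_kernel P -> P@_x <> 0 ->
  (forall m, P@_m <> 0 -> m <> x -> mnm_lt m x) -> ~ standard x.
Proof.
move=> NP Px lex sx; have xP : x \in msupp P by rewrite mcoeff_msupp; apply/eqP.
apply: Px; rewrite -(NP (deg x)).
rewrite /wsum (bigD1_seq x) ?msupp_uniq //= big1_seq ?addr0; last first.
  move=> m /andP[/eqP mx mP].
  rewrite /kappa; case: eqP => [dm|_]; last by rewrite mulr0.
  have Pm : P@_m <> 0 by apply/eqP; rewrite -mcoeff_msupp.
  have [//|lt] := standard_min sx dm.
  by case: (mnm_lt_irr (mnm_lt_trans lt (lex _ Pm mx))).
rewrite /kappa eqxx ppow0 ?mulr1 // => t.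
by rewrite (chain_lin chain) // subnn.
Qed.

End Chain.

Section LaurentCoefficients.
Variable R : comNzRingType.

Lemma lcoef_lmon (c : R) u w : lcoef u (lmon c w) = c *+ (w == u).
Proof. exact: monalg.mcoeffU. Qed.

Lemma lcoef0 u : lcoef u (0 : laurent R) = 0.
Proof. exact: monalg.mcoeff0. Qed.

Lemma lcoefD u (g h : laurent R) : lcoef u (g + h) = lcoef u g + lcoef u h.
Proof. exact: monalg.mcoeffD. Qed.

Lemma laurentP (g h : laurent R) : (forall u, lcoef u g = lcoef u h) -> g = h.
Proof. by move=> E; apply/monalg.malgP. Qed.

Lemma lcoef_sum u (I : Type) (s : seq I) (E : I -> laurent R) :
  lcoef u (\sum_(i <- s) E i) = \sum_(i <- s) lcoef u (E i).
Proof. exact: (big_morph (lcoef u) (lcoefD u) (lcoef0 u)). Qed.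

Lemma lmonM (c d : R) u w : lmon c u * lmon d w = lmon (c * d) (u + w).
Proof. exact: lmulUU. Qed.

Lemma lmonX (c : R) u k : lmon c u ^+ k = lmon (c ^+ k) (u *+ k).
Proof. by elim: k => [//|k IH]; rewrite exprS IH lmonM -exprS mulrS. Qed.

Lemma lmon_prod (I : Type) (s : seq I) (c : I -> R) (u : I -> lattice) :
  \prod_(i <- s) lmon (c i) (u i) = lmon (\prod_(i <- s) c i) (\sum_(i <- s) u i).
Proof. by elim/big_rec3: _ => [//|i x y z _ ->]; rewrite lmonM. Qed.

End LaurentCoefficients.

(** * The binomials S_(i,j) and the map to the fan algebra *)

Section LevelZero.
Variables (R : comNzRingType) (n : nat) (p : 'I_n -> R) (f : 'I_n -> lattice -> nat).
Variables (M : nat) (v : M.-tuple lattice) (D : set lattice).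
Notation poly := {mpoly R[M]}.
Notation deg := (mnm_deg2 v).
Hypothesis chain : good_chain f v D.
Notation wt := (wt f v).

Definition gam (i j : 'I_M) t : nat :=
  (f t (tnth v i) + f t (tnth v j) - f t (tnth v i + tnth v j)%R)%N.

Definition binom_poly (i j k k' : 'I_M) (a b : nat) : poly :=
  'X_i * 'X_j - ppow p (gam i j) *: ('X_k ^+ a * 'X_k' ^+ b).

Lemma binom_polyE i j k k' a b : binom_poly i j k k' a b =
  'X_[U_(i) + U_(j)] - ppow p (gam i j) *: 'X_[U_(k) *+ a + U_(k') *+ b].
Proof. by rewrite /binom_poly !mpolyXn -!mpolyXD. Qed.

Definition straightening (t : idx M 1) (g : free_mod R M (idx M 0)) : Prop :=
  exists i j k k' : 'I_M, exists a b, [/\ idx_seq t = [:: i; j],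
    k' = k.+1 :> nat, tnth v i + tnth v j = tnth v k *+ a + tnth v k' *+ b,
    mnm_lt (U_(k) *+ a + U_(k') *+ b)%MM (U_(i) + U_(j))%MM
    & g = [ffun=> binom_poly i j k k' a b]].

Definition family0 (t : idx M 1) : free_mod R M (idx M 0) := xget 0 [set g | straightening t g].

Lemma family0P t : straightening t (family0 t).
Proof.
have [i [j [E ij]]] := idx1P t.
have [k [k' [a [b [kk' dE lt]]]]] := chain_red chain ij.
have : [set g | straightening t g] [ffun=> binom_poly i j k k' a b].
  by exists i, j, k, k', a, b.
by move=> /(xgetI 0).
Qed.

Lemma tcoef_const (P : poly) (x : term M (idx M 0)) :
  tcoef ([ffun=> P] : free_mod R M (idx M 0)) x = P@_x.1.
Proof. by rewrite /tcoef ffunE. Qed.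

Lemma family0_coef t : exists i j k k' : 'I_M, exists a b, [/\ idx_seq t = [:: i; j],
    (i.+1 < j)%N, k' = k.+1 :> nat, tnth v i + tnth v j = tnth v k *+ a + tnth v k' *+ b &
    mnm_lt (U_(k) *+ a + U_(k') *+ b)%MM (U_(i) + U_(j))%MM /\
    forall x, tcoef (family0 t) x = ((U_(i) + U_(j))%MM == x.1)%:R -
       ppow p (gam i j) * ((U_(k) *+ a + U_(k') *+ b)%MM == x.1)%:R].
Proof.
have [i [j [k [k' [a [b [E kk' dE lt fE]]]]]]] := family0P t.
exists i, j, k, k', a, b; split=> //.
  by have [i' [j' [E' ij]]] := idx1P t; move: ij; rewrite E in E'; case: E' => -> ->.
split=> // x; rewrite fE tcoef_const binom_polyE mcoeffB mcoeffZ.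
by rewrite !mcoeffX.
Qed.

(** The straightened monomial is standard, so its weight is the value of f at its degree, and the
    exponent in S_(i,j) is an exact difference of weights. This makes S_(i,j) vanish in the
    comparison module. *)
Lemma gamE (i j k k' : 'I_M) a b t : k' = k.+1 :> nat ->
  tnth v i + tnth v j = tnth v k *+ a + tnth v k' *+ b ->
  wt t (U_(i) + U_(j))%MM = (gam i j t + wt t (U_(k) *+ a + U_(k') *+ b)%MM)%N.
Proof.
move=> kk' dE; have s : standard (U_(k) *+ a + U_(k') *+ b)%MM.
  move=> x y; rewrite !mnmDE !mulmnE !mnm1E.
  case: (k =P x) => [/(congr1 val) /= ?|_]; case: (k' =P x) => [/(congr1 val) /= ?|_];
  case: (k =P y) => [/(congr1 val) /= ?|_]; case: (k' =P y) => [/(congr1 val) /= ?|_]; lia.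
have := chain_lin chain t s; rewrite mnm_deg2D !degMn !mnm_deg2U -dE => <-.
rewrite /gam wtD !wtU; have := chain_sub chain t (chain_v chain i) (chain_v chain j).
lia.
Qed.

Lemma binom_in_kernel (i j k k' : 'I_M) a b : k' = k.+1 :> nat ->
  tnth v i + tnth v j = tnth v k *+ a + tnth v k' *+ b ->
  in_kernel p f v (binom_poly i j k k' a b).
Proof.
move=> kk' dE u; rewrite binom_polyE -scaleNr wsumD wsumZ !wsumX /kappa.
rewrite !mnm_deg2D !degMn !mnm_deg2U dE.
case: eqP => [uE|_]; last by rewrite mulr0 addr0.
rewrite mulNr -ppowD; apply/eqP; rewrite subr_eq0; apply/eqP/eq_ppow => t.
have := gamE t kk' dE.
have [_] := chain_deg chain t (U_(k) *+ a + U_(k') *+ b)%MM.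
rewrite mnm_deg2D !degMn !mnm_deg2U uE; lia.
Qed.

Lemma family0_kernel h s : in_kernel p f v (combine family0 h s).
Proof.
rewrite /combine free_sumE; elim/big_ind: _ => [|P Q|t _].
- exact: in_kernel0.
- exact: in_kernelD.
rewrite free_scaleE; apply: (in_kernelM chain).
have [i [j [k [k' [a [b [E kk' dE lt ->]]]]]]] := family0P t.
by rewrite ffunE; apply: binom_in_kernel.
Qed.

Lemma kernel_lead (h : free_mod R M (idx M 0)) x :
  (forall s, in_kernel p f v (h s)) ->
  is_lm (fun y z : term M (idx M 0) => mnm_lt y.1 z.1) h x ->
  exists i m, @ilead M 0 i = (m, x.2) /\ (m <= x.1)%MM.
Proof.
move=> Nh [hx lex].
have ns : ~ standard x.1.
  apply: (in_kernel_lead chain (Nh x.2) hx) => m hm mx.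
  by apply: (lex (m, x.2)) => // E; apply: mx; rewrite -E.
move: ns; rewrite /standard => /existsNP[i /existsNP[j]].
move=> /not_implyP[ij /not_implyP[xi /not_implyP[xj _]]].
have [//||t Et] := @idx_exists M 1 [:: i; j]; first by rewrite /= ij.
exists t, (U_(i) + U_(j))%MM; rewrite -(ilead0 Et) (idx0E x.2 (ilead t).2).
split; first by case: (ilead t).
have ne : i != j by rewrite -val_eqE /=; lia.
by rewrite (ilead0 Et) lep_pair.
Qed.

Notation F := (tower_families family0).

Lemma family0_groebner : groebner_level (order_at F 0) family0.
Proof.
split.
- move=> t; have [i [j [k [k' [a [b [E ij kk' dE [lt cE]]]]]]]] := family0_coef t.
  have ne : (U_(k) *+ a + U_(k') *+ b == U_(i) + U_(j) :> 'X_{1..M})%MM = false.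
    by apply/eqP => e; move: lt; rewrite e => /mnm_lt_irr.
  split=> [|[m s]].
    rewrite cE (ilead0 E) ne mulr0 subr0 eqxx; exact/eqP/oner_neq0.
  rewrite cE /=; case: eqP => [<- _ []|_].
    by rewrite [RHS]surjective_pairing (ilead0 E) (idx0E s (ilead t).2).
  rewrite sub0r (ilead0 E); case: eqP => [<- //|_].
  by rewrite mulr0 oppr0.
- move=> t; have [i [j [k [k' [a [b [E ij kk' dE [lt cE]]]]]]]] := family0_coef t.
  have ne : (U_(k) *+ a + U_(k') *+ b == U_(i) + U_(j) :> 'X_{1..M})%MM = false.
    by apply/eqP => e; move: lt; rewrite e => /mnm_lt_irr.
  by rewrite cE (ilead0 E) ne mulr0 subr0 eqxx.
- by move=> h x; apply: kernel_lead => s; apply: family0_kernel.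
Qed.

Lemma family0_homog t : homog2 v (idx_deg2 v t) (family0 t).
Proof.
move=> s m; have [i [j [k [k' [a [b [E ij kk' dE [lt cE]]]]]]]] := family0_coef t.
have -> : idx_deg2 v s = 0.
  by rewrite /idx_deg2 (_ : idx_seq s = [::]) ?big_nil //; apply/size0nil/size_idx.
rewrite cE addr0 /idx_deg2 E !big_cons big_nil addr0 /=.
case: eqP => [<- _|_]; first by rewrite mnm_deg2D !mnm_deg2U.
case: eqP => [<- _|_]; first by rewrite mnm_deg2D !degMn !mnm_deg2U -dE.
by rewrite mulr0 subr0.
Qed.

(** The leading monomial has degree 2, so only the other one can have smaller degree, and it does
    exactly if a + b < 2. Strictness will enter through this case. *)
Lemma family0_low (mm : set R) : is_ideal mm ->
  (forall i j k k' : 'I_M, forall a b, (i.+1 < j)%N -> k' = k.+1 :> nat ->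
     tnth v i + tnth v j = tnth v k *+ a + tnth v k' *+ b -> (a + b < 2)%N ->
     mm (ppow p (gam i j))) ->
  forall t x, (mdeg x.1 < 2)%N -> mm (tcoef (family0 t) x).
Proof.
move=> mmI H t x x2; have [mm0 _ mmM] := mmI.
have [i [j [k [k' [a [b [E ij kk' dE [lt cE]]]]]]]] := family0_coef t.
rewrite cE; case: eqP => [xE|_]; first by move: x2; rewrite -xE mdegD !mdeg1.
rewrite sub0r; case: eqP => [xE|_]; last by rewrite mulr0 oppr0.
rewrite mulr1 -mulN1r; apply: (mmM); apply: H ij kk' dE _.
by move: x2; rewrite -xE mdegD !mdegMn !mdeg1 !mul1n.
Qed.

Lemma phi0E (P : poly) : phi0 p f v P =
  \sum_(m <- msupp P) lmon (P@_m * ppow p (fun t => wt t m)) (deg m).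
Proof.
apply: eq_bigr => m _; rewrite /mmap1.
have -> : \prod_(i < M) lmon (ppow p (f^~ (tnth v i))) (tnth v i) ^+ m i =
    lmon (ppow p (fun t => wt t m)) (deg m).
  under eq_bigr do rewrite lmonX; rewrite lmon_prod; congr lmon.
  rewrite /ppow; under eq_bigr do rewrite -prodrXl; rewrite exchange_big.
  apply: eq_bigr => t _; rewrite /wt expr_sum; apply: eq_bigr => i _.
  by rewrite -exprM mulnC.
by rewrite /= -[RHS]lmonZ mulr_algl.
Qed.

(** Apart from the factor p^(f u) these are the coordinates of the comparison module. So [phi0 P]
    vanishes when they do, and conversely once the p_t can be cancelled. *)
Lemma lcoef_phi0 (P : poly) u :
  lcoef u (phi0 p f v P) = ppow p (f^~ u) * wsum (kappa p f v u) P.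
Proof.
rewrite phi0E lcoef_sum /wsum mulr_sumr; apply: eq_bigr => m _.
rewrite lcoef_lmon /kappa; case: eqP => [uE|_]; last by rewrite mulr0n !mulr0.
rewrite mulr1n mulrCA -ppowD; congr (_ * _); apply: eq_ppow => t.
by rewrite subnKC // -uE; have [] := chain_deg chain t m.
Qed.

Lemma phi0_graded u (P : poly) : (forall m, P@_m <> 0 -> deg m = u) ->
  forall w, w <> u -> lcoef w (phi0 p f v P) = 0.
Proof.
move=> Pu w wu; rewrite phi0E lcoef_sum big1_seq // => m /= mP.
rewrite lcoef_lmon; case: eqP => // E; case: wu; rewrite -E; apply: Pu.
by apply/eqP; rewrite -mcoeff_msupp.
Qed.

Lemma phi0_image0 (P : poly) :
  (exists h, phi F 0 h = [ffun=> P]) -> phi0 p f v P = 0.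
Proof.
move=> [h hP]; apply: laurentP => u; rewrite lcoef_phi0 lcoef0.
have [//|//|s _] := @idx_exists M 0 [::].
have := family0_kernel h s; rewrite -[combine _ h]/(phi F 0 h) hP ffunE => ->.
by rewrite mulr0.
Qed.

Lemma kernel_phi0 (P : poly) : (forall t, GRing.lreg (p t)) ->
  phi0 p f v P = 0 -> exists h, phi F 0 h = [ffun=> P].
Proof.
move=> pR P0.
have NP : in_kernel p f v P.
  move=> u; apply: (ppow_lreg (c := f^~ u) pR).
  by rewrite -lcoef_phi0 P0 lcoef0 mulr0.
have [ordG [lmP lm1 _]] := tower_spec family0_groebner 0.
have [|||q dq] := @divides_toP _ _ _ _ (@idx_lt M 1) (order_at F 0)
  ordG (@idx_lt_irr _ _) (@idx_lt_trans _ _) (@idx_lt_total _ _) family0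
  (@ilead M 0) lmP lm1 (fun h => forall s, in_kernel p f v (h s)) _ _ [ffun=> P].
- move=> h c t Nh s.
  have -> : (h - c *: family0 t) s = (h s : poly) + (-1) *: ((c * (family0 t s : poly)) : poly).
    by rewrite !ffunE scaleN1r.
  apply: in_kernelD => //; apply/in_kernelZ/(in_kernelM chain).
  have := family0_kernel (basis_vec R M t) s; by rewrite combine_basis.
- exact: kernel_lead.
- by move=> s; rewrite ffunE.
exists q; exact: divides_to_combine dq.
Qed.

Lemma phi0D P Q : phi0 p f v (P + Q) = phi0 p f v P + phi0 p f v Q.
Proof. exact: mmapD. Qed.

Lemma phi0ZX c m : phi0 p f v (c *: 'X_[m]) = lmon (c * ppow p (fun t => wt t m)) (deg m).
Proof.
apply: laurentP => u; rewrite lcoef_phi0 wsumZ wsumX lcoef_lmon /kappa.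
case: eqP => [uE|_]; last by rewrite mulr0n !mulr0.
rewrite mulr1n mulrCA -ppowD; congr (_ * _); apply: eq_ppow => t.
by rewrite subnKC // -uE; have [] := chain_deg chain t m.
Qed.

Lemma ideal_gen1 (x y : R) : ideal_gen [set x] y <-> exists c, y = c * x.
Proof.
split=> [[k [a [b [bx ->]]]]|[c ->]].
  exists (\sum_(i < k) a i); rewrite mulr_suml; apply: eq_bigr => i _.
  by rewrite (bx i).
by exists 1%N, (fun=> c), (fun=> x); rewrite big_ord1.
Qed.

(** For surjectivity, each u in the support is the degree of a standard monomial, whose weight is f
    u; a scalar multiple of it maps to the required multiple of p^(f u) x^u. *)
Lemma phi0_range (K : realType) (Fan : set (set (plane K))) :
  (forall u, fan_support Fan (emb K u) <-> D u) ->
  range (phi0 p f v) = fan_algebra p f Fan.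
Proof.
move=> DE; apply/seteqP; split=> [_ [P _ <-] u|g gF].
  split=> [|nDu]; first by move=> _; apply/ideal_gen1; exists (wsum (kappa p f v u) P);
    rewrite lcoef_phi0 mulrC.
  rewrite lcoef_phi0 [X in _ * X]big1_seq ?mulr0 // => m _; rewrite /kappa.
  case: eqP => [uE|_]; last by rewrite mulr0.
  by case: nDu; apply/DE; rewrite -uE; apply: chain_degD chain _.
have H : forall u, exists P, phi0 p f v P = lmon (lcoef u g) u.
  move=> u; have [Du nDu] := gF u.
  have [/DE Du'|/nDu ->] := pselect (fan_support Fan (emb K u)); last first.
    by exists 0; rewrite lmon0 /phi0 mmap0.
  have [c ->] := (ideal_gen1 _ _).1 (Du ((DE u).2 Du')).
  have [m sm dm] := chain_surj chain Du'.
  exists (c *: 'X_[m]); rewrite phi0ZX dm; congr (lmon (_ * _) _).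
  by apply: eq_ppow => t; rewrite -dm (chain_lin chain).
have [P PE] : exists P, phi0 p f v P = g.
  rewrite (laurentE g); elim/big_ind: _ => [|x y [P <-] [Q <-]|u _].
  - by exists 0; rewrite /phi0 mmap0.
  - by exists (P + Q); rewrite phi0D.
  - exact: H.
by exists P.
Qed.

Lemma resolution_families : are_resolution_families p f v F.
Proof.
have [mon syz] := tower_families_resolution family0_groebner.
split=> // t i j E.
have [i' [j' [k [k' [a [b [E' kk' dE _ fE]]]]]]] := family0P t.
move: E'; rewrite E => -[Ei Ej]; subst i' j'.
by exists (binom_poly i j k k' a b) => //; exists k, k', a, b.
Qed.

Lemma mY_const (mm : set R) (P : poly) : is_ideal mm -> mm P@_0%MM -> @mY R M mm P.
Proof.
move=> mmI P0.
pose gens : set poly := [set P | (exists2 c, mm c & P = c%:MP) \/ exists i, P = 'X_i].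
have genD x y : ideal_gen gens x -> ideal_gen gens y -> ideal_gen gens (x + y).
  move=> [k [a [b [bg ->]]]] [l [c [d [dg ->]]]].
  pose ab (w : poly * poly) := w.1 * w.2.
  exists (k + l)%N, (fun z => match split z with inl i => a i | inr i => c i end),
    (fun z => match split z with inl i => b i | inr i => d i end); split.
    by move=> z; case: (split z).
  rewrite big_split_ord /=; congr (_ + _); apply: eq_bigr => z _.
    by rewrite (unsplitK (inl z)).
  by rewrite (unsplitK (inr z)).
have gen0 : ideal_gen gens 0.
  exists 0%N, (fun=> 0), (fun=> 0); split; first by case.
  by rewrite big_ord0.
rewrite /mY -/gens (mpolyE P) big_seq; elim/big_ind: _ => [|x y|m mP] //; first exact: genD.
have [->|m0] := eqVneq m 0%MM.
  exists 1%N, (fun=> 1), (fun=> (P@_0%MM)%:MP); split; first by move=> _; left; exists P@_0%MM.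
  by rewrite big_ord1 mul1r mpolyX0 alg_mpolyC.
have [i mi] : exists i, m i != 0%N.
  apply/existsP; apply: contra_neqT m0 => /existsPn H; apply/mnmP => i.
  by rewrite mnm0E; apply/eqP; have := H i; rewrite negbK.
exists 1%N, (fun=> P@_m *: 'X_[m - U_(i)]), (fun=> 'X_i); split.
  by move=> _; right; exists i.
by rewrite big_ord1 -scalerAl -mpolyXD submK // lep1mP.
Qed.

Lemma resolution_minimal (mm : set R) : is_ideal mm ->
  (forall i j k k' : 'I_M, forall a b, (i.+1 < j)%N -> k' = k.+1 :> nat ->
     tnth v i + tnth v j = tnth v k *+ a + tnth v k' *+ b -> (a + b < 2)%N ->
     mm (ppow p (gam i j))) ->
  (forall t, GRing.lreg (p t)) -> is_minimal p f v F mm.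
Proof.
move=> mmI H pR; have low := family0_low mmI H; have [mm0 mmD mmM] := mmI.
split=> [P /(kernel_phi0 pR)[h hP]|j h h0 t]; apply: mY_const => //; last first.
  exact: (tower_minimal family0_groebner mmI low).
have [//|//|s _] := @idx_exists M 0 [::].
have -> : P = phi F 0 h s by rewrite hP ffunE.
rewrite /phi free_sumE raddf_sum; apply: (ideal_sum mmI) => t _.
rewrite /= free_scaleE [X in X * _](mpolyE (h t : poly)) mulr_suml raddf_sum.
apply: (ideal_sum mmI) => m _ /=.
rewrite -scalerAl mcoeffZ; apply: (mmM).
(* A nonconstant monomial contributes nothing in degree 0, and a constant one meets the constant
   coefficient of S_(i,j), which [low] puts into [mm]. *)
have [->|m0] := eqVneq m 0%MM.
  by rewrite mpolyX0 mul1r; apply: (low t (0%MM, s)); rewrite mdeg0.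
rewrite mulrC memN_msupp_eq0 ?(perm_mem (msuppMX _ _)) //.
apply: contra m0 => /mapP[k _ /esym/eqP]; by rewrite mnmD_eq0 => /andP[].
Qed.

End LevelZero.

Local Notation d := (@det2 int).

(** * Unimodular chains *)

Section Det.
Implicit Types u w x y : lattice.

Lemma latticeP u w : u.1 = w.1 -> u.2 = w.2 -> u = w.
Proof. by case: u w => [a b] [c e] /= -> ->. Qed.

Lemma latMnE u k : (u *+ k).1 = k%:Z * u.1 /\ (u *+ k).2 = k%:Z * u.2.
Proof.
elim: k => [|k [IH1 IH2]]; first by rewrite !mul0r.
by rewrite mulrS intS !mulrDl !mul1r -IH1 -IH2.
Qed.

Lemma latMzE u (k : int) : (u *~ k).1 = k * u.1 /\ (u *~ k).2 = k * u.2.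
Proof.
case: k => k; first exact: latMnE.
have [E1 E2] := latMnE u k.+1; rewrite NegzE !mulNr -E1 -E2.
by have -> : u *~ (- Posz k.+1) = - (u *+ k.+1) by rewrite mulrNz.
Qed.

Lemma latDE u w : (u + w).1 = u.1 + w.1 /\ (u + w).2 = u.2 + w.2.
Proof. by []. Qed.

Lemma latNE u : (- u).1 = - u.1 /\ (- u).2 = - u.2.
Proof. by []. Qed.

Lemma det2Dl u w x : d (u + w) x = d u x + d w x.
Proof. by have [E1 E2] := latDE u w; rewrite /det2 E1 E2; ring. Qed.

Lemma det2Dr x u w : d x (u + w) = d x u + d x w.
Proof. by have [E1 E2] := latDE u w; rewrite /det2 E1 E2; ring. Qed.

Lemma det2Nl u x : d (- u) x = - d u x.
Proof. by have [E1 E2] := latNE u; rewrite /det2 E1 E2; ring. Qed.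

Lemma det2Nr u x : d u (- x) = - d u x.
Proof. by have [E1 E2] := latNE x; rewrite /det2 E1 E2; ring. Qed.

Lemma det2C u x : d u x = - d x u.
Proof. rewrite /det2; ring. Qed.

Lemma det2uu u : d u u = 0.
Proof. rewrite /det2; ring. Qed.

Lemma det20l u : d 0 u = 0.
Proof. by rewrite /det2 !mul0r subrr. Qed.

Lemma det20r u : d u 0 = 0.
Proof. by rewrite /det2 !mulr0 subrr. Qed.

Lemma det2Ml u k x : d (u *+ k) x = k%:Z * d u x.
Proof. by have [E1 E2] := latMnE u k; rewrite /det2 E1 E2; ring. Qed.

Lemma det2Mr u k x : d x (u *+ k) = k%:Z * d x u.
Proof. by rewrite det2C det2Ml [d u x]det2C; ring. Qed.

Lemma det2Zl u (k : int) x : d (u *~ k) x = k * d u x.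
Proof. by have [E1 E2] := latMzE u k; rewrite /det2 E1 E2; ring. Qed.

Lemma det2Zr u (k : int) x : d x (u *~ k) = k * d x u.
Proof. by rewrite det2C det2Zl [d u x]det2C; ring. Qed.

Lemma det2_plucker e u w x : d e w * d u x = d e u * d w x + d e x * d u w.
Proof. rewrite /det2; ring. Qed.

Lemma unimodular_expand a b u : d a b = -1 ->
  u = a *~ (- d u b) + b *~ (- d a u).
Proof.
move=> ab; have [A1 A2] := latMzE a (- d u b); have [B1 B2] := latMzE b (- d a u).
have [D1 D2] := latDE (a *~ (- d u b)) (b *~ (- d a u)).
apply: latticeP; rewrite ?D1 ?D2 ?A1 ?B1 ?A2 ?B2; move: ab; rewrite /det2 => ab.
  have -> : - (u.1 * b.2 - u.2 * b.1) * a.1 + - (a.1 * u.2 - a.2 * u.1) * b.1 =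
    - (a.1 * b.2 - a.2 * b.1) * u.1 by ring.
  by rewrite ab opprK mul1r.
have -> : - (u.1 * b.2 - u.2 * b.1) * a.2 + - (a.1 * u.2 - a.2 * u.1) * b.2 =
  - (a.1 * b.2 - a.2 * b.1) * u.2 by ring.
by rewrite ab opprK mul1r.
Qed.

Lemma cone_expand a b u : d a b = -1 -> d a u <= 0 -> d u b <= 0 ->
  exists k l : nat, u = a *+ k + b *+ l.
Proof.
move=> ab au ub; exists `|d u b|%N, `|d a u|%N.
rewrite [LHS](unimodular_expand u ab) !pmulrn; congr (_ *~ _ + _ *~ _); lia.
Qed.

Definition primitive u := exists x y : int, u.1 * x + u.2 * y = 1.

(** Applying the Bezout relation of u to w produces the factor k = w_1 x + w_2 y. *)
Lemma primitive_det u w : primitive u -> d u w = 0 -> exists k : int, w = u *~ k.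
Proof.
move=> [x [y xy]]; rewrite /det2 => /eqP; rewrite subr_eq0 => /eqP E.
exists (w.1 * x + w.2 * y); have [E1 E2] := latMzE u (w.1 * x + w.2 * y).
apply: latticeP; rewrite ?E1 ?E2.
  have -> : (w.1 * x + w.2 * y) * u.1 = w.1 * (u.1 * x) + (u.1 * w.2) * y by ring.
  rewrite E; have -> : w.1 * (u.1 * x) + u.2 * w.1 * y = w.1 * (u.1 * x + u.2 * y) by ring.
  by rewrite xy mulr1.
have -> : (w.1 * x + w.2 * y) * u.2 = (u.2 * w.1) * x + w.2 * (u.2 * y) by ring.
rewrite -E; have -> : u.1 * w.2 * x + w.2 * (u.2 * y) = w.2 * (u.1 * x + u.2 * y) by ring.
by rewrite xy mulr1.
Qed.

Lemma primitive_neq0 u : primitive u -> u <> 0.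
Proof. by move=> [x [y xy]] u0; move: xy; rewrite u0 /= !mul0r. Qed.

Lemma unimodular_primitive u w : d u w = -1 -> primitive u /\ primitive w.
Proof.
rewrite /det2 => uw; split; first by exists (- w.2), w.1; rewrite -[1]opprK -uw; ring.
by exists u.2, (- u.1); rewrite -[1]opprK -uw; ring.
Qed.

Lemma primitive_exists u : u <> 0 -> exists w k, [/\ primitive w, (0 < k)%N & u = w *+ k].
Proof.
move=> u0; pose g := gcdz u.1 u.2.
have g0 : g != 0.
  apply/eqP => /eqP; rewrite gcdz_eq0 => /andP[/eqP u1 /eqP u2].
  by apply: u0; apply: latticeP.
have [x [y xy]] := Bezoutz u.1 u.2.
have u1 : u.1 = (u.1 %/ g)%Z * g by rewrite divzK // dvdz_gcdl.
have u2 : u.2 = (u.2 %/ g)%Z * g by rewrite divzK // dvdz_gcdr.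
exists ((u.1 %/ g)%Z, (u.2 %/ g)%Z), `|g|%N; split.
- exists x, y; apply: (mulIf g0); rewrite mul1r /= -[RHS]xy.
  rewrite [X in _ = x * X + _]u1 [X in _ = _ + y * X]u2; ring.
- by rewrite absz_gt0.
have gE : (`|g|%N)%:Z = g by rewrite abszE ger0_norm // /g.
have [E1 E2] := latMnE ((u.1 %/ g)%Z, (u.2 %/ g)%Z) `|g|%N.
by apply: latticeP; [rewrite E1 | rewrite E2]; rewrite gE mulrC.
Qed.

Section Chains.

(* A sequence w 0, ..., w r turning clockwise through an angle less than pi,
   with unimodular consecutive pairs. *)
Definition uchain (w : nat -> lattice) (r : nat) : Prop :=
  (forall i j, (i < j)%N -> (j <= r)%N -> d (w i) (w j) < 0) /\
  forall i, (i < r)%N -> d (w i) (w i.+1) = -1.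

(** Take the largest i < r with [d (w i) u <= 0]. Then u has not passed [w i.+1], and unimodularity
    makes its coordinates natural numbers. *)
Lemma uchain_locate (w : nat -> lattice) r u : uchain w r -> (0 < r)%N -> d (w 0%N) u <= 0 -> d u (w r) <= 0 ->
  exists i k l, (i < r)%N /\ u = w i *+ k + w i.+1 *+ l.
Proof.
move=> [mono unim] r0 u0 ur.
suff [i [ir iu ui]] : exists i, [/\ (i < r)%N, d (w i) u <= 0 & d u (w i.+1) <= 0].
  by have [k [l ->]] := cone_expand (unim _ ir) iu ui; exists i, k, l.
elim: r r0 ur {mono unim} => // r IH _ ur.
have [wr|wr] := lerP (d (w r) u) 0; first by exists r.
case: r IH ur wr => [|r] IH ur wr; first by move: u0 wr; lra.
have [|i [ir iu ui]] := IH isT; first by rewrite det2C; lra.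
by exists i; split=> //; apply: ltnW.
Qed.

Lemma uchain_le (w : nat -> lattice) r i j : uchain w r -> (i <= j)%N -> (j <= r)%N -> d (w i) (w j) <= 0.
Proof.
move=> [mono _]; rewrite leq_eqVlt => /orP[/eqP -> _|ij jr]; first by rewrite det2uu.
exact/ltW/mono.
Qed.

Lemma uchain_drop (w : nat -> lattice) r i : uchain w r -> (0 < i < r)%N ->
  d (w i.-1) (w i.+1) = -1 -> uchain (fun j => if (j < i)%N then w j else w j.+1) r.-1.
Proof.
move=> [mono unim] /andP[i0 ir] di; split=> [a b ab br|a ar].
  by case: ltnP => ai; case: ltnP => bi; apply: mono; lia.
case: ltnP => ai; case: ltnP => bi; try by apply: unim; lia.
  have -> : a.+2 = i.+1 by lia.
  by have -> : a = i.-1 by lia.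
by exfalso; lia.
Qed.

Lemma uchain_cons g (w : nat -> lattice) r : uchain w r -> d g (w 0%N) = -1 -> d g (w r) < 0 ->
  uchain (fun j => if j is i.+1 then w i else g) r.+1.
Proof.
move=> [mono unim] g0 gr; split=> [[|a] [|b] // ab br|[|a] ar] //; last exact: unim.
- case: b ab br => [|b] _ br; first by rewrite g0.
  have [->//|br'] := eqVneq b.+1 r.
  have m1 : d (w 0%N) (w b.+1) < 0 by apply: mono; lia.
  have m2 : d (w b.+1) (w r) < 0 by apply: mono; lia.
  have m3 : d (w 0%N) (w r) < 0 by apply: mono; lia.
  (* Both products on the right of the Pluecker relation are positive, so [d g (w b.+1)] cannot be
     nonnegative: the prolonged chain still turns by less than pi. *)
  have := det2_plucker g (w 0%N) (w b.+1) (w r); rewrite g0 => E.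
  rewrite ltNge; apply/negP => P0.
  have : d g (w b.+1) * d (w 0%N) (w r) <= 0 by rewrite mulr_ge0_le0 // ltW.
  have : 0 < d g (w r) * d (w 0%N) (w b.+1) by rewrite nmulr_rgt0.
  by rewrite E; lia.
- exact: mono.
Qed.


End Chains.
End Det.

Section HirzebruchJung.
Implicit Types u x y g h : lattice.

Definition irred (S : set lattice) u :=
  [/\ S u, u <> 0 & forall x y, S x -> S y -> u = x + y -> x = 0 \/ y = 0].

Definition sector g h : set lattice := [set u | d g u <= 0 /\ d u h <= 0].

(** In toric language [- d a c] is minus the self-intersection number of the divisor of the ray
    through b. *)
Lemma wall_relation (a b c : lattice) : d a b = -1 -> d b c = -1 -> a + c = b *~ (- d a c).
Proof.
move=> ab bc; rewrite {1}(unimodular_expand c ab) (det2C c b) bc !opprK.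
by rewrite mulrN1z addrA subrr add0r.
Qed.

(** A Euclidean descent on |d g h|, as in the continued fraction of the cone: a vector forming a
    unimodular pair with g is shifted along g until its determinant with h is minus a remainder
    modulo d g h. *)
Lemma uchain_exists g h : primitive g -> primitive h -> d g h < 0 ->
  exists w r, [/\ uchain w r, (0 < r)%N, w 0%N = g & w r = h].
Proof.
move=> pg ph; have [N] := ubnP `|d g h|%N; elim: N g pg => [|N IH] g pg; first by rewrite ltn0.
rewrite ltnS => leN gh.
have [gh1|gh1] := eqVneq (d g h) (-1).
  exists (fun i => if i is 0%N then g else h), 1%N; split=> //; split.
    by move=> [|[|i]] [|[|j]] //= _ _; rewrite gh1.
  by case.
have [w [gw wh0 whN]] : exists w, [/\ d g w = -1, d w h < 0 & d g h < d w h].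
  have [x [y xy]] := pg.
  pose w0 : lattice := (y, - x); pose q := (- d w0 h %/ d g h)%Z.
  have gw0 : d g w0 = -1 by rewrite /det2 /= -xy; ring.
  have ghn0 : d g h != 0 by lia.
  have gw : d g (w0 + g *~ q) = -1 by rewrite det2Dr det2Zr det2uu mulr0 addr0.
  have whE : d (w0 + g *~ q) h = - (- d w0 h %% d g h)%Z.
    by rewrite det2Dl det2Zl; have := divz_eq (- d w0 h) (d g h); rewrite -/q; lia.
  have := modz_ge0 (- d w0 h) ghn0; have := ltz_mod (- d w0 h) ghn0.
  (* Remainder 0 would make the vector a multiple of the primitive h, and then -1 would be a
     multiple of d g h, which is at most -2 here. *)
  have wh0 : d (w0 + g *~ q) h != 0.
    apply/eqP => E; have [|k wE] := @primitive_det h (w0 + g *~ q) ph.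
      by rewrite det2C E.
    by move: gw; rewrite wE det2Zr; have [k0|k0] := lerP k 0; nia.
  exists (w0 + g *~ q); split=> //; lia.
have [_ pw] := unimodular_primitive gw.
have [|c [r [uc r0 c0 cr]]] := IH w pw _ wh0; first by lia.
exists (fun j => if j is i.+1 then c i else g), r.+1; split=> //.
by apply: uchain_cons; rewrite ?c0 ?cr.
Qed.

(* In a unimodular chain of minimal length w_(i-1) + w_(i+1) = c w_i with c >= 2
   (for c = 1 the vector w_i could be dropped), so the linear form which is 1 on
   w_i and w_(i+1) is convex along the chain, hence >= 1 on it; a reducible w_i
   would have value >= 2. *)
Lemma hirzebruch_jung g h : primitive g -> primitive h -> d g h < 0 ->
  exists w r, [/\ uchain w r, (0 < r)%N, w 0%N = g, w r = h
    & forall u, irred (sector g h) u <-> exists2 i, (i <= r)%N & u = w i].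
Proof.
move=> pg ph gh.
pose P r := `[< exists w, [/\ uchain w r, (0 < r)%N, w 0%N = g & w r = h] >].
have exP : exists r, P r.
  by have [w [r H]] := uchain_exists pg ph gh; exists r; apply/asboolP; exists w.
case: (ex_minnP exP) => r /asboolP[w [uc r0 w0 wr]] minr.
exists w, r; split=> //.
have [mono unim] := uc.
have turn i : (0 < i < r)%N -> d (w i.-1) (w i.+1) <= -2.
  move=> ir; have lt : d (w i.-1) (w i.+1) < 0 by apply: mono; lia.
  have [E|] := eqVneq (d (w i.-1) (w i.+1)) (-1); last by lia.
  have : (r <= r.-1)%N; last by lia.
  apply: minr; apply/asboolP; exists (fun j => if (j < i)%N then w j else w j.+1).
  split; [exact: uchain_drop | lia | by case: ltnP; rewrite ?w0 //; lia |].
  by case: ltnP => [|_]; [lia | rewrite prednK].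
pose lam i x := - (d x (w i.+1) + d (w i) x).
have lamD i x y : lam i (x + y) = lam i x + lam i y.
  by rewrite /lam det2Dl det2Dr; ring.
have lamM i x k : lam i (x *+ k) = k%:Z * lam i x.
  by rewrite /lam det2Ml det2Mr; ring.
have lamZ i x k : lam i (x *~ k) = k * lam i x.
  by rewrite /lam det2Zl det2Zr; ring.
have lam_i i : (i < r)%N -> lam i (w i) = 1 /\ lam i (w i.+1) = 1.
  by move=> ir; rewrite /lam unim // !det2uu.
have rec i j : (0 < j < r)%N ->
    exists c, [/\ 2 <= c & lam i (w j.+1) + lam i (w j.-1) = c * lam i (w j)].
  move=> jr; exists (- d (w j.-1) (w j.+1)); split; first by have := turn j jr; lia.
  rewrite -lamZ -wall_relation ?lamD 1?addrC //; last by apply: unim; lia.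
  by rewrite -[X in d _ (w X)](prednK (n := j)) ?unim //; lia.
have right i k : (i + k < r)%N ->
    1 <= lam i (w (i + k)%N) /\ lam i (w (i + k)%N) <= lam i (w (i + k).+1).
  elim: k => [|k IH] ir.
    by rewrite addn0 in ir *; have [-> ->] := lam_i i ir.
  have [|l1 l2] := IH; first by lia.
  have [|c [c2]] := rec i (i + k).+1; first by lia.
  by rewrite !addnS /= => E; split; nia.
have left i k : (i < r)%N -> (k <= i)%N ->
    1 <= lam i (w (i - k).+1) /\ lam i (w (i - k).+1) <= lam i (w (i - k)%N).
  move=> ir; elim: k => [|k IH] ki.
    by rewrite subn0; have [-> ->] := lam_i i ir.
  have [|l1 l2] := IH; first by lia.
  have [|c [c2]] := rec i (i - k)%N; first by lia.
  have -> : (i - k.+1).+1 = (i - k)%N by lia.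
  have -> : (i - k)%N.-1 = (i - k.+1)%N by lia.
  by move=> E; split; nia.
have lam_ge1 i j : (i < r)%N -> (j <= r)%N -> 1 <= lam i (w j).
  move=> ir jr; have [ij|ji] := leqP j i.
    have [l1 l2] := left i (i - j)%N ir (leq_subr _ _).
    have E : (i - (i - j) = j)%N by lia.
    by rewrite E in l1 l2; apply: le_trans l1 l2.
  have [|l1 l2] := right i (j - i.+1)%N; first by lia.
  have E : ((i + (j - i.+1)).+1 = j)%N by lia.
  by rewrite E in l2; apply: le_trans l1 l2.
have secw j : (j <= r)%N -> sector g h (w j).
  by move=> jr; split; [rewrite -w0 | rewrite -wr]; apply: uchain_le uc _ _.
have wn0 j : (j <= r)%N -> w j <> 0.
  move=> jr E; have := lam_ge1 0%N j r0 jr.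
  by rewrite /lam E det20l det20r; lia.
have lam_sec i u : (i < r)%N -> sector g h u -> u <> 0 -> 1 <= lam i u.
  move=> ir [gu uh] u0; rewrite -w0 in gu; rewrite -wr in uh.
  have [j [k [l [jr uE]]]] := uchain_locate uc r0 gu uh.
  rewrite uE lamD !lamM.
  have kl : (0 < k + l)%N.
    rewrite lt0n addn_eq0; apply/negP => /andP[/eqP k0 /eqP l0].
    by apply: u0; rewrite uE k0 l0 !mulr0n addr0.
  apply: (@le_trans _ _ (k%:Z + l%:Z)); first by rewrite -PoszD.
  by apply: lerD; rewrite -[X in X <= _]mulr1 ler_wpM2l ?lam_ge1 // ltnW.
move=> u; split=> [[Su u0 irr]|[j jr ->]].
  have [gu uh] := Su; rewrite -w0 in gu; rewrite -wr in uh.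
  have [j [k [l [jr uE]]]] := uchain_locate uc r0 gu uh.
  have wj := secw j (ltnW jr); have wj1 := secw j.+1 jr.
  have secM x k' : sector g h x -> sector g h (x *+ k').
    by move=> [gx xh]; split; rewrite ?det2Ml ?det2Mr; nia.
  have secD x y : sector g h x -> sector g h y -> sector g h (x + y).
    by move=> [gx xh] [gy yh]; split; rewrite ?det2Dl ?det2Dr; lia.
  case: k uE => [|k] uE.
    case: l uE => [|l] uE; first by case: u0; rewrite uE !mulr0n addr0.
    rewrite mulr0n add0r mulrS in uE.
    have [/(wn0 _ jr) //|E] := irr _ _ wj1 (secM _ l wj1) uE.
    by exists j.+1; rewrite // uE E addr0.
  rewrite mulrS -addrA in uE.
  have [/(wn0 _ (ltnW jr)) //|E] := irr _ _ wj (secD _ _ (secM _ k wj) (secM _ l wj1)) uE.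
  by exists j; rewrite ?(ltnW jr) // uE E addr0.
split; [exact: secw | exact: wn0 | move=> x y Sx Sy wE].
apply: contrapT => /not_orP[x0 y0].
(* No form starts at the last vector; for [j = r] the form of the preceding pair takes the value 1
   there. *)
have [i [ir l1]] : exists i, (i < r)%N /\ lam i (w j) = 1.
  have [jr'|jr'] := ltnP j r; first by exists j; split=> //; case: (lam_i j jr').
  have jE : j = j.-1.+1 by lia.
  have ir : (j.-1 < r)%N by lia.
  by exists j.-1; split=> //; rewrite {2}jE; case: (lam_i _ ir).
have := lam_sec i x ir Sx x0; have := lam_sec i y ir Sy y0.
have : lam i (w j) = lam i x + lam i y by rewrite wE lamD.
lia.
Qed.

End HirzebruchJung.

(** * Rational cones in the plane *)

Section PlaneCones.
Variable K : realType.
Notation plane := (plane K).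
Notation emb := (emb K).
Notation dK := (@det2 K).
Implicit Types (x y z : plane) (u w g h : lattice) (C : set plane).

Lemma planeP x y : x.1 = y.1 -> x.2 = y.2 -> x = y.
Proof. by case: x y => [a b] [c e] /= -> ->. Qed.

Lemma planeD x y : (x + y).1 = x.1 + y.1 /\ (x + y).2 = x.2 + y.2.
Proof. by []. Qed.

Lemma planeZ (t : K) x : (t *: x).1 = t * x.1 /\ (t *: x).2 = t * x.2.
Proof. by []. Qed.

Lemma dKDl x y z : dK (x + y) z = dK x z + dK y z.
Proof. by have [E1 E2] := planeD x y; rewrite /det2 E1 E2; ring. Qed.

Lemma dKC x y : dK x y = - dK y x.
Proof. rewrite /det2; ring. Qed.

Lemma dKDr x y z : dK z (x + y) = dK z x + dK z y.
Proof. by rewrite dKC dKDl [dK x z]dKC [dK y z]dKC; ring. Qed.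

Lemma dKZl (t : K) x z : dK (t *: x) z = t * dK x z.
Proof. by have [E1 E2] := planeZ t x; rewrite /det2 E1 E2; ring. Qed.

Lemma dKZr (t : K) x z : dK z (t *: x) = t * dK z x.
Proof. by rewrite dKC dKZl [dK x z]dKC; ring. Qed.

Lemma dKxx x : dK x x = 0.
Proof. rewrite /det2; ring. Qed.

Lemma dK0r x : dK x 0 = 0.
Proof. by rewrite /det2 /= !mulr0 subrr. Qed.

Lemma dK0l x : dK 0 x = 0.
Proof. by rewrite dKC dK0r oppr0. Qed.

Lemma embD u w : emb (u + w) = emb u + emb w.
Proof. by apply: planeP; rewrite /emb /= intrD. Qed.

Lemma embN u : emb (- u) = - emb u.
Proof. by apply: planeP; rewrite /emb /= mulrNz. Qed.

Lemma emb0 : emb 0 = 0.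
Proof. by []. Qed.

Lemma embMn u k : emb (u *+ k) = k%:R *: emb u.
Proof.
elim: k => [|k IH]; first by rewrite !mulr0n scale0r.
by rewrite mulrS embD IH mulrS scalerDl scale1r.
Qed.

Lemma dK_emb u w : dK (emb u) (emb w) = (d u w)%:~R.
Proof. by rewrite /det2 /emb /= rmorphB !rmorphM. Qed.

Lemma emb_inj : injective emb.
Proof.
move=> u w E; have E1 : (u.1)%:~R = (w.1)%:~R :> K by case: E.
have E2 : (u.2)%:~R = (w.2)%:~R :> K by case: E.
by apply: latticeP; [move/intr_inj: E1 | move/intr_inj: E2].
Qed.

Lemma emb_eq0 u : emb u = 0 -> u = 0.
Proof. by rewrite -emb0 => /emb_inj. Qed.

Lemma dK_le0 u w : (dK (emb u) (emb w) <= 0) = (d u w <= 0).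
Proof. by rewrite dK_emb lerz0. Qed.

Lemma cramer (a b x : plane) : dK a b != 0 ->
  x = (dK x b / dK a b) *: a + (dK a x / dK a b) *: b.
Proof.
move=> D0; have [A1 A2] := planeZ (dK x b / dK a b) a.
have [B1 B2] := planeZ (dK a x / dK a b) b.
have [C1 C2] := planeD ((dK x b / dK a b) *: a) ((dK a x / dK a b) *: b).
apply: planeP; rewrite ?C1 ?C2 ?A1 ?B1 ?A2 ?B2; move: D0; rewrite /det2 => D0;
  field; exact: D0.
Qed.

Lemma addr_le0 (s t : K) : s <= 0 -> t <= 0 -> s + t <= 0.
Proof. by move=> s0 t0; rewrite -(addr0 0) lerD. Qed.

(** A recursive form of the generated cone, for induction on the generators. *)
Fixpoint hull (s : seq lattice) : set plane :=
  if s is g :: s' then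
    [set x | exists (t : K) y, [/\ 0 <= t, hull s' y & x = t *: emb g + y]]
  else [set x | x = 0].

Lemma hullE s : hull s = [set x | exists c : 'I_(size s) -> K,
  (forall i, 0 <= c i) /\ x = \sum_(i < size s) c i *: emb s`_i].
Proof.
elim: s => [|g s IH] /=; apply/seteqP; split=> x /=.
- by move=> ->; exists (fun=> 0); rewrite big_ord0; split=> // -[].
- by move=> [c [_]]; rewrite big_ord0.
- move=> [t [y [t0]]]; rewrite IH => -[c [c0 yE]] ->.
  exists (fun i => if unlift ord0 i is Some j then c j else t); split.
    by move=> i; case: (unlift _ _).
  rewrite big_ord_recl unlift_none /= yE; congr (_ + _); apply: eq_bigr => i _.
  by rewrite liftK.
- move=> [c [c0 ->]]; exists (c ord0), (\sum_(i < size s) c (lift ord0 i) *: emb s`_i).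
  split=> //; last by rewrite big_ord_recl.
  by rewrite IH; exists (fun i => c (lift ord0 i)).
Qed.

Lemma rational_coneP C : is_rational_cone C -> exists s, C = hull s.
Proof. by move=> [s ->]; exists s; rewrite hullE. Qed.

Lemma hull_consP g s x : hull (g :: s) x <->
  exists (t : K) y, [/\ 0 <= t, hull s y & x = t *: emb g + y].
Proof. by []. Qed.

Lemma hull0 s : hull s 0.
Proof. by elim: s => //= g s IH; exists 0, 0; rewrite scale0r addr0. Qed.

Lemma hullD s x y : hull s x -> hull s y -> hull s (x + y).
Proof.
elim: s x y => [|g s IH] x y /=; first by move=> -> ->; rewrite addr0.
move=> [t [x' [t0 hx ->]]] [t' [y' [t'0 hy ->]]].
exists (t + t'), (x' + y'); split; [exact: addr_ge0 | exact: IH |].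
by rewrite scalerDl addrACA.
Qed.

Lemma hullZ s (t : K) x : 0 <= t -> hull s x -> hull s (t *: x).
Proof.
move=> t0; elim: s x => [|g s IH] x /=; first by move=> ->; rewrite scaler0.
move=> [t' [x' [t'0 hx ->]]]; exists (t * t'), (t *: x').
by split; [exact: mulr_ge0 | exact: IH | rewrite scalerDr scalerA].
Qed.

Lemma hull_mem s g : g \in s -> hull s (emb g).
Proof.
elim: s => //= h s IH; rewrite inE => /orP[/eqP ->|/IH hg].
  by exists 1, 0; split; [exact: ler01 | exact: hull0 | rewrite scale1r addr0].
by exists 0, (emb g); rewrite scale0r add0r.
Qed.

Lemma hull_cons g s x : hull s x -> hull (g :: s) x.
Proof. by move=> hx; exists 0, x; rewrite scale0r add0r. Qed.

Definition ray g : set plane := [set x | exists2 t, 0 <= t & x = t *: emb g].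

Definition wedge g h : set plane :=
  [set x | dK (emb g) x <= 0 /\ dK x (emb h) <= 0].

Lemma wedge_expand g h x : d g h < 0 -> wedge g h x ->
  exists s t, [/\ 0 <= s, 0 <= t & x = s *: emb g + t *: emb h].
Proof.
move=> gh [gx xh]; have gh' : dK (emb g) (emb h) < 0 by rewrite dK_emb ltrz0.
exists (dK x (emb h) / dK (emb g) (emb h)), (dK (emb g) x / dK (emb g) (emb h)).
split; last by apply: cramer; rewrite lt_eqF.
- by rewrite mulr_le0 // invr_le0 ltW.
- by rewrite mulr_le0 // invr_le0 ltW.
Qed.

Lemma wedge_sum g h s t : d g h < 0 -> 0 <= s -> 0 <= t ->
  wedge g h (s *: emb g + t *: emb h).
Proof.
move=> gh s0 t0; have gh' : dK (emb g) (emb h) <= 0 by rewrite dK_emb lerz0 ltW.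
by split; rewrite ?dKDr ?dKDl ?dKZr ?dKZl dKxx mulr0 ?add0r ?addr0 mulr_ge0_le0.
Qed.

Lemma collinear (x y : plane) : y <> 0 -> dK y x = 0 -> exists t, x = t *: y.
Proof.
move=> y0 /eqP; rewrite subr_eq0 => /eqP E.
have [y1|y1] := eqVneq y.1 0; last first.
  exists (x.1 / y.1); have [E1 E2] := planeZ (x.1 / y.1) y.
  apply: planeP; rewrite ?E1 ?E2; first by rewrite divfK.
  by apply: (mulfI y1); rewrite E; field; exact: y1.
have [y2|y2] := eqVneq y.2 0; first by case: y0; apply: planeP.
exists (x.2 / y.2); have [E1 E2] := planeZ (x.2 / y.2) y.
apply: planeP; rewrite ?E1 ?E2; last by rewrite divfK.
by apply: (mulfI y2); rewrite -E; field; exact: y2.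
Qed.

Definition cone_shape C : Prop :=
  [\/ C = [set 0], exists2 g, g <> 0 & C = ray g
    | exists g h, d g h < 0 /\ C = wedge g h].

(** One more generator turns {0}, a ray or a wedge again into one of these, unless it points so far
    back that the cone contains a line, which strong convexity forbids. *)
Lemma hull_shape s : strongly_convex (hull s) -> cone_shape (hull s).
Proof.
elim: s => [|a s IH] sc; first by apply: Or31; apply/seteqP; split.
have has := @hull_cons a s.
have hem : hull (a :: s) (emb a) by apply: hull_mem; exact: mem_head.
have sub x t : 0 <= t -> hull s x -> hull (a :: s) (t *: emb a + x).
  by move=> t0 hx; exists t, x.
have [a0|a0] := pselect (a = 0).
  have -> : hull (a :: s) = hull s; last first.
    by apply: IH => x hx hNx; apply: sc; apply: has.
  apply/seteqP; split=> [x /hull_consP[t [y [_ hy ->]]]|x]; last exact: has.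
  by rewrite a0 emb0 scaler0 add0r.
have ea0 : emb a <> 0 by move/emb_eq0.
case: IH => [x hx hNx|hs|[g g0 hs]|[g [h [gh hs]]]].
- by apply: sc; apply: has.
- apply: Or32; exists a => //; apply/seteqP; split=> [x /hull_consP[t [y [t0]]]|x [t t0 ->]].
    by rewrite hs => -> ->; exists t; rewrite // addr0.
  by exists t, 0; rewrite hs addr0.
- have hg : hull s (emb g) by rewrite hs; exists 1; rewrite ?ler01 // scale1r.
  have [ga|ga|ga] := ltrgtP (d g a) 0.
  + apply: Or33; exists g, a; split=> //; apply/seteqP; split=> [x /hull_consP[t [y [t0]]]|x].
      by rewrite hs => -[t' t'0 ->] ->; rewrite addrC; apply: wedge_sum.
    move=> /(wedge_expand ga)[t [t' [t0 t'0 ->]]]; rewrite addrC.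
    by apply: sub => //; apply: hullZ.
  + have ag : d a g < 0 by rewrite det2C; lia.
    apply: Or33; exists a, g; split=> //; apply/seteqP; split=> [x /hull_consP[t [y [t0]]]|x].
      by rewrite hs => -[t' t'0 ->] ->; apply: wedge_sum.
    move=> /(wedge_expand ag)[t [t' [t0 t'0 ->]]].
    by apply: sub => //; apply: hullZ.
  + have eg0 : emb g <> 0 by move/emb_eq0.
    have [l aE] : exists l, emb a = l *: emb g by apply: collinear; rewrite // dK_emb ga.
    have [l0|l0] := lerP 0 l.
      apply: Or32; exists g => //; apply/seteqP; split=> [x /hull_consP[t [y [t0]]]|x].
        rewrite hs => -[t' t'0 ->] ->; exists (t * l + t').
          by rewrite addr_ge0 // mulr_ge0.
        by rewrite aE scalerA scalerDl.
      by rewrite -hs; apply: has.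
    case: eg0; apply: sc; first exact: has.
    have -> : - emb g = (- l^-1) *: emb a.
      by rewrite aE scalerA mulNr mulVf ?scaleN1r // lt_eqF.
    by apply: hullZ hem; rewrite oppr_ge0 invr_le0 ltW.
- have gh' : dK (emb g) (emb h) < 0 by rewrite dK_emb ltrz0.
  have hg : hull s (emb g).
    by rewrite hs; split; [rewrite dKxx | exact: ltW].
  have hh : hull s (emb h).
    by rewrite hs; split; [exact: ltW | rewrite dKxx].
  have eg0 : emb g <> 0 by move=> E; move: gh'; rewrite E dK0l ltxx.
  have eh0 : emb h <> 0 by move=> E; move: gh'; rewrite E dK0r ltxx.
  pose al : K := (d a h)%:~R / (d g h)%:~R; pose be : K := (d g a)%:~R / (d g h)%:~R.
  have aE : emb a = al *: emb g + be *: emb h.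
    have := @cramer (emb g) (emb h) (emb a); rewrite !dK_emb; apply.
    by rewrite intr_eq0 lt_eqF.
  have Dinv : (((d g h)%:~R : K)^-1 < 0) by rewrite invr_lt0 ltrz0.
  have absurd (u : lattice) l : emb u <> 0 -> hull (a :: s) (emb u) ->
      emb a = l *: emb u -> l < 0 -> False.
    move=> u0 hu E l0; apply: u0; apply: sc => //.
    have -> : - emb u = (- l^-1) *: emb a.
      by rewrite E scalerA mulNr mulVf ?scaleN1r // lt_eqF.
    by apply: hullZ hem; rewrite oppr_ge0 invr_le0 ltW.
  (* The two signs place [a] inside the wedge, past [h], before [g], or in the opposite open wedge.
     A zero determinant in the second and third case means that [a] is opposite to [g] or to [h]. *)
  have [p|p] := lerP (d g a) 0; have [q|q] := lerP (d a h) 0.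
  + apply: Or33; exists g, h; split=> //; rewrite -hs.
    apply/seteqP; split=> [x /hull_consP[t [y [t0]]]|x]; last exact: has.
    move=> hy ->; apply: hullD => //; apply: hullZ => //.
    by rewrite hs; split; rewrite dK_emb lerz0.
  + move: p; rewrite le_eqVlt => /orP[/eqP p|p].
      case: (@absurd g al) => //; [exact: has | |].
        by rewrite aE /be p mul0r scale0r addr0.
      by rewrite /al pmulr_rlt0 // ltr0z.
    apply: Or33; exists g, a; split=> //; apply/seteqP; split=> [x /hull_consP[t [y [t0]]]|x].
      rewrite hs => /(wedge_expand gh)[t1 [t2 [t10 t20 ->]]] ->; split.
        rewrite !dKDr !dKZr dKxx mulr0 add0r; apply: addr_le0.
          by rewrite mulr_ge0_le0 // dK_emb lerz0 ltW.
        by rewrite mulr_ge0_le0 // ltW.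
      rewrite !dKDl !dKZl dKxx mulr0 add0r; apply: addr_le0.
        by rewrite mulr_ge0_le0 // dK_emb lerz0 ltW.
      by rewrite mulr_ge0_le0 // dKC dK_emb oppr_le0 ler0z ltW.
    move=> /(wedge_expand p)[t [t' [t0 t'0 ->]]]; rewrite addrC.
    by apply: sub => //; apply: hullZ.
  + move: q; rewrite le_eqVlt => /orP[/eqP q|q].
      case: (@absurd h be) => //; [exact: has | |].
        by rewrite aE /al q mul0r scale0r add0r.
      by rewrite /be pmulr_rlt0 // ltr0z.
    apply: Or33; exists a, h; split=> //; apply/seteqP; split=> [x /hull_consP[t [y [t0]]]|x].
      rewrite hs => /(wedge_expand gh)[t1 [t2 [t10 t20 ->]]] ->; split.
        rewrite !dKDr !dKZr dKxx mulr0 add0r; apply: addr_le0.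
          by rewrite mulr_ge0_le0 // dKC dK_emb oppr_le0 ler0z ltW.
        by rewrite mulr_ge0_le0 // dK_emb lerz0 ltW.
      rewrite !dKDl !dKZl dKxx mulr0 addr0; apply: addr_le0.
        by rewrite mulr_ge0_le0 // dK_emb lerz0 ltW.
      by rewrite mulr_ge0_le0 // ltW.
    move=> /(wedge_expand q)[t [t' [t0 t'0 ->]]].
    by apply: sub => //; apply: hullZ.
  + case: ea0; apply: sc => //; apply: has; rewrite aE opprD -!scaleNr.
    by apply: hullD; apply: hullZ => //; rewrite oppr_ge0 pmulr_rle0 ?ltr0z // ltW.
Qed.

End PlaneCones.

(** * Maximal cones and their Hilbert bases *)

Section HilbertBases.

Lemma monoid_generated_mem (X : set lattice) u : X u -> monoid_generated X u.
Proof.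
move=> Xu; exists [:: u]; split; last by rewrite big_seq1.
by move=> w; rewrite inE => /eqP ->.
Qed.

Lemma irred_sum (S : set lattice) (s : seq lattice) u : S 0 ->
  (forall x y, S x -> S y -> S (x + y)) -> (forall w, w \in s -> S w) ->
  irred S u -> u = \sum_(w <- s) w -> u \in s.
Proof.
move=> S0 SD + [_ + irr] => sS u0.
elim: s sS => [|x s IH] sS; first by rewrite big_nil.
rewrite big_cons => uE.
have Ss : S (\sum_(w <- s) w).
  rewrite big_seq; elim/big_ind: _ => // w ws; apply: sS; by rewrite inE ws orbT.
have Sx : S x by apply: sS; exact: mem_head.
have [x0|s0] := irr _ _ Sx Ss uE; last by rewrite uE s0 addr0 mem_head.
rewrite inE IH ?orbT // => [w ws|]; first by apply: sS; rewrite inE ws orbT.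
by rewrite uE x0 add0r.
Qed.

Lemma sector0 g h : sector g h 0.
Proof. by split; rewrite ?det20l ?det20r. Qed.

Lemma sectorD g h x y : sector g h x -> sector g h y -> sector g h (x + y).
Proof. by move=> [gx xh] [gy yh]; split; rewrite ?det2Dl ?det2Dr; lia. Qed.

Lemma sector_generated g h : primitive g -> primitive h -> d g h < 0 ->
  monoid_generated (irred (sector g h)) = sector g h.
Proof.
move=> pg ph gh; have [w [r [uc r0 w0 wr irrE]]] := hirzebruch_jung pg ph gh.
apply/seteqP; split=> u.
  move=> [s [sX ->]]; rewrite big_seq; elim/big_ind: _; first exact: sector0.
    exact: sectorD.
  by move=> x /sX [].
move=> [gu uh]; rewrite -w0 in gu; rewrite -wr in uh.
have [i [k [l [ir ->]]]] := uchain_locate uc r0 gu uh.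
exists (nseq k (w i) ++ nseq l (w i.+1)); split; last first.
  by rewrite big_cat /= !big_nseq !iter_addr_0.
move=> x; rewrite mem_cat !mem_nseq => /orP[/andP[_ /eqP ->]|/andP[_ /eqP ->]]; apply/irrE.
  by exists i; rewrite // ltnW.
by exists i.+1.
Qed.

(** An irreducible vector written as a sum of generators must be one of them, so the irreducibles
    lie in every generating set. Since they generate the sector themselves, they form the only
    minimal one. *)
Lemma sector_hilbert g h X : primitive g -> primitive h -> d g h < 0 ->
  is_hilbert_basis (sector g h) X <-> X = irred (sector g h).
Proof.
move=> pg ph gh; have genI := sector_generated pg ph gh.
have sub Y : monoid_generated Y = sector g h -> irred (sector g h) `<=` Y.
  move=> genY u irru; have [Su _ _] := irru.
  have : monoid_generated Y u by rewrite genY.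
  move=> [s [sY uE]]; apply: (sY); apply: irred_sum irru uE.
  - exact: sector0.
  - exact: sectorD.
  - by move=> w /sY Yw; rewrite -genY; apply: monoid_generated_mem.
split=> [[genX minX]|->]; first by apply/esym/minX => //; exact: sub.
split=> // Y YI genY; apply/seteqP; split=> //; exact: sub.
Qed.

End HilbertBases.

Section FanGeometry.
Variables (K : realType) (F : set (set (plane K))).
Hypothesis fanF : is_fan F.
Hypothesis propF : proper_rational_cone (fan_support F).
Notation plane := (plane K).
Notation emb := (emb K).
Notation dK := (@det2 K).
Notation D := (fan_support F).
Implicit Types (x y z : plane) (u w g h : lattice) (C : set plane).

Definition lat C : set lattice := [set w | C (emb w)].

Lemma lat_wedge g h : lat (@wedge K g h) = sector g h.
Proof.
by apply/seteqP; split=> u; rewrite /lat /wedge /sector /= !dK_emb !lerz0.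
Qed.

Lemma wedge_scale g h k l : (0 < k)%N -> (0 < l)%N ->
  @wedge K (g *+ k) (h *+ l) = @wedge K g h.
Proof.
move=> k0 l0; apply/seteqP; split=> x [];
  by rewrite /wedge /= !embMn dKZl dKZr !pmulr_rle0 ?ltr0n.
Qed.

Lemma fan_cone C : F C -> exists s, C = @hull K s.
Proof. by case: fanF => _ H _ _ _ /H[/rational_coneP]. Qed.

Lemma fan_shape C : F C -> cone_shape C.
Proof.
move=> FC; have [s sE] := fan_cone FC; rewrite sE; apply: hull_shape.
by rewrite -sE; case: fanF => _ H _ _ _; case: (H _ FC).
Qed.

Lemma fan_cone0 C : F C -> C 0.
Proof. by move=> /fan_cone[s ->]; apply: hull0. Qed.

Lemma fan_coneD C x y : F C -> C x -> C y -> C (x + y).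
Proof. by move=> /fan_cone[s ->]; apply: hullD. Qed.

Lemma fan_coneZ C (t : K) x : F C -> 0 <= t -> C x -> C (t *: x).
Proof. by move=> /fan_cone[s ->]; apply: hullZ. Qed.

Lemma suppZ (t : K) x : 0 <= t -> D x -> D (t *: x).
Proof. by move=> t0 [C FC Cx]; exists C => //; apply: fan_coneZ. Qed.

Lemma suppD x y : D x -> D y -> D (x + y).
Proof.
move=> Dx Dy; have [_ _ _ _ conv] := fanF.
have -> : x + y = 2 *: (2^-1 *: x + (1 - 2^-1) *: y).
  have -> : 1 - 2^-1 = 2^-1 :> K by lra.
  by rewrite -scalerDr scalerA mulfV ?scale1r // pnatr_eq0.
by apply: suppZ; [lra | apply: conv => //; lra].
Qed.

Lemma fan_list : exists s : seq (set plane), forall C, F C <-> C \in s.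
Proof. by have [/finite_seqP[s ->] _ _ _ _] := fanF; exists s. Qed.

(** Passing to a strictly larger cone decreases the number of cones of the fan that contain it. *)
Lemma maximal_exists C : F C -> exists2 C', maximal_cone F C' & C `<=` C'.
Proof.
have [s sE] := fan_list.
have [N] := ubnP (count (fun C' => `[< C `<=` C' >]) s).
elim: N C => [|N IH] C; first by rewrite ltn0.
rewrite ltnS => le FC; have [maxC|] := pselect (maximal_cone F C); first by exists C.
move=> /not_andP[//|/existsNP[C' /not_implyP[FC' /not_implyP[CC' ne]]]].
have [|C2 max2 C'2] := IH C' _ FC'; last by exists C2 => // x /CC' /C'2.
apply: leq_trans le; pose P1 := fun E : set plane => `[< C' `<=` E >].
have P1C : ~~ P1 C.
  apply/negP => /asboolP C'C; case: ne; apply/seteqP; split=> //.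
have E := count_predUI P1 (pred1 C) s.
have E0 : count (predI P1 (pred1 C)) s = 0%N.
  rewrite (eq_count (a2 := pred0)) ?count_pred0 // => A /=.
  by case: eqVneq => [->|_]; rewrite ?andbF // (negbTE P1C).
have C1 : (0 < count (pred1 C) s)%N by rewrite -has_count has_pred1; apply/sE.
apply: (@leq_trans (count (predU P1 (pred1 C)) s)); last first.
  by apply: sub_count => A /= /orP[/asboolP C'A|/eqP ->]; apply/asboolP => // x /CC' /C'A.
by move: E; rewrite E0 addn0 => ->; rewrite -[X in (X < _)%N]addn0 ltn_add2l.
Qed.

Lemma supp_maximal x : D x -> exists2 C, maximal_cone F C & C x.
Proof. by move=> [C /maximal_exists[C' maxC' CC'] /CC']; exists C'. Qed.

Lemma supp_not_line (y : plane) : y <> 0 -> exists2 x, D x & dK y x <> 0.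
Proof.
move=> y0; apply: contrapT => none; case: propF => _ _; apply.
exists (- y.2, y.1), 0; split.
  by move=> E; apply: y0; apply: planeP; [case: E | case: E => /eqP; rewrite oppr_eq0 => /eqP].
move=> x Dx; apply: contrapT => ne; apply: none; exists x => // E; apply: ne.
by rewrite /dot /= -E /det2; ring.
Qed.

Lemma supp0 : D 0.
Proof.
have [|x Dx _] := @supp_not_line (emb (1, 0)); first by move=> /emb_eq0 [].
by rewrite -(scale0r x); apply: suppZ.
Qed.

End FanGeometry.

Section MaximalCones.
Variables (K : realType) (F : set (set (plane K))).
Hypothesis fanF : is_fan F.
Hypothesis propF : proper_rational_cone (fan_support F).
Notation plane := (plane K).
Notation emb := (emb K).
Notation dK := (@det2 K).
Notation D := (fan_support F).
Implicit Types (x y z : plane) (u g h : lattice) (C : set plane).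

Lemma pigeonhole (s : seq (set plane)) (P : nat -> plane) :
  (forall N, exists2 C, C \in s & C (P N)) ->
  exists2 C, C \in s & forall B, exists2 N, (B <= N)%N & C (P N).
Proof.
move=> H; apply: contrapT => none.
have [B HB] : exists B, forall C N, C \in s -> (B <= N)%N -> ~ C (P N).
  have {}none C : C \in s -> exists B, forall N, (B <= N)%N -> ~ C (P N).
    move=> Cs; apply: contrapT => nB; apply: none; exists C => // B.
    apply: contrapT => nN; apply: nB; exists B => N BN CPN; apply: nN; by exists N.
  elim: s {H} none => [|C s IH] none; first by exists 0%N.
  have [B1 H1] := none C (mem_head _ _).
  have [|B2 H2] := IH; first by move=> C' C's; apply: none; rewrite inE C's orbT.
  exists (maxn B1 B2) => C' N; rewrite inE geq_max => /orP[/eqP ->|C's] /andP[N1 N2].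
    exact: H1.
  exact: H2.
by have [C Cs] := H B; apply: HB.
Qed.

Lemma affine_limit (a b : K) :
  (forall B, exists2 N : nat, (B <= N)%N & N%:R * a + b <= 0) -> a <= 0.
Proof.
move=> H; rewrite leNgt; apply/negP => a0.
have [N BN] := H (Num.bound (`|b| / a)).
apply/negP; rewrite -ltNge.
have : `|b| / a < N%:R.
  apply: lt_le_trans (archi_boundP (divr_ge0 (normr_ge0 b) (ltW a0))) _.
  by rewrite ler_nat.
rewrite ltr_pdivrMr // => lt; have := ler_norm (- b); rewrite normrN; lra.
Qed.

(* A maximal cone C cannot be a ray through g: choose y in the support off the
   line of g; one cone contains N g + y for arbitrarily large N, hence contains
   g, and so C would be properly contained in it. *)
Lemma maximal_wedge C : maximal_cone F C -> exists g h,
  [/\ primitive g, primitive h, d g h < 0 & C = wedge g h].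
Proof.
move=> maxC; have [FC max] := maxC.
suff [g [h [gh CE]]] : exists g h, d g h < 0 /\ C = wedge g h.
  have g0 : g <> 0 by move=> g0; move: gh; rewrite g0 det20l ltxx.
  have h0 : h <> 0 by move=> h0; move: gh; rewrite h0 det20r ltxx.
  have [g' [k [pg k0 gE]]] := primitive_exists g0.
  have [h' [l [ph l0 hE]]] := primitive_exists h0.
  exists g', h'; rewrite CE gE hE wedge_scale //; split=> //.
  by move: gh; rewrite gE hE det2Ml det2Mr; nia.
have absurd C' x : F C' -> C `<=` C' -> C' x -> ~ C x -> False.
  by move=> FC' CC' C'x; rewrite -(max _ FC' CC').
have [CE|[g g0 CE]|//] := fan_shape fanF FC.
  have e0 : emb (1, 0) <> 0 by move=> /emb_eq0 [].
  have [x [C' FC' C'x] ex] := supp_not_line propF e0.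
  case: (absurd C' x) => //; first by rewrite CE => _ ->; exact: fan_cone0 FC'.
  by rewrite CE => x0; apply: ex; rewrite x0 dK0r.
have eg0 : emb g <> 0 by move/emb_eq0.
have [y Dy gy] := supp_not_line propF eg0.
have Dg : D (emb g) by exists C => //; rewrite CE; exists 1; rewrite ?ler01 ?scale1r.
have [s sE] := fan_list fanF.
pose P (N : nat) := N%:R *: emb g + y.
have gP N : dK (emb g) (P N) = dK (emb g) y.
  by rewrite dKDr dKZr dKxx mulr0 add0r.
have [|C' /sE FC' inf] := @pigeonhole s P.
  move=> N; have [C' FC' C'N] : D (P N) by apply: suppD => //; apply: suppZ.
  by exists C' => //; apply/sE.
have C'g : C' (emb g).
  have [C'E|[r r0 C'E]|[g' [h' [gh' C'E]]]] := fan_shape fanF FC'.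
  - have [N _] := inf 0%N; rewrite C'E => PN0; case: gy.
    by rewrite -(gP N) PN0 dK0r.
  - have [N1 _ PN1] := inf 0%N; have [N2 N12 PN2] := inf N1.+1.
    rewrite C'E in PN1 PN2; case: PN1 => t1 _ E1; case: PN2 => t2 _ E2.
    have P1 : dK (emb r) (P N1) = 0 by rewrite E1 dKZr dKxx mulr0.
    have P2 : dK (emb r) (P N2) = 0 by rewrite E2 dKZr dKxx mulr0.
    have rg : dK (emb r) (emb g) = 0.
      have : (N2%:R - N1%:R) * dK (emb r) (emb g) = 0.
        move: P1 P2; rewrite !dKDr !dKZr; lra.
      by move/eqP; rewrite mulf_eq0 subr_eq0 eqr_nat gtn_eqF //= => /eqP.
    by case: gy; rewrite -(gP N1) E1 dKZr dKC rg oppr0 mulr0.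
  - rewrite C'E; split.
      apply: (@affine_limit _ (dK (emb g') y)) => B.
      have [N BN] := inf B; rewrite C'E => -[H _]; exists N => //.
      by move: H; rewrite dKDr dKZr.
    apply: (@affine_limit _ (dK y (emb h'))) => B.
    have [N BN] := inf B; rewrite C'E => -[_ H]; exists N => //.
    by move: H; rewrite dKDl dKZl.
have [N _ C'N] := inf 0%N.
exfalso; apply: (absurd C' (P N)) => //.
  by rewrite CE => x [t t0 ->]; apply: (fan_coneZ fanF FC' t0 C'g).
by rewrite CE => -[t _ E]; apply: gy; rewrite -(gP N) E dKZr dKxx mulr0.
Qed.

Lemma maximal_hilbert C X : maximal_cone F C ->
  is_hilbert_basis [set w | C (emb w)] X <-> X = irred (lat C).
Proof.
move=> /maximal_wedge[g [h [pg ph gh CE]]].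
by rewrite -/(lat C) CE lat_wedge; apply: sector_hilbert.
Qed.

Lemma fan_hilbertE u : fan_hilbert F u <-> exists2 C, maximal_cone F C & irred (lat C) u.
Proof.
split=> [[C [X [maxC hX Xu]]]|[C maxC iu]].
  by exists C => //; rewrite -((maximal_hilbert X maxC).1 hX).
by exists C, (irred (lat C)); split=> //; apply/maximal_hilbert.
Qed.

Lemma maximal_chain C : maximal_cone F C -> exists w r,
  [/\ uchain w r, (0 < r)%N, lat C = sector (w 0%N) (w r)
    & forall u, irred (lat C) u <-> exists2 i, (i <= r)%N & u = w i].
Proof.
move=> /maximal_wedge[g [h [pg ph gh CE]]].
have [w [r [uc r0 w0 wr irrE]]] := hirzebruch_jung pg ph gh.
by exists w, r; rewrite CE lat_wedge w0 wr; split.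
Qed.

Lemma fan_hilbert_list : exists L : seq lattice, forall u, u \in L <-> fan_hilbert F u.
Proof.
have [s sE] := fan_list fanF.
suff [L LE] : exists L : seq lattice, forall u, u \in L <->
    exists C, [/\ C \in s, maximal_cone F C & irred (lat C) u].
  exists L => u; rewrite LE fan_hilbertE; split=> [[C [_ maxC iu]]|[C maxC iu]]; exists C => //.
  by split=> //; apply/sE; case: maxC.
elim: s {sE} => [|C s [L IH]]; first by exists [::] => u; split=> // -[C []].
have [maxC|nC] := pselect (maximal_cone F C); last first.
  exists L => u; rewrite IH; split=> -[C' [C's maxC' iu]]; exists C'; split=> //.
    by rewrite inE C's orbT.
  by move: C's; rewrite inE => /orP[/eqP E|//]; case: nC; rewrite -E.
have [w [r [_ _ _ irrE]]] := maximal_chain maxC.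
exists ([seq w i | i <- iota 0 r.+1] ++ L) => u; rewrite mem_cat; split.
  case/orP=> [/mapP[i]|/IH[C' [C's maxC' iu]]]; last first.
    by exists C'; rewrite inE C's orbT.
  rewrite mem_iota add0n ltnS => ir ->; exists C; rewrite mem_head; split=> //.
  by apply/irrE; exists i.
move=> [C' [C's maxC' iu]]; apply/orP; move: C's; rewrite inE => /orP[/eqP E|C's].
  left; move: iu; rewrite E => /irrE[i ir ->]; apply/mapP; exists i => //.
  by rewrite mem_iota add0n ltnS.
by right; apply/IH; exists C'.
Qed.

(** The intersection with [C'] is a face of the wedge, cut out by a form that is nonnegative on it.
    The form vanishes at u, a combination of g and h with positive coefficients, hence at g and
    h. *)
Lemma wedge_interior C' g h u : F C' -> F (wedge g h) -> d g h < 0 ->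
  C' (emb u) -> d g u < 0 -> d u h < 0 -> wedge g h `<=` C'.
Proof.
move=> FC' FC gh C'u gu uh.
have [_ _ _ inter _] := fanF; have [[a [a0 aE]] _] := inter _ _ FC FC'.
have [s [t [s0 t0 uE]]] : exists s t, [/\ 0 < s, 0 < t & emb u = s *: emb g + t *: emb h].
  exists (dK (emb u) (emb h) / dK (emb g) (emb h)), (dK (emb g) (emb u) / dK (emb g) (emb h)).
  split; last by apply: cramer; rewrite dK_emb intr_eq0 lt_eqF.
  - by rewrite !dK_emb nmulr_rgt0 ?invr_lt0 ltrz0.
  - by rewrite !dK_emb nmulr_rgt0 ?invr_lt0 ltrz0.
have Cu : wedge g h (emb u) by split; rewrite dK_emb lerz0 ltW.
have Cg : wedge g h (emb g) by split; rewrite ?dKxx // dK_emb lerz0 ltW.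
have Ch : wedge g h (emb h) by split; rewrite ?dKxx // dK_emb lerz0 ltW.
have dotD (x y : plane) (q r : K) : dot a (q *: x + r *: y) = q * dot a x + r * dot a y.
  have [E1 E2] := planeD (q *: x) (r *: y); have [E3 E4] := planeZ q x.
  by have [E5 E6] := planeZ r y; rewrite /dot E1 E2 E3 E4 E5 E6; ring.
have au : dot a (emb u) = 0.
  by have : (wedge g h `&` C') (emb u) by []; rewrite aE => -[].
have [ag ah] : dot a (emb g) = 0 /\ dot a (emb h) = 0.
  move: au; rewrite uE dotD; have := a0 _ Cg; have := a0 _ Ch => h0 g0 E.
  have sg : 0 <= s * dot a (emb g) by rewrite mulr_ge0 // ltW.
  have th : 0 <= t * dot a (emb h) by rewrite mulr_ge0 // ltW.
  have /eqP : s * dot a (emb g) = 0 by lra.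
  rewrite mulf_eq0 (gt_eqF s0) /= => /eqP ->.
  have /eqP : t * dot a (emb h) = 0 by lra.
  by rewrite mulf_eq0 (gt_eqF t0) /= => /eqP ->.
move=> x Cx; suff : (wedge g h `&` C') x by case.
rewrite aE; split=> //; have [q [r [_ _ ->]]] := wedge_expand gh Cx.
by rewrite dotD ag ah !mulr0 addr0.
Qed.

Lemma irred_extremal C u g k : F C -> irred (lat C) u -> (0 < k)%N -> u = g *+ k -> u = g.
Proof.
move=> FC [Cu u0 irr] k0 uE.
have Cg : lat C g.
  rewrite /lat /=; have -> : emb g = (k%:R)^-1 *: emb u.
    by rewrite uE embMn scalerA mulVf ?scale1r // pnatr_eq0 -lt0n.
  have k0' : 0 <= (k%:R : K)^-1 by rewrite invr_ge0 ler0n.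
  exact: (fan_coneZ fanF FC k0' Cu).
have Ck : lat C (g *+ k.-1).
  by rewrite /lat /= embMn; apply: (fan_coneZ fanF FC _ Cg); rewrite ler0n.
have uE' : u = g + g *+ k.-1 by rewrite uE -mulrS prednK.
have [g0|k1] := irr _ _ Cg Ck uE'.
- by case: u0; rewrite uE g0 mul0rn.
- by rewrite uE -(prednK k0) mulrS k1 addr0.
Qed.

(** The Hilbert bases of different maximal cones are compatible. If u is interior to C, then C lies
    in C' and they agree by maximality. If u is on a boundary ray of C, it is a multiple of the
    primitive generator, and its irreducibility in C' leaves only the generator itself. *)
Lemma irred_transfer C C' u : maximal_cone F C -> maximal_cone F C' ->
  irred (lat C') u -> lat C u -> irred (lat C) u.
Proof.
move=> maxC maxC' iu Cu; have [FC max] := maxC; have [FC' _] := maxC'.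
have [w [r [uc r0 latE irrE]]] := maximal_chain maxC.
have [g [h [pg ph gh CE]]] := maximal_wedge maxC.
have [C'u u0 _] := iu.
have iC g' : g' = g \/ g' = h -> irred (lat C) g'.
  move=> g'E; have [w' [r' [_ r'0 w'0 w'r irrE']]] := hirzebruch_jung pg ph gh.
  rewrite CE lat_wedge; apply/irrE'.
  by case: g'E => ->; [exists 0%N | exists r'].
have [gu uh] : sector g h u by move: Cu; rewrite CE lat_wedge.
have [gu0|gu0] := eqVneq (d g u) 0.
  have [z uE] := primitive_det pg gu0.
  have z0 : 0 < z.
    move: uh; rewrite uE det2Zl => zh; rewrite lt_neqAle; apply/andP; split; last by nia.
    by apply/eqP => z0; apply: u0; rewrite uE -z0 mulr0z.
  suff -> : u = g; first by apply: iC; left.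
  apply: (irred_extremal FC' iu (k := `|z|%N)); first by lia.
  by rewrite {1}uE pmulrn; congr (_ *~ _); lia.
have [uh0|uh0] := eqVneq (d u h) 0.
  have [|z uE] := primitive_det ph (w := u); first by rewrite det2C uh0.
  have z0 : 0 < z.
    move: gu; rewrite uE det2Zr => zh; rewrite lt_neqAle; apply/andP; split; last by nia.
    by apply/eqP => z0; apply: u0; rewrite uE -z0 mulr0z.
  suff -> : u = h; first by apply: iC; right.
  apply: (irred_extremal FC' iu (k := `|z|%N)); first by lia.
  by rewrite {1}uE pmulrn; congr (_ *~ _); lia.
have CC' : C `<=` C'.
  by rewrite CE in FC *; apply: wedge_interior FC' FC gh C'u _ _; lia.
by rewrite -(max _ FC' CC').
Qed.

Lemma irred_primitive C u : maximal_cone F C -> irred (lat C) u -> primitive u.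
Proof.
move=> maxC iu; have [FC _] := maxC; have [_ u0 _] := iu.
have [w [k [pw k0 uE]]] := primitive_exists u0.
by rewrite (irred_extremal FC iu k0 uE).
Qed.

(** The three possible shapes settle a strongly convex support. Otherwise the support contains a
    whole line through a lattice vector g, and lattice vectors of the support on both sides of this
    line would make it the whole plane. *)
Lemma half_plane : exists2 e, primitive e & forall u, D (emb u) -> d e u <= 0.
Proof.
suff [e e0 eP] : exists2 e, e <> 0 & forall u, D (emb u) -> d e u <= 0.
  have [e' [k [pe' k0 eE]]] := primitive_exists e0.
  by exists e' => // u /eP; rewrite eE det2Ml; nia.
have [rat nT _] := propF; have [s sE] := rational_coneP rat.
have [sc|nsc] := pselect (strongly_convex D).
  have : cone_shape D by rewrite sE; apply: hull_shape; rewrite -sE.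
  case=> [DE|[g g0 DE]|[g [h [gh DE]]]].
  - by exists (1, 0) => // u; rewrite DE => /emb_eq0 ->; rewrite det20r.
  - exists g => // u; rewrite DE => -[t _ E].
    by rewrite -(dK_le0 K) E dKZr dKxx mulr0.
  - exists g => [g0|u]; first by move: gh; rewrite g0 det20l ltxx.
    by rewrite DE => -[H _]; rewrite -(dK_le0 K).
have [g [g0 Dg DNg]] : exists g, [/\ g <> 0, D (emb g) & D (- emb g)].
  apply: contrapT => none; apply: nsc.
  (* A line in the support yields a generator with the same property: if x = t g + y with t > 0 and
     -x is in the support, then -g = t^-1 (-x + y) is too. *)
  have key s' x : {subset s' <= s} -> hull s' x -> D (- x) -> x = 0.
    elim: s' x => [|g s' IH] x sub //= [t [y [t0 hy xE]]] DNx.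
    have sub' : {subset s' <= s} by move=> g' g's; apply: sub; rewrite inE g's orbT.
    have Dsub z : hull s' z -> D z.
      rewrite sE; elim: s' sub' z {IH sub hy} => [|g' s' IH] sub' z /=.
        by move=> ->; apply: hull0.
      move=> [t' [z' [t'0 hz ->]]]; apply: hullD; last first.
        by apply: IH hz => g1 g1s; apply: sub'; rewrite inE g1s orbT.
      by apply: hullZ t'0 _; apply: hull_mem; apply: sub'; apply: mem_head.
    have [t1|t1] := eqVneq t 0.
      by rewrite xE t1 scale0r add0r; apply: IH; rewrite // -[y]add0r -(scale0r (emb g)) -t1 -xE.
    have [g0|g0] := pselect (g = 0).
      have xy : x = y by rewrite xE g0 emb0 scaler0 add0r.
      by rewrite xy; apply: IH; rewrite // -xy.
    case: none; exists g; split=> //.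
      by rewrite sE; apply: hull_mem; apply: sub; exact: mem_head.
    have -> : - emb g = t^-1 *: (- x + y).
      by rewrite xE opprD subrK scalerN scalerA mulVf ?scale1r.
    apply: suppZ => //; first by rewrite invr_ge0.
    by apply: suppD => //; apply: Dsub.
  by move=> x; rewrite {1}sE => hx DNx; apply: key hx DNx.
have eg0 : emb g <> 0 by move/emb_eq0.
have [H|nH] := pselect (forall u, D (emb u) -> d g u <= 0); first by exists g.
have [H'|nH'] := pselect (forall u, D (emb u) -> d (- g) u <= 0).
  by exists (- g) => // E; apply: g0; rewrite -[g]opprK E oppr0.
move: nH nH' => /existsNP[a /not_implyP[Da /negP]]; rewrite -ltNge => ga.
move=> /existsNP[b /not_implyP[Db /negP]]; rewrite -ltNge det2Nl oppr_gt0 => gb.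
case: nT; apply/seteqP; split=> // x _.
have Dq (q : K) : D (q *: emb g).
  have [q0|q0] := lerP 0 q; first exact: suppZ.
  rewrite -[q]opprK scaleNr -scalerN; apply: suppZ => //.
  by rewrite oppr_ge0 ltW.
have ga' : dK (emb g) (emb a) > 0 by rewrite dK_emb ltr0z.
have gb' : dK (emb g) (emb b) < 0 by rewrite dK_emb ltrz0.
have [x0|x0] := lerP 0 (dK (emb g) x).
  rewrite (@cramer _ (emb g) (emb a) x) ?gt_eqF //; apply: suppD => //.
  by apply: suppZ => //; rewrite divr_ge0 // ltW.
rewrite (@cramer _ (emb g) (emb b) x) ?lt_eqF //; apply: suppD => //.
by apply: suppZ => //; rewrite mulr_le0 ?invr_le0 // ltW.
Qed.

End MaximalCones.

(** * The clockwise enumeration *)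

Section ClockwiseOrder.
Variable e : lattice.
Implicit Types u w x y z : lattice.

(* [e] comes first and [- e] last: the sign of the determinant alone does not
   order opposite vectors. *)
Definition cw_le u w : bool :=
  (u == e) || ((w != e) && ((w == - e) || ((u != - e) && (d u w <= 0)))).

Definition cw_side u := [|| u == e, u == - e | d e u < 0].

Lemma cw_le_total : total cw_le.
Proof.
move=> u w; rewrite /cw_le; case: (u == e); case: (w == e) => //=.
case: (u == - e); case: (w == - e) => //=.
by rewrite [d w u]det2C oppr_le0; apply: le_total.
Qed.

(** The sign of the determinant is not transitive on the plane; on the open half-plane where [d e]
    is negative the Pluecker relation makes it so. *)
Lemma det2_trans u x w : d e u < 0 -> d e x < 0 -> d e w < 0 ->
  d u x <= 0 -> d x w <= 0 -> d u w <= 0.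
Proof.
move=> eu ex ew ux xw; have := det2_plucker e u x w.
rewrite leNgt => E; apply/negP => uw.
have : d e x * d u w < 0 by rewrite nmulr_rlt0.
have : 0 <= d e u * d x w by rewrite mulr_le0 // ltW.
have : 0 <= d e w * d u x by rewrite mulr_le0 // ltW.
by rewrite E; lia.
Qed.

Lemma cw_le_trans : {in cw_side & &, transitive cw_le}.
Proof.
move=> x u w; rewrite !unfold_in /cw_side /cw_le.
case: (eqVneq u e) => //= ue; case: (eqVneq x e) => //= xe; case: (eqVneq w e) => //= we.
case: (eqVneq w (- e)) => //= wne; case: (eqVneq x (- e)) => //= xne.
case: (eqVneq u (- e)) => //= une ex eu ew ux xw.
exact: (@det2_trans u x w).
Qed.

Lemma primitive_parallel u w : primitive u -> primitive w -> d u w = 0 -> w = u \/ w = - u.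
Proof.
move=> pu [x [y xy]] /(primitive_det pu)[k wE]; move: xy; have [E1 E2] := latMzE u k.
rewrite wE E1 E2 => xy.
have kk : k * (u.1 * x + u.2 * y) = 1 by rewrite -xy; ring.
have [k1|k1] : k = 1 \/ k = -1.
  have : (`|k| * `|(u.1 * x + u.2 * y)%R| = 1)%N by rewrite -abszM kk.
  by move/eqP; rewrite muln_eq1 => /andP[/eqP ? _]; lia.
- by left; rewrite k1.
- by right; rewrite k1 mulrN1z.
Qed.

Lemma cw_le_lt u w : primitive u -> primitive w -> cw_side u -> cw_side w -> u <> w ->
  cw_le u w -> d u w < 0 \/ (u = e /\ w = - e).
Proof.
rewrite /cw_side /cw_le => pu pw.
case: (eqVneq u e) => [->|ue] /=.
  by case: (eqVneq w e) => [-> //|we] /=; case: (eqVneq w (- e)) => [->|wne]; [right | left].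
case: (eqVneq w e) => [//|we] /=; case: (eqVneq u (- e)) => [->|une] /=.
  by case: (eqVneq w (- e)) => [-> //|].
case: (eqVneq w (- e)) => [->|wne] /=.
  by move=> eu _ _ _; left; rewrite det2Nr det2C opprK.
move=> eu ew uw le; left; rewrite lt_neqAle le andbT; apply/eqP => uw0.
have [E|E] := primitive_parallel pu pw uw0; first by case: uw.
by move: ew; rewrite E det2Nr; lia.
Qed.

End ClockwiseOrder.

Section Enumeration.
Variables (K : realType) (F : set (set (plane K))).
Hypothesis fanF : is_fan F.
Hypothesis propF : proper_rational_cone (fan_support F).
Notation D := (lat (fan_support F)).
Notation V v i := (nth (0 : lattice) v i).

(** The exception in [cb_lt] is the pair of boundary vectors of a half-plane. *)
Record clockwise_basis (v : seq lattice) : Prop := ClockwiseBasis {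
  cb_enum : is_clockwise_enum (fan_hilbert F) v;
  cb_size : (1 < size v)%N;
  cb_lt : forall i j, (i < j < size v)%N -> d (V v i) (V v j) < 0 \/
            [/\ i = 0%N, j.+1 = size v & V v j = - V v i];
  cb_uni : forall k, (k.+1 < size v)%N -> d (V v k) (V v k.+1) = -1;
  cb_cone : forall k, (k.+1 < size v)%N -> exists C,
            [/\ maximal_cone F C, lat C (V v k) & lat C (V v k.+1)];
  cb_loc : forall u, D u -> exists k a b,
            (k.+1 < size v)%N /\ u = V v k *+ a + V v k.+1 *+ b }.

Lemma hilbert_supp u : fan_hilbert F u -> D u.
Proof. by move=> /(fan_hilbertE fanF propF)[C [FC _] [Cu _ _]]; exists C. Qed.

Lemma hilbert_primitive u : fan_hilbert F u -> primitive u.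
Proof. by move=> /(fan_hilbertE fanF propF)[C maxC iu]; apply: irred_primitive maxC iu. Qed.

Lemma sorted_hilbert : exists v : seq lattice, [/\ uniq v,
    forall u, u \in v <-> fan_hilbert F u
  & forall i j, (i < j < size v)%N -> d (V v i) (V v j) < 0 \/
       [/\ i = 0%N, j.+1 = size v & V v j = - V v i]].
Proof.
have [e pe eP] := half_plane fanF propF.
have [L LE] := fan_hilbert_list fanF propF.
pose v := sort (cw_le e) (undup L).
have vE u : u \in v <-> fan_hilbert F u by rewrite mem_sort mem_undup; apply: LE.
have uv : uniq v by rewrite sort_uniq undup_uniq.
have side u : fan_hilbert F u -> cw_side e u.
  move=> Hu; rewrite /cw_side; have := eP u (hilbert_supp Hu).
  rewrite le_eqVlt => /orP[/eqP eu|->]; last by rewrite !orbT.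
  by have [->|->] := primitive_parallel pe (hilbert_primitive Hu) eu; rewrite eqxx ?orbT.
have pw : pairwise (cw_le e) v.
  rewrite -(sorted_pairwise_in (P := cw_side e)); first exact/sort_sorted/cw_le_total.
    exact: cw_le_trans.
  by apply/allP => u /vE /side.
have lt i j : (i < j < size v)%N ->
    d (V v i) (V v j) < 0 \/ (V v i = e /\ V v j = - e).
  move=> /andP[ij jv]; have iv := ltn_trans ij jv.
  have Hi : fan_hilbert F (V v i) by apply/vE; exact: mem_nth.
  have Hj : fan_hilbert F (V v j) by apply/vE; exact: mem_nth.
  apply: cw_le_lt; try exact: hilbert_primitive; try exact: side.
    by move/eqP; rewrite nth_uniq // ltn_eqF.
  by move/(pairwiseP (0 : lattice)): pw; apply.
exists v; split=> // i j ijv; have [|[ie je]] := lt i j ijv; first by left.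
right; move: ijv => /andP[ij jv]; have iv := ltn_trans ij jv.
have Hsupp k : (k < size v)%N -> d e (V v k) <= 0.
  by move=> kv; apply: eP; apply: hilbert_supp; apply/vE; apply: mem_nth.
have e0 := primitive_neq0 pe.
(* A vector before [e] or after [- e] would lie on the forbidden side of [e] or repeat an entry, so
   this pair occupies the two ends of the list. *)
split; last by rewrite ie.
- have [//|i0] := posnP i.
  have [|H|[H _]] := lt 0%N i; first by rewrite i0.
    by have := Hsupp 0%N (leq_ltn_trans (leq0n i) iv); rewrite -ie det2C; lia.
  have : V v 0%N == V v i by rewrite H ie.
  by rewrite nth_uniq // ?(leq_ltn_trans (leq0n i) iv) // eq_sym => /eqP.
- have [//|jv'] := eqVneq j.+1 (size v).
  have kv : (j.+1 < size v)%N by rewrite ltn_neqAle jv' jv.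
  have [|H|[H _]] := lt j j.+1; first by rewrite ltnSn kv.
    by have := Hsupp j.+1 kv; move: H; rewrite je det2Nl; lia.
  have : V v i == V v j by rewrite ie H.
  by rewrite nth_uniq // ltn_eqF.
Qed.

Lemma clockwise_basis_exists : exists v, clockwise_basis v.
Proof.
have [v [uv vE lt]] := sorted_hilbert; exists v.
have inv u : fan_hilbert F u -> exists2 i, (i < size v)%N & u = V v i.
  move=> /vE uin; exists (index u v); first by rewrite index_mem.
  by rewrite nth_index.
have le i j : (i <= j)%N -> (j < size v)%N -> d (V v i) (V v j) <= 0.
  rewrite leq_eqVlt => /orP[/eqP -> _|ij jv]; first by rewrite det2uu.
  have [|/ltW //|[_ _ ->]] := lt i j; first by rewrite ij jv.
  by rewrite det2Nr det2uu oppr0.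
have ltI i j : (i < size v)%N -> d (V v i) (V v j) < 0 -> (i < j)%N.
  by move=> iv ijlt; rewrite ltnNge; apply/negP => ji; have := le j i ji iv; rewrite det2C; lia.
have [C0 maxC0 _] := supp_maximal fanF (supp0 fanF propF).
have maxH C w r : (forall u, irred (lat C) u <-> exists2 i, (i <= r)%N & u = w i) ->
    maximal_cone F C -> forall i, (i <= r)%N -> exists2 a, (a < size v)%N & w i = V v a.
  move=> irrE maxC i ir; apply: inv; apply/(fan_hilbertE fanF propF); exists C => //.
  by apply/irrE; exists i.
have size1 : (1 < size v)%N.
  have [w [r [uc r0 latE irrE]]] := maximal_chain fanF propF maxC0.
  have [a av wa] := maxH _ _ _ irrE maxC0 0%N (leq0n r).
  have [b bv wb] := maxH _ _ _ irrE maxC0 r (leqnn r).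
  have [mono _] := uc; have := mono 0%N r r0 (leqnn r); rewrite wa wb => /(ltI _ _ av) ab.
  exact: leq_ltn_trans (leq_ltn_trans (leq0n a) ab) bv.
(* Opposite neighbours would be the only two vectors of the list, but the ends of a maximal cone are
   two listed vectors with negative determinant. *)
have cons k : (k.+1 < size v)%N -> d (V v k) (V v k.+1) < 0.
  move=> kv; have [|//|[k0 kM VN]] := lt k k.+1; first by rewrite ltnSn.
  have [w [r [uc r0 latE irrE]]] := maximal_chain fanF propF maxC0.
  have [a av wa] := maxH _ _ _ irrE maxC0 0%N (leq0n r).
  have [b bv wb] := maxH _ _ _ irrE maxC0 r (leqnn r).
  have [mono _] := uc; have := mono 0%N r r0 (leqnn r); rewrite wa wb => ab.
  have abI := ltI _ _ av ab; move: VN ab; rewrite k0.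
  have -> : a = 0%N by lia.
  have -> : b = 1%N by lia.
  by move=> ->; rewrite det2Nr det2uu; lia.
have lt' i j : (i < j)%N -> (j < size v)%N -> (0 < i)%N || (j.+1 < size v)%N ->
    d (V v i) (V v j) < 0.
  by move=> ij jv H; have [|//|[i0 jM _]] := lt i j; [rewrite ij jv | lia].
(* A maximal cone containing v_k + v_(k+1) contains both vectors, because its
   two extremal vectors are in the list. *)
have around k : (k.+1 < size v)%N -> exists C, [/\ maximal_cone F C,
    lat C (V v k) & lat C (V v k.+1)].
  move=> kv; have kv' := ltnW kv.
  have Hk i : (i < size v)%N -> D (V v i).
    by move=> iv; apply: hilbert_supp; apply/vE; exact: mem_nth.
  have [C maxC Ck] : exists2 C, maximal_cone F C & lat C (V v k + V v k.+1).
    have := supp_maximal fanF (suppD fanF (Hk _ kv') (Hk _ kv)).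
    by move=> [C maxC]; rewrite -embD; exists C.
  exists C; have [w [r [uc r0 latE irrE]]] := maximal_chain fanF propF maxC.
  have [a av wa] := maxH _ _ _ irrE maxC 0%N (leq0n r).
  have [b bv wb] := maxH _ _ _ irrE maxC r (leqnn r).
  have [] : sector (w 0%N) (w r) (V v k + V v k.+1) by rewrite -latE.
  rewrite wa wb det2Dl det2Dr => H1 H2.
  have cs := cons k kv.
  have ak : (a <= k)%N.
    rewrite leqNgt; apply/negP => ka.
    have := le k.+1 a ka av; rewrite det2C => l1.
    have := le k a (ltnW ka) av; rewrite det2C => l2.
    have [E|ne] := eqVneq a k.+1; first by move: H1; rewrite E det2uu [d (V v k.+1) _]det2C; lia.
    have : d (V v k.+1) (V v a) < 0 by apply: lt'; lia.
    rewrite det2C; lia.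
  have kb : (k < b)%N.
    rewrite ltnNge; apply/negP => bk.
    have := le b k bk kv'; rewrite det2C => l1.
    have := le b k.+1 (leqW bk) kv; rewrite det2C => l2.
    have [E|ne] := eqVneq b k; first by move: H2; rewrite E det2uu [d (V v k.+1) _]det2C; lia.
    have : d (V v b) (V v k) < 0 by apply: lt'; lia.
    rewrite det2C; lia.
  have inC i : (a <= i)%N -> (i <= b)%N -> lat C (V v i).
    move=> ai ib; rewrite latE; split; rewrite ?wa ?wb; apply: le => //.
    exact: leq_ltn_trans ib bv.
  by split; [exact: maxC | apply: inC; lia | apply: inC; lia].
(* Neighbours in the chain of a cone are neighbours in the list. A vector listed between them would
   lie in this cone, be irreducible there by [irred_transfer], and so appear in the chain strictly
   between [w i] and [w i.+1]. *)
have step C w r i a b : maximal_cone F C -> uchain w r -> (0 < r)%N ->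
    lat C = sector (w 0%N) (w r) ->
    (forall u, irred (lat C) u <-> exists2 i, (i <= r)%N & u = w i) ->
    (i < r)%N -> (a < size v)%N -> (b < size v)%N -> w i = V v a -> w i.+1 = V v b ->
    b = a.+1.
  move=> maxC uc r0 latE irrE ir av bv wa wb; have [mono unim] := uc.
  have ab : (a < b)%N by apply: ltI => //; rewrite -wa -wb; apply: mono.
  apply/eqP; rewrite eqn_leq ab andbT leqNgt; apply/negP => ab1.
  have [l lv wl] := maxH _ _ _ irrE maxC 0%N (leq0n r).
  have [l' l'v wl'] := maxH _ _ _ irrE maxC r (leqnn r).
  have la : (l <= a)%N.
    have [i0|i0] := posnP i; last by apply/ltnW/ltI => //; rewrite -wl -wa; apply: mono; lia.
    have : V v l == V v a by rewrite -wl -wa i0.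
    by rewrite nth_uniq // => /eqP ->.
  have bl' : (b <= l')%N.
    have [i0|i0] := eqVneq i.+1 r; last by apply/ltnW/ltI => //; rewrite -wl' -wb; apply: mono; lia.
    have : V v l' == V v b by rewrite -wl' -wb i0.
    by rewrite nth_uniq // => /eqP ->.
  have a1v : (a.+1 < size v)%N by lia.
  have [m mr wm] : exists2 m, (m <= r)%N & V v a.+1 = w m.
    apply/irrE; have [C' maxC' iu] : exists2 C', maximal_cone F C' & irred (lat C') (V v a.+1).
      by apply/(fan_hilbertE fanF propF)/vE; exact: mem_nth.
    apply: (irred_transfer fanF propF maxC maxC' iu).
    by rewrite latE; split; [rewrite wl | rewrite wl']; apply: le; lia.
  have im : (i < m)%N.
    rewrite ltnNge; apply/negP => mi; have := uchain_le uc mi (ltnW ir).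
    by rewrite -wm wa det2C; have := cons a a1v; lia.
  have mi : (m <= i)%N.
    rewrite leqNgt; apply/negP => mi; have := uchain_le uc mi mr.
    rewrite -wm wb det2C; have : d (V v a.+1) (V v b) < 0 by apply: lt'; lia.
    lia.
  lia.
split=> //.
- by split=> //; apply/(sortedP (0 : lattice)) => k; apply: cons.
- move=> k kv; have [C [maxC Ck Ck1]] := around k kv.
  have [w [r [uc r0 latE irrE]]] := maximal_chain fanF propF maxC.
  have inC i : (i < size v)%N -> lat C (V v i) -> exists2 a, (a <= r)%N & V v i = w a.
    move=> iv Ci; apply/irrE.
    have [C' maxC' iu] : exists2 C', maximal_cone F C' & irred (lat C') (V v i).
      by apply/(fan_hilbertE fanF propF)/vE; exact: mem_nth.
    exact: (irred_transfer fanF propF maxC maxC' iu Ci).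
  have [a ar wa] := inC k (ltnW kv) Ck; have [b br wb] := inC k.+1 kv Ck1.
  have ab : (a < b)%N.
    rewrite ltnNge; apply/negP => ba; have := uchain_le uc ba ar.
    by rewrite -wa -wb det2C; have := cons k kv; lia.
  have [c cv wc] := maxH _ _ _ irrE maxC a.+1 (leq_trans ab br).
  have ck := step C w r a k c maxC uc r0 latE irrE (leq_trans ab br) (ltnW kv) cv (esym wa) wc.
  have [_ unim] := uc; rewrite wa -ck -wc unim //; exact: leq_trans ab br.
- move=> u /(supp_maximal fanF)[C maxC Cu].
  have [w [r [uc r0 latE irrE]]] := maximal_chain fanF propF maxC.
  have := Cu; rewrite -[C _]/(lat C u) latE => -[u0 ur].
  have [i [k [l [ir ->]]]] := uchain_locate uc r0 u0 ur.
  have [a av wa] := maxH _ _ _ irrE maxC i (ltnW ir).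
  have [b bv wb] := maxH _ _ _ irrE maxC i.+1 ir.
  have ba := step C w r i a b maxC uc r0 latE irrE ir av bv wa wb.
  by exists a, k, l; rewrite -ba -wa -wb.
Qed.

End Enumeration.

Lemma standard_pair M (m : 'X_{1..M}) : (1 < M)%N -> standard m ->
  exists k k' : 'I_M, exists a b, k' = k.+1 :> nat /\ m = (U_(k) *+ a + U_(k') *+ b)%MM.
Proof.
move=> M1 sm; have [m0|m0] := eqVneq m 0%MM.
  exists (Ordinal (ltnW M1)), (Ordinal M1), 0%N, 0%N; split=> //.
  by rewrite !mulm0n addm0.
have [i0 mi0] : exists i, (0 < m i)%N.
  apply/existsP; apply: contra_neqT m0 => /existsPn H; apply/mnmP => i.
  by rewrite mnm0E; have := H i; lia.
case: (@arg_minnP _ i0 (fun i => (0 < m i)%N) val mi0) => i mi mini.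
have low (l : 'I_M) : (l < i)%N -> m l = 0%N.
  by move=> li; apply/eqP; rewrite -leqn0 leqNgt; apply/negP => /mini; rewrite leqNgt li.
have high (l : 'I_M) : (i.+1 < l)%N -> m l = 0%N.
  by move=> il; apply/eqP; rewrite -leqn0 leqNgt; apply/negP => /(sm _ _ il mi).
have [iM|iM] := ltnP i.+1 M.
  exists i, (Ordinal iM), (m i), (m (Ordinal iM)); split=> //; apply/mnmP => l.
  rewrite mnmDE !mulmnE !mnm1E -!val_eqE /=.
  have [li|li|/val_inj ->] := ltngtP l i.
  - by rewrite low // !mul0n; case: eqP => [|_]; lia.
  - have [E|ne] := eqVneq i.+1 l; last by rewrite high; lia.
    by rewrite mul0n add0n mul1n; congr (m _); apply: val_inj.
  - by rewrite mul1n gtn_eqF ?mul0n ?addn0.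
(* Only the last variable occurs, so the pair is (i - 1, i) with exponent 0 at i - 1. *)
have iM' := ltn_ord i; have kM : (i.-1 < M)%N by exact: leq_ltn_trans (leq_pred i) iM'.
exists (Ordinal kM), i, 0%N, (m i); split; first by rewrite /=; lia.
apply/mnmP => l; rewrite mnmDE !mulmnE !mnm1E muln0 add0n.
have [<-|ne] := eqVneq i l; first by rewrite mul1n.
by rewrite mul0n low //; move: ne; rewrite -val_eqE /=; have := ltn_ord l; lia.
Qed.

(** * From the enumeration to [good_chain] *)

Section Clockwise.
Variables (K : realType) (F : set (set (plane K))).
Hypothesis fanF : is_fan F.
Hypothesis propF : proper_rational_cone (fan_support F).
Variables (n : nat) (f : 'I_n -> lattice -> nat).
Hypothesis f_lin : forall t, fan_linear F (f t).
Variable v : seq lattice.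
Hypothesis cb : clockwise_basis F v.
Notation D := (lat (fan_support F)).
Notation V i := (nth (0 : lattice) v i).
Notation M := (size v).
Notation vt := (in_tuple v).
Implicit Types i j k l a b : nat.

Lemma tnthV (i : 'I_M) : tnth vt i = V i.
Proof. exact: tnth_nth. Qed.

Lemma cb_le i j : (i <= j)%N -> (j < M)%N -> d (V i) (V j) <= 0.
Proof.
rewrite leq_eqVlt => /orP[/eqP -> _|ij jv]; first by rewrite det2uu.
have [|/ltW //|[_ _ ->]] := cb_lt cb (i := i) (j := j); first by rewrite ij jv.
by rewrite det2Nr det2uu oppr0.
Qed.

Lemma cb_lt' i j : (i < j)%N -> (j < M)%N -> (0 < i)%N || (j.+1 < M)%N ->
  d (V i) (V j) < 0.
Proof.
by move=> ij jv H; have [|//|[i0 jM _]] := cb_lt cb (i := i) (j := j); [rewrite ij jv | lia].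
Qed.

Lemma cb_supp i : (i < M)%N -> D (V i).
Proof.
move=> iM; apply: (hilbert_supp fanF propF); have [_ vE _] := cb_enum cb.
by apply/vE; exact: mem_nth.
Qed.

(** For k < l the determinant of [V k.+1] with the left side is a, and with the right side a sum of
    nonpositive terms. So a and b' vanish, and only a multiple of the shared vector or 0 can have
    two expressions. *)
Lemma cb_pair_eq k l a b a' b' : (k <= l)%N -> (l.+1 < M)%N ->
  V k *+ a + V k.+1 *+ b = V l *+ a' + V l.+1 *+ b' ->
  [\/ [/\ k = l, a = a' & b = b'], [/\ l = k.+1, a = 0%N, b' = 0%N & b = a']
    | [/\ a = 0%N, b = 0%N, a' = 0%N & b' = 0%N]].
Proof.
move=> kl lM E; have kM : (k.+1 < M)%N by lia.
have uk := cb_uni cb kM; have ul := cb_uni cb lM.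
have dk x : d (V k) (V k *+ a + V k.+1 *+ b) = x -> x = - b%:Z.
  by rewrite det2Dr !det2Mr det2uu uk => <-; lia.
have dk1 x : d (V k.+1) (V k *+ a + V k.+1 *+ b) = x -> x = a%:Z.
  by rewrite det2Dr !det2Mr det2uu det2C uk => <-; lia.
have [kl'|kl'] := eqVneq k l.
  apply: Or31; split=> //.
    have := dk1 _ erefl; rewrite E kl' det2Dr !det2Mr det2uu det2C ul; lia.
  have := dk _ erefl; rewrite E kl' det2Dr !det2Mr det2uu ul; lia.
have kl1 : (k.+1 <= l)%N by lia.
have dl : d (V k.+1) (V l) <= 0 by apply: cb_le => //; lia.
have dl1 : d (V k.+1) (V l.+1) < 0 by apply: cb_lt'; lia.
have := dk1 _ erefl; rewrite E det2Dr !det2Mr => Ea.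
have a0 : a = 0%N.
  have : a'%:Z * d (V k.+1) (V l) <= 0 by rewrite mulr_ge0_le0.
  have : b'%:Z * d (V k.+1) (V l.+1) <= 0 by rewrite mulr_ge0_le0 // ltW.
  lia.
have b0 : b' = 0%N.
  have : a'%:Z * d (V k.+1) (V l) <= 0 by rewrite mulr_ge0_le0.
  have [//|b'0] := posnP b'.
  have : b'%:Z * d (V k.+1) (V l.+1) < 0 by rewrite pmulr_rlt0.
  lia.
have [lk|lk] := eqVneq l k.+1.
  apply: Or32; split=> //; have := dk _ erefl.
  rewrite E lk b0 mulr0n addr0 det2Mr uk; lia.
apply: Or33; have dl' : d (V k.+1) (V l) < 0 by apply: cb_lt'; lia.
have a'0 : a' = 0%N.
  have [//|a'0] := posnP a'.
  have : a'%:Z * d (V k.+1) (V l) < 0 by rewrite pmulr_rlt0.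
  lia.
split=> //; have := dk _ erefl.
by rewrite E a'0 b0 !mulr0n addr0 det20r; lia.
Qed.

Lemma supp_lin t k a b : (k.+1 < M)%N ->
  f t (V k *+ a + V k.+1 *+ b) = (a * f t (V k) + b * f t (V k.+1))%N.
Proof.
move=> kM; have [C [[FC _] Ck Ck1]] := cb_cone cb kM.
by have [lin _] := f_lin t; apply: (lin C FC).
Qed.

(** The last clause says that v_j and later vectors do not occur, which is the lexicographic
    decrease. The sum turns strictly before v_j, so k < j; if k + 1 = j, the determinant with v_k
    forces b = 0. *)
Lemma cb_red i j : (i.+1 < j)%N -> (j < M)%N -> exists k a b,
  [/\ (k.+1 < M)%N, V i + V j = V k *+ a + V k.+1 *+ b
    & (a = 0%N \/ (k < j)%N) /\ (b = 0%N \/ (k.+1 < j)%N)].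
Proof.
move=> ij jM; have Dij : D (V i + V j).
  by rewrite /lat /= embD; apply: suppD => //; apply: cb_supp; lia.
have ijM : (i < j < M)%N by lia.
have [ijlt|[i0 jM' VN]] := cb_lt cb ijM; last first.
  (* Opposite vectors have sum 0; with both exponents 0 the pair at [i] is an arbitrary choice. *)
  exists i, 0%N, 0%N; rewrite VN subrr !mulr0n addr0; split=> //; [lia|].
  by split; left.
have [k [a [b [kM E]]]] := cb_loc cb Dij.
exists k, a, b; have [kj|jk] := ltnP k j; last first.
  have := congr1 (fun u => d u (V j)) E; rewrite /= !det2Dl !det2Ml det2uu addr0.
  have := cb_le jk (ltnW kM); have := cb_le (leqW jk) kM; rewrite !(det2C (V j)) => h1 h2.
  have : 0 <= a%:Z * d (V k) (V j) by rewrite mulr_ge0 //; lia.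
  have : 0 <= b%:Z * d (V k.+1) (V j) by rewrite mulr_ge0 //; lia.
  lia.
split=> //; split; first by right.
have [kj1|kj1] := eqVneq k.+1 j; last by right; lia.
left; have := congr1 (d (V k)) E; rewrite !det2Dr !det2Mr det2uu -kj1 (cb_uni cb kM).
have : d (V i) (V k) < 0 by apply: cb_lt'; lia.
rewrite det2C; lia.
Qed.

Lemma clockwise_good_chain : good_chain f vt D.
Proof.
have v1 := cb_size cb.
have degE (k k' : 'I_M) a b : k' = k.+1 :> nat ->
    mnm_deg2 vt (U_(k) *+ a + U_(k') *+ b)%MM = V k *+ a + V k.+1 *+ b.
  by move=> kk; rewrite mnm_deg2D !degMn !mnm_deg2U !tnthV kk.
split.
- rewrite /lat /= emb0 -(scale0r (emb K (V 0))); apply: suppZ => //.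
  by apply: cb_supp; apply: ltnW.
- by move=> u w Du Dw; rewrite /lat /= embD; apply: suppD.
- by move=> i; rewrite tnthV; apply: cb_supp.
- by move=> t u w Du Dw; have [_] := f_lin t; apply.
- move=> t m /(standard_pair v1)[k [k' [a [b [kk ->]]]]].
  rewrite degE // supp_lin -?kk // wtD !wtMn !wtU !tnthV kk; lia.
- move=> m m' /(standard_pair v1)[k [k' [a [b [kk ->]]]]].
  move=> /(standard_pair v1)[l [l' [a' [b' [ll ->]]]]]; rewrite !degE // => E.
  have kM : (k.+1 < M)%N by rewrite -kk. have lM : (l.+1 < M)%N by rewrite -ll.
  have [kl|lk] := leqP k l.
    have [[kl' -> ->]|[lk -> -> ->]|[-> -> -> ->]] := cb_pair_eq kl lM E.
    + by have -> : k = l; [apply: val_inj | congr (_ + _ *+ _)%MM; congr U_(_)%MM; apply: val_inj; rewrite /= kk ll kl'].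
    + rewrite !mulm0n add0m addm0; congr (U_(_) *+ _)%MM; apply: val_inj.
      by rewrite /= kk lk.
    + by rewrite !mulm0n.
  have [[kl' -> ->]|[kl -> -> ->]|[-> -> -> ->]] := cb_pair_eq (ltnW lk) kM (esym E).
  + by rewrite kl' ltnn in lk.
  + rewrite !mulm0n add0m addm0; congr (U_(_) *+ _)%MM; apply: val_inj.
    by rewrite /= ll kl.
  + by rewrite !mulm0n.
- move=> u Du; have [k [a [b [kM ->]]]] := cb_loc cb Du.
  pose k0 : 'I_M := Ordinal (ltnW kM); pose k1 : 'I_M := Ordinal kM.
  exists (U_(k0) *+ a + U_(k1) *+ b)%MM; last exact: (degE k0 k1).
  move=> x y; rewrite !mnmDE !mulmnE !mnm1E -!val_eqE /=.
  by case: eqP => ?; case: eqP => ?; case: eqP => ?; case: eqP => ?; lia.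
- move=> i j ij; have [k [a [b [kM E [ak bk]]]]] := cb_red ij (ltn_ord j).
  pose k0 : 'I_M := Ordinal (ltnW kM); pose k1 : 'I_M := Ordinal kM.
  exists k0, k1, a, b; rewrite !tnthV; split=> //; apply/mnm_ltP; exists j.
  rewrite !mnmDE !mulmnE !mnm1E -!val_eqE /=; split.
    by case: eqP => ?; case: eqP => ?; case: eqP => ?; case: eqP => ?; lia.
  move=> l jl; rewrite !mnmDE !mulmnE !mnm1E -!val_eqE /=.
  by case: eqP => ?; case: eqP => ?; case: eqP => ?; case: eqP => ?; lia.
Qed.

End Clockwise.

Lemma cramer_nat (a b u : lattice) : d a b <= 0 -> d a u <= 0 -> d u b <= 0 ->
  u *+ `|d a b| = a *+ `|d u b| + b *+ `|d a u|.
Proof.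
move=> ab au ub; have [E1 E2] := latDE (a *+ `|d u b|) (b *+ `|d a u|).
have [U1 U2] := latMnE u `|d a b|; have [A1 A2] := latMnE a `|d u b|.
have [B1 B2] := latMnE b `|d a u|.
by apply: latticeP; rewrite ?E1 ?E2 ?U1 ?U2 ?A1 ?A2 ?B1 ?B2 !abszE !ler0_norm // /det2; ring.
Qed.

Lemma int_diff (k : int) : exists a b : nat, k = a%:Z - b%:Z.
Proof.
case: k => k; first by exists k, 0%N; rewrite subr0.
by exists 0%N, k.+1; rewrite NegzE sub0r.
Qed.

(** * Strict families *)

Section Strictness.
Variables (K : realType) (F : set (set (plane K))).
Hypothesis fanF : is_fan F.
Hypothesis propF : proper_rational_cone (fan_support F).
Notation D := (lat (fan_support F)).
Implicit Types (u w x y X Y : lattice) (C : set (plane K)).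

Section OneFunction.
Variable f : lattice -> nat.
Hypothesis f_lin : fan_linear F f.

Lemma fan_linear_hom u N : D u -> f (u *+ N) = (N * f u)%N.
Proof.
move=> [C FC Cu]; have [lin _] := f_lin.
by have := lin C FC u u N 0%N Cu Cu; rewrite mulr0n addr0 mul0n addn0.
Qed.

Lemma fan_linear0 : f 0 = 0%N.
Proof.
have D0 : D 0 by rewrite /lat /= emb0; apply: supp0.
by have := fan_linear_hom 0 D0; rewrite mulr0n mul0n.
Qed.

Lemma lat_suppD u w : D u -> D w -> D (u + w).
Proof. by move=> Du Dw; rewrite /lat /= embD; apply: suppD. Qed.

Lemma lat_suppM u k : D u -> D (u *+ k).
Proof. by move=> Du; rewrite /lat /= embMn; apply: suppZ. Qed.

Lemma fan_linear_comb u w a b : D u -> D w ->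
  (f (u *+ a + w *+ b)%R <= a * f u + b * f w)%N.
Proof.
move=> Du Dw; rewrite -!fan_linear_hom //; have [_] := f_lin.
by apply; rewrite -/(lat _ _); apply: lat_suppM.
Qed.

(* If [f] is additive at [x + y], then it is linear on the cone spanned by
   [x] and [y]. *)
Lemma flat_scale x y u : D x -> D y -> D u -> d x y < 0 -> d x u <= 0 -> d u y <= 0 ->
  f (x + y) = (f x + f y)%N ->
  (`|d x y| * f u = `|d u y| * f x + `|d x u| * f y)%N.
Proof.
move=> Dx Dy Du xy xu uy fxy; have E := cramer_nat (ltW xy) xu uy.
set A := `|d u y|%N in E *; set B := `|d x u|%N in E *; set N := `|d x y|%N in E *.
have := fan_linear_comb A B Dx Dy; rewrite -E fan_linear_hom // => le1.
(* The complementary combination [x *+ B + y *+ A] completes [u *+ N] to a multiple of x + y, where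
   f is known. Subadditivity of this decomposition gives the inequality opposite to [le1]. *)
have E2 : (x + y) *+ (A + B) = u *+ N + (x *+ B + y *+ A) *+ 1.
  by rewrite E mulr1n mulrnDl !mulrnDr [RHS]addrACA; congr (_ + _); apply: addrC.
have Dxy : D (x *+ B + y *+ A) by apply: lat_suppD; apply: lat_suppM.
have := fan_linear_comb N 1 Du Dxy; rewrite -E2 fan_linear_hom; last exact: lat_suppD.
have := fan_linear_comb B A Dx Dy; rewrite fxy; lia.
Qed.

(** Adding multiples of x or of -x cannot increase f, and u and w are reached from each other in
    this way. *)
Lemma flat_shift x u w (z : int) : D x -> D (- x) -> D u -> D w ->
  f x = 0%N -> f (- x) = 0%N -> u = w + x *~ z -> f u = f w.
Proof.
move=> Dx DNx Du Dw fx fNx uE.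
have [z1 [z2 zE]] := int_diff z.
have E1 : u + (- x) *+ z1 + x *+ z2 = w.
  rewrite uE zE mulrzBr -!pmulrn mulNrn.
  by rewrite addrA -[w + x *+ z1 - x *+ z2 - x *+ z1]addrA addrACA subrr addr0 subrK.
have E2 : w + x *+ z1 + (- x) *+ z2 = u.
  by rewrite uE zE mulrzBr -!pmulrn mulNrn addrA.
have sub p q a : D p -> D q -> f q = 0%N -> (f (p + q *+ a)%R <= f p)%N.
  by move=> Dp Dq q0; have := fan_linear_comb 1 a Dp Dq; rewrite mulr1n q0 muln0 addn0 mul1n.
apply/eqP; rewrite eqn_leq; apply/andP; split.
  rewrite -E2; apply: leq_trans (sub _ _ _ _ _ fNx) (sub _ _ _ _ _ fx) => //.
  by apply: lat_suppD => //; apply: lat_suppM.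
rewrite -E1; apply: leq_trans (sub _ _ _ _ _ fx) (sub _ _ _ _ _ fNx) => //.
by apply: lat_suppD => //; apply: lat_suppM.
Qed.

(** Modulo the line of x the lattice has rank 1 with coordinate [d x], and f is constant along that
    line. *)
Lemma flat_opposite x u w : D x -> D (- x) -> primitive x -> D u -> D w ->
  d x u <= 0 -> d x w <= 0 -> f x = 0%N -> f (- x) = 0%N ->
  (`|d x w| * f u = `|d x u| * f w)%N.
Proof.
move=> Dx DNx px Du Dw xu xw fx fNx.
have [z zE] : exists z, u *+ `|d x w| = w *+ `|d x u| + x *~ z.
  have [|z zE] := primitive_det px (w := u *+ `|d x w| - w *+ `|d x u|).
    rewrite det2Dr det2Nr !det2Mr !abszE !ler0_norm //; ring.
  by exists z; rewrite -zE addrC subrK.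
by rewrite -!fan_linear_hom //; apply: flat_shift zE => //; apply: lat_suppM.
Qed.

Lemma flat_between x y u w : D x -> D y -> D u -> D w -> primitive x ->
  d x y < 0 \/ (y = - x /\ exists2 m, D m & d x m < 0) ->
  d x u <= 0 -> d u y <= 0 -> d x w <= 0 -> d w y <= 0 ->
  f (x + y) = (f x + f y)%N -> f (u + w) = (f u + f w)%N.
Proof.
move=> Dx Dy Du Dw px [xy|[yE [m Dm xm]]] xu uy xw wy fxy.
  have Duw := lat_suppD Du Dw.
  have xuw : d x (u + w) <= 0 by rewrite det2Dr; lia.
  have uwy : d (u + w) y <= 0 by rewrite det2Dl; lia.
  have := flat_scale Dx Dy Du xy xu uy fxy; have := flat_scale Dx Dy Dw xy xw wy fxy.
  have := flat_scale Dx Dy Duw xy xuw uwy fxy.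
  have -> : (`|d (u + w)%R y| = `|d u y| + `|d w y|)%N by rewrite det2Dl; lia.
  have -> : (`|d x (u + w)%R| = `|d x u| + `|d x w|)%N by rewrite det2Dr; lia.
  have N0 : (0 < `|d x y|)%N by lia.
  by move=> E1 E2 E3; apply/eqP; rewrite -(eqn_pmul2l N0) mulnDr E1 E2 E3 !mulnDl addnACA.
move: fxy; rewrite yE subrr fan_linear0 => fxy.
have fx : f x = 0%N by lia.
have fNx : f (- x) = 0%N by lia.
have DNx : D (- x) by rewrite -yE.
have Duw := lat_suppD Du Dw.
have xuw : d x (u + w) <= 0 by rewrite det2Dr; lia.
have H z : D z -> d x z <= 0 -> (`|d x m| * f z = `|d x z| * f m)%N.
  by move=> Dz xz; apply: flat_opposite => //; apply: ltW.
have := H _ Duw xuw; have := H _ Du xu; have := H _ Dw xw.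
have -> : (`|d x (u + w)%R| = `|d x u| + `|d x w|)%N by rewrite det2Dr; lia.
have N0 : (0 < `|d x m|)%N by lia.
by move=> E1 E2 E3; apply/eqP; rewrite -(eqn_pmul2l N0) mulnDr E1 E2 E3 !mulnDl.
Qed.

Lemma cone_linear C X Y u : F C -> lat C X -> lat C Y -> lat C u -> d X Y = -1 ->
  (f u)%:Z = - d u Y * (f X)%:Z - d X u * (f Y)%:Z.
Proof.
move=> FC CX CY Cu XY; have uE := unimodular_expand u XY.
have [p1 [p2 pE]] := int_diff (- d u Y); have [q1 [q2 qE]] := int_diff (- d X u).
have [lin _] := f_lin; rewrite -mulNr pE qE.
have E : u *+ 1 + (X *+ p2 + Y *+ q2) *+ 1 = X *+ p1 + Y *+ q1.
  rewrite uE pE qE !mulrzBr -!pmulrn !mulr1n addrACA !subrK.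
  by [].
have Cw : lat C (X *+ p2 + Y *+ q2).
  rewrite /lat /= embD !embMn; apply: (fan_coneD fanF FC);
    by apply: (fan_coneZ fanF FC) => //; rewrite ler0n.
have := lin C FC _ _ 1%N 1%N Cu Cw; rewrite E (lin C FC) // (lin C FC) //; lia.
Qed.

(** Additivity at X + Z = c Y determines f Z from f X and f Y as a linear form would, so the forms
    representing f on C and on C' coincide. *)
Lemma union_linear C C' X Y Z : F C -> F C' -> lat C X -> lat C Y -> lat C' Y -> lat C' Z ->
  d X Y = -1 -> d Y Z = -1 -> 0 <= - d X Z -> D (X + Z) -> f (X + Z) = (f X + f Z)%N ->
  (forall u w, lat (C `|` C') u -> lat (C `|` C') w -> lat (C `|` C') (u + w)) ->
  linear_on (C `|` C') f.
Proof.
move=> FC FC' CX CY C'Y C'Z XY YZ c0 DXZ fXZ add.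
have wall := wall_relation XY YZ; set c := - d X Z in wall c0.
have fZ : (f Z)%:Z = c * (f Y)%:Z - (f X)%:Z.
  have DY : D Y by exists C.
  have : f (X + Z) = (`|c| * f Y)%N.
    by rewrite wall -(fan_linear_hom _ DY) pmulrn; congr (f (_ *~ _)); lia.
  rewrite fXZ; nia.
have ZE : Z = Y *~ c - X by rewrite -wall addrC addKr.
pose lam u := - d u Y * (f X)%:Z - d X u * (f Y)%:Z.
have lamE u : lat (C `|` C') u -> (f u)%:Z = lam u.
  move=> [Cu|C'u]; first exact: cone_linear Cu XY.
  rewrite (cone_linear FC' C'Y C'Z C'u YZ) fZ ZE /lam.
  rewrite det2Dr det2Nr det2Zr (det2C Y u) (det2C u X); ring.
have mul u k : lat (C `|` C') u -> lat (C `|` C') (u *+ k).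
  have k0 : 0 <= (k%:R : K) by rewrite ler0n.
  by move=> [Cu|C'u]; [left | right]; rewrite embMn; apply: (fan_coneZ fanF) => //.
move=> u w a b Cu Cw; apply/eqP; rewrite -eqz_nat PoszD !PoszM.
rewrite lamE; last by apply: add; apply: mul.
rewrite (lamE u Cu) (lamE w Cw) /lam det2Dl det2Dr !det2Ml !det2Mr; apply/eqP; ring.
Qed.

End OneFunction.
End Strictness.

(** * Walls between basis vectors and strictness *)

Section Gap.
Variables (K : realType) (F : set (set (plane K))).
Hypothesis fanF : is_fan F.
Hypothesis propF : proper_rational_cone (fan_support F).
Variables (n : nat) (f : 'I_n -> lattice -> nat).
Hypothesis f_lin : forall t, fan_linear F (f t).
Variable v : seq lattice.
Hypothesis cb : clockwise_basis F v.
Notation D := (lat (fan_support F)).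
Notation V i := (nth (0 : lattice) v i).
Notation M := (size v).
Implicit Types (i j k l a b : nat) (C : set (plane K)).

Lemma cb_hilbert i : (i < M)%N -> fan_hilbert F (V i).
Proof. by move=> iM; have [_ vE _] := cb_enum cb; apply/vE; exact: mem_nth. Qed.

Lemma cb_irred C i : maximal_cone F C -> (i < M)%N -> lat C (V i) -> irred (lat C) (V i).
Proof.
move=> maxC iM Ci; have [C' maxC' iu] := (fan_hilbertE fanF propF _).1 (cb_hilbert iM).
exact: (irred_transfer fanF propF maxC maxC' iu).
Qed.

Lemma cone_ends C : maximal_cone F C -> exists a b,
  [/\ (a < b < M)%N, d (V a) (V b) < 0 & C = wedge (V a) (V b)].
Proof.
move=> maxC; have [g [h [pg ph gh CE]]] := maximal_wedge fanF propF maxC.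
have [w [r [uc r0 w0 wr irrE]]] := hirzebruch_jung pg ph gh.
have pos u : irred (sector g h) u -> exists2 i, (i < M)%N & u = V i.
  rewrite -(lat_wedge K) -CE => iu; have [_ vE _] := cb_enum cb.
  have uin : u \in v by apply/vE/(fan_hilbertE fanF propF); exists C.
  by exists (index u v); rewrite ?index_mem ?nth_index.
have [|a aM ga] := pos g; first by apply/irrE; exists 0%N.
have [|b bM hb] := pos h; first by apply/irrE; exists r.
exists a, b; rewrite -ga -hb bM andbT; split=> //.
rewrite ltnNge; apply/negP => ba; have := cb_le cb ba aM.
by rewrite -ga -hb det2C; lia.
Qed.

(** With a + b < 2 the sum is 0 or a basis vector. The first contradicts strong convexity, the
    second the irreducibility of that vector in C. *)
Lemma same_cone_sum C i j k a b : maximal_cone F C -> (i < M)%N -> (j < M)%N ->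
  lat C (V i) -> lat C (V j) -> (k.+1 < M)%N -> (a + b < 2)%N ->
  V i + V j = V k *+ a + V k.+1 *+ b -> False.
Proof.
move=> maxC iM jM Ci Cj kM ab E.
have [_ i0 _] := cb_irred maxC iM Ci; have [_ j0 _] := cb_irred maxC jM Cj.
have [FC _] := maxC; have Cij : lat C (V i + V j).
  by rewrite /lat /= embD; apply: (fan_coneD fanF FC).
have notH m : (m < M)%N -> V i + V j = V m -> False.
  move=> mM Em; rewrite Em in Cij.
  have [_ _ irr] := cb_irred maxC mM Cij.
  by have [] := irr _ _ Ci Cj (esym Em).
have [_ sc _ _ _] := fanF; have [_ sconv] := sc _ FC.
case: a b ab E => [|[|a]] [|[|b]] // _; rewrite ?mulr0n ?mulr1n ?addr0 ?add0r => E.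
- apply: i0; apply: (@emb_eq0 K); apply: sconv Ci _.
  have jE : V j = - V i by apply/eqP; rewrite -addr_eq0 addrC E.
  by rewrite -embN -jE.
- exact: notH kM E.
- exact: notH (ltnW kM) E.
Qed.

(** C is a maximal cone through v_i and v_(i+1), and v_(l+1) is the first later vector outside C,
    which comes no later than v_j. *)
Lemma wall_exists i j : (i.+1 < j)%N -> (j < M)%N ->
  (forall C, maximal_cone F C -> lat C (V i) -> ~ lat C (V j)) ->
  exists C l, [/\ maximal_cone F C, (i < l < j)%N, lat C (V l.-1), lat C (V l)
                & ~ lat C (V l.+1)].
Proof.
move=> ij jM H; have [C [maxC Ci Ci1]] := cb_cone cb (k := i) (ltn_trans ij jM).
pose P m := (i < m)%N && `[< ~ lat C (V m) >].
have exP : exists m, P m.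
  by exists j; rewrite /P (ltnW ij) /=; apply/asboolP/H.
case: (ex_minnP exP) => m /andP[im /asboolP nm] minm.
have mj : (m <= j)%N by apply: minm; rewrite /P (ltnW ij) /=; apply/asboolP/H.
have im1 : m != i.+1 by apply/eqP => mE; apply: nm; rewrite mE.
have inC l : (i <= l < m)%N -> lat C (V l).
  move=> /andP[il lm]; have [<-//|il'] := eqVneq i l.
  apply: contrapT => nl; have : (m <= l)%N.
    by apply: minm; rewrite /P ltn_neqAle il' il /=; apply/asboolP.
  by rewrite leqNgt lm.
exists C, m.-1; split=> //; first by lia.
- by apply: inC; lia.
- by apply: inC; lia.
- by rewrite prednK //; lia.
Qed.

Lemma wall_cones C l : maximal_cone F C -> (0 < l)%N -> (l.+1 < M)%N ->
  lat C (V l.-1) -> lat C (V l) -> ~ lat C (V l.+1) ->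
  exists C' a b, [/\ maximal_cone F C', (a < l < b)%N /\ (b < M)%N,
     C = wedge (V a) (V l) & C' = wedge (V l) (V b)].
Proof.
move=> maxC l0 lM Cl1 Cl nCl.
have [C' [maxC' C'l C'l1]] := cb_cone cb lM.
have [a [b [/andP[ab bM] dab CE]]] := cone_ends maxC.
have [a' [b' [/andP[ab' bM'] dab' CE']]] := cone_ends maxC'.
have lpM := ltnW lM.
move: Cl1 Cl nCl; rewrite CE lat_wedge => -[Ca1 Cb1] [Ca Cb] nC.
have /(_ C'l C'l1) : lat C' (V l) -> lat C' (V l.+1) -> sector (V a') (V b') (V l) /\
    sector (V a') (V b') (V l.+1) by rewrite CE' lat_wedge.
move=> [[Ca' Cb'] [Ca1' Cb1']].
have al : (a < l)%N.
  rewrite ltnNge; apply/negP => la.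
  have : d (V l.-1) (V a) < 0 by apply: (cb_lt' cb); lia.
  rewrite det2C; lia.
have lb : (l <= b)%N.
  rewrite leqNgt; apply/negP => bl.
  have : d (V b) (V l) < 0 by apply: (cb_lt' cb); lia.
  rewrite det2C; lia.
have bl : b = l.
  apply/eqP; rewrite eqn_leq lb andbT leqNgt; apply/negP => lb'.
  by apply: nC; split; apply: (cb_le cb); lia.
have al' : (a' <= l)%N.
  rewrite leqNgt; apply/negP => la.
  have : d (V l) (V a') < 0 by apply: (cb_lt' cb); lia.
  rewrite det2C; lia.
have lb' : (l < b')%N.
  rewrite ltnNge; apply/negP => bl'.
  have : d (V b') (V l.+1) < 0 by apply: (cb_lt' cb); lia.
  rewrite det2C; lia.
(* If [C'] began before v_l, then v_l would be interior to [C'] and lie in C. The two cones would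
   coincide, and v_(l+1) would lie in C. *)
have al2 : a' = l.
  apply/eqP; rewrite eqn_leq al' /= leqNgt; apply/negP => al2.
  have [FC maxi] := maxC; have [FC' maxi'] := maxC'.
  have sub : wedge (V a') (V b') `<=` C.
    apply: (wedge_interior fanF FC) => //; first by rewrite -CE'.
    - have Cl' : lat C (V l) by rewrite CE lat_wedge.
      exact: Cl'.
    - by apply: (cb_lt' cb); lia.
    - by apply: (cb_lt' cb); lia.
  have CC' : C = C' by apply: maxi' => //; rewrite CE'.
  by apply: nC; rewrite -(lat_wedge K) -CE CC'.
exists C', a, b'; split; [exact: maxC' | by rewrite al lb' | by rewrite -bl |].
by rewrite -[in X in wedge X _]al2.
Qed.

(** A cone listed between C and C' would be squeezed onto the line of v_l, but maximal cones are
    two-dimensional. *)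
Lemma consecutive_cones Cs C C' a l b : is_clockwise_cones F Cs ->
  maximal_cone F C -> maximal_cone F C' -> (a < l < b)%N -> (b < M)%N -> (l.+1 < M)%N ->
  C = wedge (V a) (V l) -> C' = wedge (V l) (V b) -> d (V l) (V b) < 0 ->
  exists2 q : nat, (q.+1 < size Cs)%N &
     C = nth set0 Cs q /\ C' = nth set0 Cs q.+1.
Proof.
move=> [CsE before] maxC maxC' /andP[al lb] bM lM CE CE' dlb.
have Cl : C (emb K (V l)).
  by rewrite CE; split; rewrite dK_le0 ?det2uu // (cb_le cb) //; lia.
have C'l : C' (emb K (V l)).
  by rewrite CE'; split; rewrite dK_le0 ?det2uu // (cb_le cb) //; lia.
have C'b : C' (emb K (V b)).
  by rewrite CE'; split; rewrite dK_le0 ?det2uu // (cb_le cb) //; lia.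
have [q qs Cq] := (CsE C).1 maxC; have [r rs Cr] := (CsE C').1 maxC'.
have qr : (q < r)%N.
  rewrite ltnNge leq_eqVlt; apply/negP => /orP[/eqP rq|rq].
    have Cb : C (emb K (V b)) by rewrite Cq -rq -Cr.
    by move: Cb; rewrite CE => -[_]; rewrite dK_le0 det2C; lia.
  have := before _ _ rq qs; rewrite -Cq -Cr => /(_ _ _ C'b Cl).
  by rewrite (dK_le0 K) det2C; lia.
have rq : r = q.+1.
  apply/eqP; rewrite eqn_leq qr andbT leqNgt; apply/negP => qr'.
  have q1s : (q.+1 < size Cs)%N := ltn_trans qr' rs.
  have maxE : maximal_cone F (nth set0 Cs q.+1) by apply/CsE; exists q.+1.
  have [x [y [xyM dxy EE]]] := cone_ends maxE.
  have perp z : nth set0 Cs q.+1 z -> @det2 K (emb K (V l)) z = 0.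
    move=> Ez; apply/eqP; rewrite eq_le.
    have := before _ _ (ltnSn q) q1s; rewrite -Cq => /(_ _ _ Cl Ez) ->.
    have := before _ _ qr' rs; rewrite -Cr => /(_ _ _ Ez C'l).
    by rewrite dKC oppr_le0.
  have Ex : nth set0 Cs q.+1 (emb K (V x)).
    by rewrite EE; split; rewrite dK_le0 ?det2uu // ltW.
  have Ey : nth set0 Cs q.+1 (emb K (V y)).
    by rewrite EE; split; rewrite dK_le0 ?det2uu // ltW.
  have lx : d (V l) (V x) = 0.
    by have := perp _ Ex; rewrite (dK_emb K) => /eqP; rewrite intr_eq0 => /eqP.
  have ly : d (V l) (V y) = 0.
    by have := perp _ Ey; rewrite (dK_emb K) => /eqP; rewrite intr_eq0 => /eqP.
  (* As [V x] and [V y] are parallel to v_l, the Pluecker relation gives d(v_b, v_l) d(v_x, v_y) =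
     0, although both factors are nonzero. *)
  have := det2_plucker (V b) (V x) (V l) (V y).
  rewrite ly (det2C (V x) (V l)) lx oppr0 !mulr0 addr0 => /eqP.
  by rewrite mulf_eq0 (det2C (V b)) oppr_eq0 !lt_eqF.
by exists q; rewrite -?rq.
Qed.

(** The angle from v_a to v_b is at most pi, so the union is cut out by the conditions at its two
    ends, and the side of v_l decides which cone contains the sum. *)
Lemma union_closed C C' a l b u w : C = wedge (V a) (V l) -> C' = wedge (V l) (V b) ->
  (a < l < b)%N -> (b < M)%N -> lat (C `|` C') u -> lat (C `|` C') w -> lat (C `|` C') (u + w).
Proof.
move=> CE CE' /andP[al lb] bM.
have dal : d (V a) (V l) < 0 by apply: (cb_lt' cb); lia.
have dlb : d (V l) (V b) < 0 by apply: (cb_lt' cb); lia.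
have dab : d (V a) (V b) <= 0 by apply: (cb_le cb); lia.
have latU x : lat (C `|` C') x <-> sector (V a) (V l) x \/ sector (V l) (V b) x.
  by rewrite -!(lat_wedge K) -CE -CE'.
have left_le x : sector (V l) (V b) x -> d (V a) x <= 0.
  move=> [lx xb]; have E := cramer_nat (ltW dlb) lx xb.
  have := congr1 (d (V a)) E; rewrite det2Dr !det2Mr.
  have : `|d x (V b)|%N%:Z * d (V a) (V l) <= 0 by rewrite mulr_ge0_le0 // ltW.
  have : `|d (V l) x|%N%:Z * d (V a) (V b) <= 0 by rewrite mulr_ge0_le0.
  have N0 : 0 < `|d (V l) (V b)|%N%:Z by lia.
  by move=> h1 h2 h3; rewrite -(pmulr_rle0 _ N0) h3; lia.
have right_le x : sector (V a) (V l) x -> d x (V b) <= 0.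
  move=> [ax xl]; have E := cramer_nat (ltW dal) ax xl.
  have := congr1 (d^~ (V b)) E; rewrite /= det2Dl !det2Ml.
  have : `|d x (V l)|%N%:Z * d (V a) (V b) <= 0 by rewrite mulr_ge0_le0.
  have : `|d (V a) x|%N%:Z * d (V l) (V b) <= 0 by rewrite mulr_ge0_le0 // ltW.
  have N0 : 0 < `|d (V a) (V l)|%N%:Z by lia.
  by move=> h1 h2 h3; rewrite -(pmulr_rle0 _ N0) h3; lia.
have ends x : sector (V a) (V l) x \/ sector (V l) (V b) x -> d (V a) x <= 0 /\ d x (V b) <= 0.
  move=> [sx|sx].
    by split; [case: sx | apply: right_le].
  by split; [apply: left_le | case: sx].
rewrite !latU => /ends[au ub] /ends[aw wb].
have [H|H] := lerP (d (u + w) (V l)) 0.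
  by left; split=> //; rewrite det2Dr; lia.
by right; split; [rewrite det2C; lia | rewrite det2Dl; lia].
Qed.

(* Two elements of a common cone cannot have a sum with a + b < 2, because the
   Hilbert basis consists of irreducibles.  Otherwise a wall of the fan lies
   strictly between v_i and v_j; additivity of all f_t at v_i + v_j would make
   them linear across this wall. *)
Lemma strict_gap i j k a b : strict F f -> (i.+1 < j)%N -> (j < M)%N -> (k.+1 < M)%N ->
  V i + V j = V k *+ a + V k.+1 *+ b -> (a + b < 2)%N ->
  exists t, (f t (V i + V j)%R < f t (V i) + f t (V j))%N.
Proof.
move=> [Cs [clock nlin]] ij jM kM E ab; apply: contrapT => none.
have iM : (i < M)%N by lia.
have flat t : f t (V i + V j) = (f t (V i) + f t (V j))%N.
  have [_ sub] := f_lin t.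
  have le := sub _ _ (cb_supp fanF propF cb iM) (cb_supp fanF propF cb jM).
  apply/eqP; rewrite eqn_leq le leqNgt; apply/negP => lt; apply: none; by exists t.
have [|C [l [maxC /andP[il lj] Cl1 Cl nCl]]] := wall_exists ij jM.
  by move=> C maxC Ci Cj; apply: (same_cone_sum maxC iM jM Ci Cj kM ab E).
have l0 : (0 < l)%N by lia.
have lM : (l.+1 < M)%N by lia.
have [C' [x [y [maxC' [/andP[xl ly] yM] CE CE']]]] := wall_cones maxC l0 lM Cl1 Cl nCl.
have dly : d (V l) (V y) < 0 by apply: (cb_lt' cb); lia.
have xly : (x < l < y)%N by rewrite xl.
have [q qs [Cq Cq1]] := consecutive_cones clock maxC maxC' xly yM lM CE CE' dly.
have [t] := nlin q qs; rewrite -Cq -Cq1; apply.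
have [FC _] := maxC; have [FC' _] := maxC'.
have C'l1 : lat C' (V l.+1).
  by rewrite CE' lat_wedge; split; apply: (cb_le cb); lia.
have C'l : lat C' (V l).
  by rewrite CE' lat_wedge; split; apply: (cb_le cb); lia.
have supp m : (m < M)%N -> D (V m) by apply: (cb_supp fanF propF cb).
have lp : l.-1.+1 = l by lia.
apply: (union_linear fanF (f_lin t) FC FC' Cl1 Cl C'l C'l1).
- by rewrite -[in X in d _ X]lp; apply: (cb_uni cb); lia.
- exact: (cb_uni cb).
- have : d (V l.-1) (V l.+1) <= 0 by apply: (cb_le cb); lia.
  lia.
- by apply: (lat_suppD fanF); apply: supp; lia.
- apply: (flat_between fanF propF (f_lin t) (supp i iM) (supp j jM)) => //.
  + by apply: supp; lia.
  + by apply: supp; lia.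
  + exact: (hilbert_primitive fanF propF (cb_hilbert iM)).
  + have ijM : (i < j < M)%N by lia.
    have [|[_ _ VN]] := cb_lt cb ijM; first by left.
    right; split=> //; exists (V l); first by apply: supp; lia.
    by apply: (cb_lt' cb); lia.
  + by apply: (cb_le cb); lia.
  + by apply: (cb_le cb); lia.
  + by apply: (cb_le cb); lia.
  + by apply: (cb_le cb); lia.
- by move=> u w; apply: (union_closed CE CE' xly yM).
Qed.

End Gap.

Theorem theorem1p9 (R : comNzRingType) (K : realType) (n : nat)
    (p : 'I_n -> R) (F : set (set (plane K))) (f : 'I_n -> lattice -> nat) :
  noetherian R -> is_fan F -> (forall t, fan_linear F (f t)) ->
  proper_rational_cone (fan_support F) ->
  exists (M : nat) (v : M.-tuple lattice) (S : families R M),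
    [/\ is_clockwise_enum (fan_hilbert F) v,
        are_resolution_families p f v S,
        (* the free modules, the Z^2-grading and exactness; the modules of
           homological degree j > M - 2 are zero *)
        [/\ forall j, #|idx M j.+1| = (j.+1 * 'C(M.-1, j.+2))%N,
            is_Z2_graded p f v S
          & forall j h, phi S j h = 0 <-> exists h', h = phi S j.+1 h'],
        [/\ range (phi0 p f v) = fan_algebra p f F,
            forall P : {mpoly R[M]}, (exists h, phi S 0 h = [ffun=> P]) -> phi0 p f v P = 0
          & (forall t, GRing.lreg (p t)) ->
            forall P : {mpoly R[M]}, phi0 p f v P = 0 -> exists h, phi S 0 h = [ffun=> P]]
      & forall (G : int -> set R) (m : set R),
          is_Zgrading G -> is_star_local G m -> strict F f ->
          (forall t, GRing.lreg (p t)) -> (forall t, m (p t)) ->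
          is_minimal p f v S m].

Proof.
move=> _ fanF f_lin propF.
have [v cb] := clockwise_basis_exists fanF propF.
have chain := clockwise_good_chain fanF propF f_lin cb.
have gb := family0_groebner p chain.
exists (size v), (in_tuple v), (tower_families (family0 p f (in_tuple v))).
split.
- exact: cb_enum cb.
- exact: (resolution_families p chain).
- split; [exact: card_idx | split | exact: (tower_exact gb)].
  + move=> u P Pu w wu; exact: phi0_graded Pu _ wu.
  + by move=> j u h; apply: (tower_phi_homog gb (family0_homog chain)).
- split; [exact: (phi0_range p chain) | exact: (phi0_image0 chain) |].
  by move=> pR P; apply: (kernel_phi0 chain).
- move=> G m _ [[[mI _] _ _] _] strictF pR pm.
  apply: (resolution_minimal chain mI) => // i j k k' a b ij kk' E ab.
  apply: ppow_mem => //.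
  have kM : (k.+1 < size v)%N by rewrite -kk'.
  rewrite !tnthV kk' in E.
  have [t lt] := strict_gap fanF propF f_lin cb strictF ij (ltn_ord j) kM E ab.
  by exists t; rewrite /gam !tnthV subn_gt0.
Qed.
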